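(* Let $\Omega$ be a Polish space, $c\in L^\infty(\Omega\times\Omega)$, and $P,Q$ Borel probability measures on $\Omega$. Let $\mathrm d_S(P,Q):=\mathbb E_{(X,Y)\sim\pi_{P,Q}}[c(X,Y)]$ be the Sinkhorn cost. As $n,m\to\infty$ with $\frac{m}{n+m}\to\lambda\in(0,1)$, $$\sqrt{\frac{nm}{n+m}}\big(\mathrm d_S(P_n,Q_m)-\mathrm d_S(P,Q)\big)\to\mathcal N(0,\sigma_\lambda^2(c))\quad\text{in distribution},$$ where $$\sigma_\lambda^2(c)=\lambda\operatorname{Var}_{X\sim P}\big[(I_{L^2_0(P)}-A_QA_P)^{-1}(c_{\mathrm x}-A_Qc_{\mathrm y})(X)\big]+(1-\lambda)\operatorname{Var}_{Y\sim Q}\big[(I_{L^2_0(Q)}-A_PA_Q)^{-1}(c_{\mathrm y}-A_Pc_{\mathrm x})(Y)\big].$$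
   Context: $L^\infty$ denotes bounded Borel-measurable functions. Put $C(x,y)=\exp(-c(x,y))$. For Borel probability measures $P,Q$ on $\Omega$, the entropic optimal transport plan $\pi_{P,Q}$ is the unique minimizer of $\int c\,d\pi+\mathrm{KL}(\pi\mid P\otimes Q)$ over couplings $\pi\in\Pi(P,Q)$. The potentials are the unique bounded measurable $f_{P,Q},g_{P,Q}:\Omega\to\mathbb R$ with, everywhere on $\Omega$, $f_{P,Q}=-\log\int C(\cdot,y)e^{g_{P,Q}(y)}dQ(y)$, $g_{P,Q}=-\log\int C(x,\cdot)e^{f_{P,Q}(x)}dP(x)$, and $\int g_{P,Q}\,dQ=0$. With $\xi_{P,Q}(x,y)=C(x,y)e^{f_{P,Q}(x)+g_{P,Q}(y)}$, $d\pi_{P,Q}=\xi_{P,Q}\,d(P\otimes Q)$. Samples: $X_1,\dots,X_n$ i.i.d. $\sim P$ and $Y_1,\dots,Y_m$ i.i.d. $\sim Q$ are mutually independent, $P_n=\frac1n\sum_i\delta_{X_i}$, $Q_m=\frac1m\sum_j\delta_{Y_j}$. Operators: $(A_Pf)(y)=\int\xi_{P,Q}(x,y)f(x)dP(x)$, $(A_Qg)(x)=\int\xi_{P,Q}(x,y)g(y)dQ(y)$. $L^2_0(\mu)$ denotes the mean-zero functions in $L^2(\mu)$; $I_{L^2_0(P)}-A_QA_P$ and $I_{L^2_0(Q)}-A_PA_Q$ have bounded inverses on $L_0^2(P)$ and $L_0^2(Q)$. Functions: $c_{\mathrm x}(x)=\int c(x,y)\xi_{P,Q}(x,y)dQ(y)$,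 $c_{\mathrm y}(y)=\int c(x,y)\xi_{P,Q}(x,y)dP(x)$. *)

(* Defs.v *)
From HB Require Import structures.
From mathcomp Require Import all_boot all_order all_algebra finmap.
From mathcomp Require Import all_classical all_reals all_analysis.

Set Implicit Arguments.
Unset Strict Implicit.
Unset Printing Implicit Defensive.

Import Order.TTheory GRing.Theory Num.Theory.
Import numFieldNormedType.Exports.

Local Open Scope classical_set_scope.
Local Open Scope ring_scope.

(* Hausdorff pseudometric spaces are exactly metric spaces, so this says that
   the topology of T is induced by a complete metric and has a countable dense
   subset. *)
Definition polish_space (R : realType) (T : topologicalType) : Prop :=
  (exists (M : completePseudoMetricType R) (f : T -> M) (g : M -> T),
     [/\ hausdorff_space M, cancel f g, cancel g f, continuous f
       & continuous g]) /\
  (exists2 D : set T, countable D & dense D).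

(* For a Polish space T, the product sigma-algebra of borel T * borel T, on which
   couplings and product measures live, coincides with that of borel (T * T). *)
Notation borel T := (g_sigma_algebraType (@open T)).

Definition bounded_measurable d (T : measurableType d) (R : realType)
    (f : T -> R) : Prop :=
  measurable_fun [set: T] f /\ bounded_fun f.

Section entropic_optimal_transport.
Context {d : measure_display} {T : measurableType d} {R : realType}.
Implicit Types (c : T * T -> R) (P Q : probability T R).
Local Open Scope ereal_scope.

Definition coupling P Q : set (probability (T * T)%type R) :=
  [set pi | forall A, measurable A ->
     pi (fst @^-1` A) = P A /\ pi (snd @^-1` A) = Q A].

(* KL(pi | mu) is the pi-integral of log(dpi/dmu) when pi is absolutely
   continuous with respect to mu, and +oo otherwise. *)
Definition KL d' (S : measurableType d') (pi mu : probability S R) : \bar R :=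
  if `[< pi `<< mu >]
  then \int[pi]_z (ln (fine (Radon_Nikodym (charge_of_finite_measure pi) mu z)))%:E
  else +oo.

Definition eot_objective c P Q (pi : probability (T * T)%type R) : \bar R :=
  \int[pi]_z (c z)%:E + KL pi (P \x Q).

Definition is_eot_plan c P Q : set (probability (T * T)%type R) :=
  [set pi | coupling P Q pi /\
     forall pi', coupling P Q pi' ->
       eot_objective c P Q pi <= eot_objective c P Q pi'].

Local Close Scope ereal_scope.

(* The minimizer is unique as a measure; [get] selects it. *)
Definition eot_plan c P Q : probability (T * T)%type R :=
  get (is_eot_plan c P Q).

Definition sinkhorn_cost c P Q : R := \int[eot_plan c P Q]_z c z.

Definition is_eot_potentials c P Q : set ((T -> R) * (T -> R)) :=
  [set fg | [/\ bounded_measurable fg.1, bounded_measurable fg.2,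
     forall x, fg.1 x = - ln (\int[Q]_y (expR (- c (x, y)) * expR (fg.2 y))),
     forall y, fg.2 y = - ln (\int[P]_x (expR (- c (x, y)) * expR (fg.1 x)))
   & \int[Q]_y fg.2 y = 0]].

Definition eot_potentials c P Q : (T -> R) * (T -> R) :=
  xget (cst 0, cst 0) (is_eot_potentials c P Q).

Definition eot_density c P Q (x y : T) : R :=
  let fg := eot_potentials c P Q in
  expR (- c (x, y)) * expR (fg.1 x + fg.2 y).

(* A_P acts on functions of x and returns functions of y; A_Q conversely. *)
Definition opA_P c P Q (f : T -> R) (y : T) : R :=
  \int[P]_x (eot_density c P Q x y * f x).

Definition opA_Q c P Q (g : T -> R) (x : T) : R :=
  \int[Q]_y (eot_density c P Q x y * g y).

Definition c_x c P Q (x : T) : R := \int[Q]_y (c (x, y) * eot_density c P Q x y).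

Definition c_y c P Q (y : T) : R := \int[P]_x (c (x, y) * eot_density c P Q x y).

Definition L2_0 (mu : probability T R) : set (T -> R) :=
  [set u | u \in Lfun mu 2%:E /\ \int[mu]_x u x = 0].

(* (I - K)^-1 h on L^2_0(mu): the u in L^2_0(mu) with (I - K) u = h. Elements
   of L^2(mu) are represented by functions, so the equation holds mu-almost
   everywhere and u is determined up to mu-almost everywhere equality. *)
Definition inv_subI (mu : probability T R) (K : (T -> R) -> (T -> R))
    (h : T -> R) : T -> R :=
  xget (cst 0) [set u | L2_0 mu u /\ {ae mu, forall x, u x - K u x = h x}].

Definition sinkhorn_variance c P Q (lambda : R) : R :=
  let A_P := opA_P c P Q in
  let A_Q := opA_Q c P Q in
  let cx := c_x c P Q in
  let cy := c_y c P Q in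
  lambda * fine 'V_P[inv_subI P (A_Q \o A_P) (cx \- A_Q cy)] +
  (1 - lambda) * fine 'V_Q[inv_subI Q (A_P \o A_Q) (cy \- A_P cx)].

(* The sum of the Dirac masses at x_0, ..., x_(n-1) has total mass n, so
   [mnormalize] divides it by n; its second argument is used only if n = 0. *)
Definition empirical (x : nat -> T) (n : nat) : probability T R :=
  mnormalize (msum (fun i => dirac (x i)) n) (dirac point).

Lemma empiricalE (x : nat -> T) (n : nat) (A : set T) : (0 < n)%N ->
  empirical x n A = ((n%:R^-1)%:E * \sum_(i < n) \d_(x i) A)%E.
Proof.
move=> n0; rewrite /empirical /= /mnormalize /=.
rewrite (_ : msum _ _ [set: T] = n%:R%:E); last first.
  rewrite /msum (eq_bigr (fun=> 1%E)) => [|i _]; last by rewrite /= diracT.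
  by rewrite sumEFin sumr_const card_ord.
by rewrite orbF eqe pnatr_eq0 gtn_eqF//= muleC.
Qed.

End entropic_optimal_transport.

(* [normal_prob 0 0] is not the Dirac mass at 0 in the library, hence the case
   distinction. *)
Definition gaussian {R : realType} (v : R) : probability (measurableTypeR R) R :=
  if v == 0 then (@dirac _ (measurableTypeR R) (0 : R) R : probability _ R)
  else (normal_prob 0 (Num.sqrt v) : probability _ R).

Section random_variables.
Context {d : measure_display} {W : measurableType d} {R : realType}.
Variable Pr : probability W R.

Definition mutually_independent (I : choiceType) d' (T : measurableType d')
    (Z : I -> W -> T) : Prop :=
  forall (J : {fset I}) (A : I -> set T), (forall i, measurable (A i)) ->
    Pr (\bigcap_(i in [set` J]) Z i @^-1` A i) =
    (\prod_(i <- J) Pr (Z i @^-1` A i))%E.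

Definition has_law d' (T : measurableType d') (Z : {RV Pr >-> T})
    (mu : probability T R) : Prop :=
  forall A, measurable A -> distribution Pr Z A = mu A.

(* That the Z k are random variables is part of the assertion. *)
Definition cvg_in_distribution (Z : nat -> W -> R)
    (mu : probability (measurableTypeR R) R) : Prop :=
  (forall k, measurable_fun [set: W] (Z k)) /\
  forall h : R -> R, continuous h -> bounded_fun h ->
    'E_Pr[h \o Z k]%E @[k --> \oo] --> (\int[mu]_x (h x)%:E)%E.

End random_variables.

(* Main.v *)
(* Let [u, v] solve the linear system [u + A_Q v = c_x], [v + A_P u = c_y]; it is
   solvable because the density [xi] of the plan is bounded below, so that
   [A_Q A_P] contracts the bounded mean-zero functions. Then [w = (c - u - v) xi]
   integrates to zero in each variable. For any marginals [P', Q'] the density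
   of the new plan is [xi e^(a + b)] with [a, b] the change of the potentials, so
     cost (P', Q') - cost (P, Q) = (P' - P) u + (Q' - Q) v
       + \int w d(P' x Q') + \int w (e^(a + b) - 1) d(P' x Q'),
   and strong convexity of the dual problem bounds [a, b] in mean square by the
   marginal defects of [xi]. For empirical measures all error terms are
   degenerate two-sample statistics of size [O(1/n + 1/m)] in mean.

   The remaining sum of independent terms is compared with the Gaussian law by
   Lindeberg's replacement method, interpolating along the heat flow of a
   Lipschitz test function; continuous test functions are squeezed between
   Lipschitz ones. *)

Require Import Defs.
From HB Require Import structures.
From mathcomp Require Import all_boot all_order all_algebra finmap.
From mathcomp Require Import all_classical all_reals all_analysis.
From mathcomp Require Import measurable_realfun ring lra.

Set Implicit Arguments.
Unset Strict Implicit.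
Unset Printing Implicit Defensive.

Import Order.TTheory GRing.Theory Num.Theory.
Import numFieldNormedType.Exports.

Local Open Scope classical_set_scope.
Local Open Scope ring_scope.

(** The linear system is chosen so that the potentials drop out at first order: [w] is centred in
    each variable under [P] and [Q], hence [\int w (a + b)] is a product of two small quantities,
    and [a], [b] only have to be bounded in mean square. All estimates concern bounded measurable
    functions, with explicit constants in a bound [K] of [|c|]. The constants are the same for all
    marginals, in particular for every realization of the empirical measures, so the expansion of
    the cost is a pathwise inequality before any expectation is taken. Two objects are selected by
    choice. The plan is some minimizer, so the cost is computed for every minimizer by duality. The
    inverse operators return some solution in [L2_0], so solutions are shown to agree almost
    everywhere. The cost must also be measurable in the sample: the potentials at the sample points
    are limits of Sinkhorn iterates, which are finite expressions in the sample. *)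

Local Notation bmeas := bounded_measurable.
Local Notation bmeasR h := (@bounded_measurable _ (measurableTypeR _) _ h).

(** * Bounded measurable functions *)

Section bounded_measurable.
Context d (T : measurableType d) (R : realType).
Implicit Types f g : T -> R.

Lemma bmeasP f : bmeas f <->
  measurable_fun [set: T] f /\ exists M : R, forall x, `|f x| <= M.
Proof.
split=> -[mf bf]; split=> //.
  case: bf => M [_ /(_ (M + 1))]; rewrite ltrDl ltr01 => /(_ isT) bf.
  by exists (M + 1) => x; exact: bf.
case: bf => M bf; exists M; split; first exact: num_real.
by move=> N MN x _; rewrite /= (le_trans (bf x))// ltW.
Qed.

Lemma bmeas_fun f : bmeas f -> measurable_fun [set: T] f.
Proof. by case. Qed.

Lemma bmeas_bound f : bmeas f ->
  exists2 M : R, 0 <= M & forall x, `|f x| <= M.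
Proof.
move=> /bmeasP[_ [M fM]].
by exists M => //; rewrite (le_trans _ (fM point)).
Qed.

Lemma bmeas_intro f M : measurable_fun [set: T] f ->
  (forall x, `|f x| <= M) -> bmeas f.
Proof. by move=> mf fM; apply/bmeasP; split=> //; exists M. Qed.

Lemma bmeas_cst (r : R) : bmeas (fun _ : T => r).
Proof. exact: (@bmeas_intro _ `|r|). Qed.

Lemma bmeasD f g : bmeas f -> bmeas g ->
  bmeas (fun x => f x + g x).
Proof.
move=> /bmeasP[mf [M fM]] /bmeasP[mg [N gN]].
apply: (@bmeas_intro _ (M + N)); first exact: measurable_funD.
by move=> x; rewrite (le_trans (ler_normD _ _))// lerD.
Qed.

Lemma bmeasN f : bmeas f ->
  bmeas (fun x => - f x).
Proof.
move=> /bmeasP[mf [M fM]].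
apply: (@bmeas_intro _ M); first exact: measurableT_comp.
by move=> x; rewrite normrN.
Qed.

Lemma bmeasB f g : bmeas f -> bmeas g ->
  bmeas (fun x => f x - g x).
Proof. by move=> bf bg; exact/bmeasD/bmeasN. Qed.

Lemma bmeasM f g : bmeas f -> bmeas g ->
  bmeas (fun x => f x * g x).
Proof.
move=> /bmeasP[mf [M fM]] /bmeasP[mg [N gN]].
apply: (@bmeas_intro _ (M * N)); first exact: measurable_funM.
by move=> x; rewrite normrM ler_pM.
Qed.

Lemma bmeas_sqr f : bmeas f ->
  bmeas (fun x => f x ^+ 2).
Proof. by move=> bf; under eq_fun do rewrite expr2; exact: bmeasM. Qed.

Lemma bmeas_norm f : bmeas f ->
  bmeas (fun x => `|f x|).
Proof.
move=> /bmeasP[mf [M fM]].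
apply: (@bmeas_intro _ M); first exact: measurableT_comp.
by move=> x; rewrite normr_id.
Qed.

Lemma bmeas_expR f : bmeas f ->
  bmeas (fun x => expR (f x)).
Proof.
move=> /bmeasP[mf [M fM]].
apply: (@bmeas_intro _ (expR M)); first exact: measurableT_comp.
by move=> x; rewrite ger0_norm ?expR_ge0// ler_expR (le_trans (ler_norm _)).
Qed.

Lemma bmeas_sum (I : Type) (s : seq I) (F : I -> T -> R) :
  (forall i, bmeas (F i)) ->
  bmeas (fun x => \sum_(i <- s) F i x).
Proof.
move=> bF; elim: s => [|i s IH].
  by under eq_fun do rewrite big_nil; exact: bmeas_cst.
by under eq_fun do rewrite big_cons; exact: bmeasD.
Qed.

End bounded_measurable.

Lemma bmeas_comp d d' (T : measurableType d) (S : measurableType d')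
    (R : realType) (h : S -> T) (f : T -> R) :
  bmeas f -> measurable_fun [set: S] h ->
  bmeas (fun x => f (h x)).
Proof.
move=> /bmeasP[mf [M fM]] mh.
by apply: (@bmeas_intro _ _ _ _ M); first exact: measurableT_comp.
Qed.

Lemma EFin_Rintegral d (T : measurableType d) (R : realType)
    (mu : {measure set T -> \bar R}) (f : T -> R) : mu.-integrable setT (EFin \o f) ->
  (\int[mu]_x (f x)%:E)%E = (\int[mu]_x f x)%:E.
Proof. by move=> fi; rewrite /Rintegral fineK//; exact: integrable_fin_num. Qed.

Section bounded_integral.
Context d (T : measurableType d) (R : realType) (P : probability T R).
Implicit Types f g : T -> R.

Lemma bmeas_integrable f : bmeas f ->
  P.-integrable [set: T] (EFin \o f).
Proof.
case=> mf bf; apply: measurable_bounded_integrable => //.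
exact: le_lt_trans (probability_le1 P measurableT) (ltry _).
Qed.

Lemma EFin_integral_bounded f : bmeas f ->
  (\int[P]_x (f x)%:E)%E = (\int[P]_x f x)%:E.
Proof. by move=> /bmeas_integrable; exact: EFin_Rintegral. Qed.

Lemma integral_cst1 r : \int[P]_x r = r.
Proof. by rewrite Rintegral_cst//= probability_setT mulr1. Qed.

Lemma integral_boundedD f g : bmeas f -> bmeas g ->
  \int[P]_x (f x + g x) = \int[P]_x f x + \int[P]_x g x.
Proof. by move=> bf bg; rewrite RintegralD//; exact: bmeas_integrable. Qed.

Lemma integral_boundedB f g : bmeas f -> bmeas g ->
  \int[P]_x (f x - g x) = \int[P]_x f x - \int[P]_x g x.
Proof. by move=> bf bg; rewrite RintegralB//; exact: bmeas_integrable. Qed.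

Lemma integral_boundedZ r f : bmeas f ->
  \int[P]_x (r * f x) = r * \int[P]_x f x.
Proof. by move=> bf; rewrite RintegralZl//; exact: bmeas_integrable. Qed.

Lemma integral_boundedZr r f : bmeas f ->
  \int[P]_x (f x * r) = \int[P]_x f x * r.
Proof. by move=> bf; rewrite RintegralZr//; exact: bmeas_integrable. Qed.

Lemma integral_bounded_sum (I : Type) (s : seq I) (F : I -> T -> R) :
  (forall i, bmeas (F i)) ->
  \int[P]_x (\sum_(i <- s) F i x) = \sum_(i <- s) \int[P]_x F i x.
Proof.
move=> bF; elim: s => [|i s IH].
  by rewrite big_nil; under eq_Rintegral do rewrite big_nil; rewrite integral_cst1.
rewrite big_cons; under eq_Rintegral do rewrite big_cons.
by rewrite integral_boundedD// ?IH//; exact: bmeas_sum.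
Qed.

Lemma le_integral_bounded f g : bmeas f -> bmeas g ->
  (forall x, f x <= g x) -> \int[P]_x f x <= \int[P]_x g x.
Proof. by move=> bf bg fg; apply: le_Rintegral => //; exact: bmeas_integrable. Qed.

Lemma integral_bounded_le f r : bmeas f ->
  (forall x, f x <= r) -> \int[P]_x f x <= r.
Proof.
move=> bf fr; rewrite -[leRHS]integral_cst1.
by apply: le_integral_bounded => //; exact: bmeas_cst.
Qed.

Lemma integral_bounded_ge f r : bmeas f ->
  (forall x, r <= f x) -> r <= \int[P]_x f x.
Proof.
move=> bf fr; rewrite -[leLHS]integral_cst1.
by apply: le_integral_bounded => //; exact: bmeas_cst.
Qed.

Lemma integral_bounded_norm f r : bmeas f ->
  (forall x, `|f x| <= r) -> `|\int[P]_x f x| <= r.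
Proof.
move=> bf fr; rewrite ler_norml; apply/andP; split.
  by apply: integral_bounded_ge => // x; move: (fr x); rewrite ler_norml => /andP[].
by apply: integral_bounded_le => // x; move: (fr x); rewrite ler_norml => /andP[].
Qed.

Lemma le_norm_integral_bounded f : bmeas f ->
  `|\int[P]_x f x| <= \int[P]_x `|f x|.
Proof. by move=> bf; apply: le_normr_Rintegral => //; exact: bmeas_integrable. Qed.

Lemma bmeas_ln f r : bmeas f -> 0 < r ->
  (forall x, r <= f x) -> bmeas (fun x => ln (f x)).
Proof.
move=> /bmeasP[mf [M fM]] r0 rf.
have f0 x : 0 < f x by exact: lt_le_trans (rf x).
apply: (@bmeas_intro _ _ _ _ (`|ln r| + `|ln M|)).
  exact: measurableT_comp.
move=> x; have fx : f x <= M by rewrite (le_trans (ler_norm _)).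
have M0 : 0 < M by exact: lt_le_trans fx.
have h1 : ln r <= ln (f x) by rewrite ler_ln ?posrE.
have h2 : ln (f x) <= ln M by rewrite ler_ln ?posrE.
have := ler_norm (ln M); have := ler_norm (- ln r); rewrite normrN.
have := normr_ge0 (ln r); have := normr_ge0 (ln M).
rewrite ler_norml; lra.
Qed.

End bounded_integral.

Section bounded_fubini.
Context d1 d2 (T1 : measurableType d1) (T2 : measurableType d2) (R : realType).
Implicit Types (F : T1 * T2 -> R) (P : probability T1 R) (Q : probability T2 R).

Lemma bmeas_fst F y : bmeas F ->
  bmeas (fun x => F (x, y)).
Proof. by move=> bF; apply: bmeas_comp => //; exact: pair2_measurable. Qed.

Lemma bmeas_snd F x : bmeas F ->
  bmeas (fun y => F (x, y)).
Proof. by move=> bF; apply: bmeas_comp => //; exact: pair1_measurable. Qed.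

Lemma bounded_integrable_prod P Q F : bmeas F ->
  (P \x Q)%E.-integrable setT (EFin \o F).
Proof.
exact: (@bmeas_integrable _ _ _ (P \x Q)%E F).
Qed.

Lemma bmeas_integral_snd Q F : bmeas F ->
  bmeas (fun x => \int[Q]_y F (x, y)).
Proof.
move=> bF; have [M M0 FM] := bmeas_bound bF.
apply: (@bmeas_intro _ _ _ _ M); last first.
  by move=> x; apply: integral_bounded_norm => //; exact: bmeas_snd.
apply/measurable_EFinP.
(* The claim involves no measure on the first factor; a Dirac mass fills that slot of the product
   measure. *)
apply: eq_measurable_fun (measurable_fubini_F
  (bounded_integrable_prod (@dirac _ T1 point R : probability _ _) Q bF)).
move=> x _ /=.
by rewrite /fubini_F EFin_integral_bounded//; exact: bmeas_snd.
Qed.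

Lemma bmeas_integral_fst P F : bmeas F ->
  bmeas (fun y => \int[P]_x F (x, y)).
Proof.
move=> bF; have [M M0 FM] := bmeas_bound bF.
apply: (@bmeas_intro _ _ _ _ M); last first.
  by move=> x; apply: integral_bounded_norm => //; exact: bmeas_fst.
apply/measurable_EFinP.
apply: eq_measurable_fun (measurable_fubini_G
  (bounded_integrable_prod P (@dirac _ T2 point R : probability _ _) bF)).
move=> x _ /=.
by rewrite /fubini_G EFin_integral_bounded//; exact: bmeas_fst.
Qed.

Lemma integral_prod_bounded P Q F : bmeas F ->
  (\int[P \x Q]_z (F z)%:E)%E = (\int[P]_x \int[Q]_y F (x, y))%:E.
Proof.
move=> bF; rewrite -integral12_prod_meas1; last exact: bounded_integrable_prod.
rewrite -EFin_integral_bounded; last exact: bmeas_integral_snd.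
apply: eq_integral => x _; rewrite /fubini_F EFin_integral_bounded//.
exact: bmeas_snd.
Qed.

Lemma bounded_fubini P Q F : bmeas F ->
  \int[P]_x \int[Q]_y F (x, y) = \int[Q]_y \int[P]_x F (x, y).
Proof.
move=> bF; apply: EFin_inj; rewrite -integral_prod_bounded//.
rewrite -integral21_prod_meas1; last exact: bounded_integrable_prod.
rewrite -EFin_integral_bounded; last exact: bmeas_integral_fst.
apply: eq_integral => x _; rewrite /fubini_G EFin_integral_bounded//.
exact: bmeas_fst.
Qed.

End bounded_fubini.

Section centering.
Context d (T : measurableType d) (R : realType) (mu : probability T R) (f : T -> R).
Hypothesis bf : bmeas f.

Let bm := bmeas_cst T (\int[mu]_x f x).

Lemma bmeas_center a : bmeas (fun x => a * (f x - \int[mu]_x f x)).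
Proof.
apply: bmeasM; first exact: bmeas_cst.
exact: bmeasB.
Qed.

Lemma integral_center a : \int[mu]_x (a * (f x - \int[mu]_x f x)) = 0.
Proof.
rewrite integral_boundedZ; last exact: bmeasB.
by rewrite integral_boundedB// integral_cst1 subrr mulr0.
Qed.

Lemma integral_center_sqr a : \int[mu]_x ((a * (f x - \int[mu]_x f x)) ^+ 2) =
  a ^+ 2 * (\int[mu]_x (f x ^+ 2) - (\int[mu]_x f x) ^+ 2).
Proof.
have bf2 : bmeas (fun x => f x ^+ 2) := bmeas_sqr bf.
have b1 : bmeas (fun x => a ^+ 2 * f x ^+ 2).
  by apply: bmeasM => //; exact: bmeas_cst.
set m := \int[mu]_x f x.
have b2 : bmeas (fun x => (2 * a ^+ 2 * m) * f x).
  by apply: bmeasM => //; exact: bmeas_cst.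
have b3 := bmeas_cst T (a ^+ 2 * m ^+ 2).
transitivity (\int[mu]_x ((a ^+ 2 * f x ^+ 2 - 2 * a ^+ 2 * m * f x) + a ^+ 2 * m ^+ 2)).
  by apply: eq_Rintegral => x _; move: (f x) (m) => y z; ring.
rewrite (integral_boundedD _ (bmeasB b1 b2) b3) (integral_boundedB _ b1 b2).
by rewrite (integral_boundedZ _ _ bf2) (integral_boundedZ _ _ bf) integral_cst1 -/m; move: (\int[mu]_x _) (m) => y z; ring.
Qed.

Lemma variance_integral_ge0 : 0 <= \int[mu]_x (f x ^+ 2) - (\int[mu]_x f x) ^+ 2.
Proof.
rewrite -[leRHS]mul1r -[X in X * _](expr1n R 2) -integral_center_sqr.
by apply: Rintegral_ge0 => x _; exact: sqr_ge0.
Qed.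

End centering.

(** * The Sinkhorn iteration *)

Lemma cvg_geometric0 (R : realType) (C q : R) : 0 <= q < 1 ->
  (fun k => C * q ^+ k) @ \oo --> (0 : R).
Proof.
move=> /andP[q0 q1]; rewrite -[X in _ --> X](mulr0 C).
by apply: cvgM; [exact: cvg_cst|apply: cvg_expr; rewrite ger0_norm].
Qed.

Lemma geometric_cauchy_limit d (T : measurableType d) (R : realType)
    (h : nat -> T -> R) (C q : R) :
  0 <= C -> 0 <= q < 1 -> (forall k, bmeas (h k)) ->
  (forall k x, `|h k.+1 x - h k x| <= C * q ^+ k) ->
  exists2 l : T -> R, bmeas l &
    forall k x, `|l x - h k x| <= C / (1 - q) * q ^+ k.
Proof.
move=> C0 /andP[q0 q1] bh hC.
have q1' : 0 < 1 - q by rewrite subr_gt0.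
have step k j x : `|h (k + j)%N x - h k x| <= C / (1 - q) * q ^+ k * (1 - q ^+ j).
  elim: j => [|j IH]; first by rewrite addn0 subrr normr0 expr0 subrr mulr0.
  rewrite addnS; have := ler_normD (h (k + j).+1 x - h (k + j)%N x) (h (k + j)%N x - h k x).
  rewrite addrA subrK => /le_trans; apply.
  rewrite (le_trans (lerD (hC _ _) IH))// exprD exprS le_eqVlt; apply/orP; left.
  by apply/eqP; field; rewrite gt_eqF.
have step' k j x : (k <= j)%N -> `|h j x - h k x| <= C / (1 - q) * q ^+ k.
  move=> kj; rewrite -(subnKC kj) (le_trans (step _ _ _))// ler_piMr//.
    by rewrite mulr_ge0 ?exprn_ge0// divr_ge0// ltW.
  by rewrite lerBlDr lerDl exprn_ge0.
pose b k := C / (1 - q) * q ^+ k.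
have b0 : b @ \oo --> (0 : R) by apply: cvg_geometric0; rewrite q0.
(* Adding the geometric tail [b k] turns [h k x] into a nonincreasing sequence, because
   [b k - b k.+1] is exactly the allowed increment [C * q ^+ k]; it is bounded below, so it
   converges. *)
have cvgh x : cvgn (h ^~ x).
  have -> : h ^~ x = (fun k => (h k x + b k) - b k) by apply/funext => k; rewrite addrK.
  apply: is_cvgB; last by apply/cvg_ex; exists 0.
  apply: nonincreasing_is_cvgn.
    apply/nonincreasing_seqP => k; have := hC k x.
    have bS : b k.+1 = b k - C * q ^+ k.
      by rewrite /b exprS; field; rewrite gt_eqF.
    by rewrite bS ler_norml => /andP[_]; lra.
  exists (h 0%N x - b 0%N) => _ [k _ <-].
  have := step' 0%N k x (leq0n _); rewrite -/(b 0%N) ler_norml => /andP[+ _].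
  have : 0 <= b k by rewrite /b mulr_ge0 ?exprn_ge0// divr_ge0// ltW.
  by move=> ? ?; lra.
have hl k x : `|limn (h ^~ x) - h k x| <= b k.
  rewrite ler_norml lerBlDr lerBrDr; apply/andP; split.
    apply: (@cvgr_to_ge _ _ _ _ _ _ _ (cvgh x)); near=> j.
    have kj : (k <= j)%N by near: j; exact: nbhs_infty_ge.
    by have := step' _ _ x kj; rewrite -/(b k) ler_norml => /andP[]; lra.
  apply: (@cvgr_to_le _ _ _ _ _ _ _ (cvgh x)); near=> j.
  have kj : (k <= j)%N by near: j; exact: nbhs_infty_ge.
  by have := step' _ _ x kj; rewrite -/(b k) ler_norml => /andP[]; lra.
exists (fun x => limn (h ^~ x)); last exact: hl.
have [M M0 hM] := bmeas_bound (bh 0%N).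
apply: (@bmeas_intro _ _ _ _ (b 0%N + M)).
  apply: (@measurable_fun_cvg _ _ _ _ h) => [k|x _]; last exact: cvgh.
  exact: bmeas_fun.
move=> x; rewrite -[X in `|X|](subrK (h 0%N x)) (le_trans (ler_normD _ _))//.
by rewrite lerD.
Unshelve. all: by end_near.
Qed.

(** Converts a shared mass [k] into a contraction of the exponent. After factoring out [expR s], it
    remains to use [1 - t <= expR (- t)] and [1 - expR (- s) >= s * expR (- s) >= s * expR (-
    S)]. *)
Lemma expR_mixture_le (R : realType) (k s S : R) : 0 <= k -> 0 <= s <= S ->
  k + (1 - k) * expR s <= expR ((1 - k * expR (- S)) * s).
Proof.
move=> k0 /andP[s0 sS].
have ss : expR (- s) * expR s = 1 by rewrite -expRD addNr expR0.
have -> : k + (1 - k) * expR s = (1 - k * (1 - expR (- s))) * expR s.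
  move: (expR s) (expR (- s)) ss => a b ba;
  have -> : k + (1 - k) * a = a - k * (a - b * a) by rewrite ba; ring.
  ring.
have -> : expR ((1 - k * expR (- S)) * s) = expR (- (k * expR (- S) * s)) * expR s.
  by rewrite -expRD; congr expR; ring.
rewrite ler_wpM2r ?expR_ge0// (le_trans _ (expR_ge1Dx _))//.
rewrite lerD2l lerN2 -mulrA ler_wpM2l//.
rewrite (@le_trans _ _ (expR (- s) * s))//.
  by rewrite ler_wpM2r// ler_expR lerN2.
have : expR (- s) * (1 + s) <= expR (- s) * expR s.
  by rewrite ler_wpM2l ?expR_ge0// expR_ge1Dx.
by rewrite ss; lra.
Qed.

(* If the density [p'] dominates [k p], then [p' - k p] has mass [1 - k]. *)
Lemma integral_minorized d (T : measurableType d) (R : realType)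
    (Q : probability T R) (p p' w : T -> R) (k M : R) :
  bmeas p -> bmeas p' -> bmeas w ->
  \int[Q]_y p y = 1 -> \int[Q]_y p' y = 1 ->
  (forall y, k * p y <= p' y) -> (forall y, w y <= M) ->
  \int[Q]_y (w y * p' y) <= k * \int[Q]_y (w y * p y) + (1 - k) * M.
Proof.
move=> bp bp' bw p1 p'1 pk wM.
have bwp : bmeas (fun y => w y * p y) by exact: bmeasM.
have bwp' : bmeas (fun y => w y * p' y) by exact: bmeasM.
have bk (a : R) z : bmeas z -> bmeas (fun y : T => a * z y).
  by move=> bz; apply: bmeasM => //; exact: bmeas_cst.
have : 0 <= \int[Q]_y ((M - w y) * (p' y - k * p y)).
  by apply: Rintegral_ge0 => y _; rewrite mulr_ge0// subr_ge0.
rewrite (@eq_Rintegral _ _ _ _ _ (fun y =>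
  M * p' y - M * k * p y - (w y * p' y - k * (w y * p y)))); last first.
  by move=> y _; ring.
rewrite integral_boundedB; [|apply: bmeasB; exact: bk|
  apply: bmeasB => //; exact: bk].
rewrite !integral_boundedB//; [|exact: bk..].
by rewrite !integral_boundedZ// p1 p'1; lra.
Qed.

(** One half-step of the Sinkhorn iteration. The two spaces are kept distinct so that the other
    half-step is the same operator for the swapped cost. *)
HB.lock Definition soft_min d1 d2 (T1 : measurableType d1) (T2 : measurableType d2)
    (R : realType) (c : T1 * T2 -> R) (Q : probability T2 R) (g : T2 -> R) (x : T1) : R :=
  - ln (\int[Q]_y (expR (- c (x, y)) * expR (g y))).

Section soft_min.
Context d1 d2 (T1 : measurableType d1) (T2 : measurableType d2) (R : realType).
Variables (c : T1 * T2 -> R) (K : R).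
Hypotheses (bc : bmeas c) (cK : forall z, `|c z| <= K).
Variable Q : probability T2 R.
Implicit Types g : T2 -> R.

Local Notation soft_min := (soft_min c Q).

Lemma bmeas_exp_cost : bmeas (fun z => expR (- c z)).
Proof. exact/bmeas_expR/bmeasN. Qed.

Lemma bmeas_exp_cost_fun g : bmeas g ->
  bmeas (fun z => expR (- c z) * expR (g z.2)).
Proof.
move=> bg; apply: bmeasM; first exact: bmeas_exp_cost.
by apply: bmeas_expR; exact: bmeas_comp.
Qed.

Let bCg g x : bmeas g ->
  bmeas (fun y => expR (- c (x, y)) * expR (g y)).
Proof. by move=> bg; exact: (bmeas_snd x (bmeas_exp_cost_fun bg)). Qed.

Lemma soft_min_integral_gt0 g : bmeas g ->
  exists2 r : R, 0 < r & forall x, r <= \int[Q]_y (expR (- c (x, y)) * expR (g y)).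
Proof.
move=> bg; have [M M0 gM] := bmeas_bound bg.
have [L L0 cL] := bmeas_bound bc.
exists (expR (- L) * expR (- M)); first by rewrite mulr_gt0 ?expR_gt0.
move=> x; apply: integral_bounded_ge; first exact: bCg.
move=> y; rewrite ler_pM ?expR_ge0// ler_expR.
  by rewrite lerN2 (le_trans (ler_norm _)).
by move: (gM y); rewrite ler_norml => /andP[].
Qed.

Lemma soft_minE g x : bmeas g ->
  expR (- soft_min g x) = \int[Q]_y (expR (- c (x, y)) * expR (g y)).
Proof.
move=> bg; have [r r0 rI] := soft_min_integral_gt0 bg.
by rewrite soft_min.unlock opprK lnK// posrE (lt_le_trans r0).
Qed.

Lemma bmeas_soft_min g : bmeas g ->
  bmeas (soft_min g).
Proof.
move=> bg; have [r r0 rI] := soft_min_integral_gt0 bg.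
rewrite soft_min.unlock; apply: bmeasN; apply: bmeas_ln r0 rI.
exact: (bmeas_integral_snd Q (bmeas_exp_cost_fun bg)).
Qed.

(* Two values of [soft_min] are compared through their exponentials, where the
   problem is linear. *)
Lemma soft_min_le g g' x x' r : bmeas g -> bmeas g' ->
  \int[Q]_y (expR (- c (x', y)) * expR (g' y)) <=
    expR r * \int[Q]_y (expR (- c (x, y)) * expR (g y)) ->
  soft_min g x <= soft_min g' x' + r.
Proof.
move=> bg bg'; rewrite -!soft_minE// -expRD ler_expR.
by move: (soft_min g x) (soft_min g' x') => a b; lra.
Qed.

Lemma soft_minD g s x : bmeas g ->
  soft_min (fun y => g y + s) x = soft_min g x - s.
Proof.
move=> bg; apply: oppr_inj; apply: expR_inj; rewrite soft_minE//; last first.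
  by apply: bmeasD => //; exact: bmeas_cst.
rewrite opprB addrC expRD soft_minE// -integral_boundedZr//; last exact: bCg.
by apply: eq_Rintegral => y _; rewrite expRD mulrA.
Qed.

Lemma soft_min_density g x : bmeas g ->
  \int[Q]_y (expR (- c (x, y)) * expR (soft_min g x + g y)) = 1.
Proof.
move=> bg; rewrite -[RHS](expR0) -(subrr (soft_min g x)) expRD soft_minE//.
rewrite -integral_boundedZ//; last exact: bCg.
by apply: eq_Rintegral => y _; rewrite expRD mulrCA.
Qed.

(** The bound involves neither [g] nor [Q]: changing [x] moves the cost by at most [2K] under the
    integral. The uniformity of all later constants in the marginals starts here. *)
Lemma soft_min_osc g x x' : bmeas g ->
  soft_min g x - soft_min g x' <= K *+ 2.
Proof.
move=> bg; rewrite lerBlDl; apply: soft_min_le => //.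
rewrite -integral_boundedZ//; last exact: bCg.
apply: le_integral_bounded; [exact: bCg| |].
  by apply: bmeasM; [exact: bmeas_cst|exact: bCg].
move=> y; rewrite mulrA ler_wpM2r ?expR_ge0// -expRD ler_expR.
have := cK (x, y); have := cK (x', y); rewrite !ler_norml; lra.
Qed.

Lemma soft_min_lipschitz g g' e x : bmeas g -> bmeas g' ->
  (forall y, `|g y - g' y| <= e) -> `|soft_min g x - soft_min g' x| <= e.
Proof.
have lip u v : bmeas u -> bmeas v ->
    (forall y, `|u y - v y| <= e) -> soft_min u x <= soft_min v x + e.
  move=> bu bv uv; apply: soft_min_le => //.
  rewrite -integral_boundedZ//; last exact: bCg.
  apply: le_integral_bounded; [exact: bCg| |].
    by apply: bmeasM; [exact: bmeas_cst|exact: bCg].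
  move=> y; rewrite mulrCA ler_wpM2l ?expR_ge0// -expRD ler_expR.
  by move: (uv y); rewrite ler_norml; lra.
move=> bg bg' gg'; rewrite ler_norml; apply/andP; split.
  by rewrite lerBrDr addrC lerBlDr lip// => y; rewrite distrC.
by rewrite lerBlDl lip.
Qed.

(** A contraction for the oscillation seminorm. The average of [w = expR (g - g')] under the Gibbs
    density [p z] is the exponential of the difference of the soft minima at [z]. The densities at
    [x] and [x'] share the mass [k], and on the rest [w] is at most [expR s] times its average. *)
Lemma soft_min_contract g g' (S s : R) : bmeas g -> bmeas g' ->
  s <= S ->
  (forall y y', (g y - g' y) - (g y' - g' y') <= s) ->
  forall x x', (soft_min g x - soft_min g' x) - (soft_min g x' - soft_min g' x') <=
    (1 - expR (- (K *+ 4)) * expR (- S)) * s.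
Proof.
move=> bg bg' sS gs x x'.
have s0 : 0 <= s by have := gs point point; rewrite subrr.
set k := expR (- (K *+ 4)); set th := 1 - _ * _.
have [p pE] : exists p : T1 -> T2 -> R, p =
  fun z y => expR (- c (z, y)) * expR (soft_min g' z + g' y) by exists (fun z y =>
  expR (- c (z, y)) * expR (soft_min g' z + g' y)).
pose w y := expR (g y - g' y).
have bw : bmeas w by exact/bmeas_expR/bmeasB.
have bp z : bmeas (p z).
  rewrite pE; apply: bmeasM.
    exact: (bmeas_snd z bmeas_exp_cost).
  apply: bmeas_expR; apply: bmeasD => //.
  exact: bmeas_cst.
have bwp z : bmeas (fun y => w y * p z y) by exact: bmeasM.
have p1 z : \int[Q]_y p z y = 1 by rewrite pE; exact: soft_min_density.
have wE z : \int[Q]_y (w y * p z y) = expR (soft_min g' z - soft_min g z).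
  rewrite expRD soft_minE// -integral_boundedZ; last exact: bCg.
  apply: eq_Rintegral => y _; rewrite /w pE -!expRD; congr expR.
  by move: (soft_min g' z) => a; ring.
have [b bE] : exists b : R, b = \int[Q]_y (w y * p x y) by eexists.
have [b' b'E] : exists b : R, b = \int[Q]_y (w y * p x' y) by eexists.
have b0 : 0 < b by rewrite bE wE expR_gt0.
have wb y : w y <= expR s * b.
  have -> : w y = \int[Q]_y' (w y * p x y') by rewrite integral_boundedZ// p1 mulr1.
  rewrite bE -integral_boundedZ//; apply: le_integral_bounded.
  - by apply: bmeasM => //; exact: bmeas_cst.
  - by apply: bmeasM => //; exact: bmeas_cst.
  move=> y'; rewrite mulrA ler_wpM2r//.
    by rewrite pE mulr_ge0 ?expR_ge0.
  by rewrite -expRD ler_expR; have := gs y y'; lra.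
(* In the exponent [4K], half comes from the cost and half from the oscillation of [soft_min g']. *)
have pk y : k * p x y <= p x' y.
  rewrite pE /k -!expRD ler_expR.
  have := cK (x, y); have := cK (x', y); have := soft_min_osc x x' bg'.
  rewrite !ler_norml; move: (soft_min g' x) (soft_min g' x') => a a'; lra.
have main : b' <= k * b + (1 - k) * (expR s * b).
  by rewrite b'E {1}bE; exact: integral_minorized.
have e0 : k + (1 - k) * expR s <= expR (th * s).
  by apply: expR_mixture_le; rewrite ?expR_ge0 ?s0.
have : b' <= expR (th * s) * b.
  rewrite (le_trans main)// (_ : _ + _ = (k + (1 - k) * expR s) * b); last by ring.
  by rewrite ler_wpM2r// ltW.
rewrite bE b'E !wE -expRD ler_expR.
by move: (soft_min g x) (soft_min g x') (soft_min g' x) (soft_min g' x') => *; lra.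
Qed.

End soft_min.

Section sinkhorn_iteration.
Context d1 d2 (T1 : measurableType d1) (T2 : measurableType d2) (R : realType).
Variables (c : T1 * T2 -> R) (K : R).
Hypotheses (bc : bmeas c) (cK : forall z, `|c z| <= K).
Variables (P : probability T1 R) (Q : probability T2 R).

Local Notation swap_cost := (fun z : T2 * T1 => c (z.2, z.1)).

Lemma bmeas_swap : bmeas swap_cost.
Proof.
apply: (bmeas_comp bc).
by apply/measurable_fun_pair; [exact: measurable_snd|exact: measurable_fst].
Qed.

Definition sinkhorn_step g := soft_min swap_cost P (soft_min c Q g).

Definition sinkhorn_iter k := iter k sinkhorn_step (fun=> 0).

Lemma bmeas_sinkhorn_step g : bmeas g ->
  bmeas (sinkhorn_step g).
Proof.
move=> bg; apply: bmeas_soft_min; first exact: bmeas_swap.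
exact: bmeas_soft_min.
Qed.

Lemma bmeas_sinkhorn_iter k : bmeas (sinkhorn_iter k).
Proof.
elim: k => [|k IH]; first exact: bmeas_cst.
exact: bmeas_sinkhorn_step.
Qed.

Let K0 : 0 <= K. Proof. by rewrite (le_trans _ (cK point)). Qed.

(** The first factor is the shared mass in [soft_min_contract]. The second is its [expR (- S)] with
    [S = 4K], the largest oscillation of a difference of two soft minima. *)
Definition sinkhorn_rate : R := 1 - expR (- (K *+ 4)) * expR (- (K *+ 4)).

Lemma sinkhorn_rate_itv : 0 <= sinkhorn_rate < 1.
Proof.
rewrite /sinkhorn_rate -expRD subr_ge0 -[X in _ <= X]expR0 ler_expR.
rewrite ltrBlDr ltrDl expR_gt0 andbT; have := K0; lra.
Qed.

Lemma sinkhorn_step_osc g y y' : bmeas g ->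
  sinkhorn_step g y - sinkhorn_step g y' <= K *+ 2.
Proof.
move=> bg; apply: soft_min_osc; [exact: bmeas_swap| |].
  by move=> z; exact: cK.
exact: bmeas_soft_min.
Qed.

Lemma sinkhorn_step_contract g g' s : bmeas g -> bmeas g' ->
  s <= K *+ 4 ->
  (forall y y', (g y - g' y) - (g y' - g' y') <= s) ->
  forall y y', (sinkhorn_step g y - sinkhorn_step g' y) -
    (sinkhorn_step g y' - sinkhorn_step g' y') <= sinkhorn_rate * s.
Proof.
move=> bg bg' sK gs y y'; have /andP[r0 /ltW r1] := sinkhorn_rate_itv.
have s0 : 0 <= s by have := gs point point; rewrite subrr.
have rs : sinkhorn_rate * s <= s by rewrite ler_piMl.
(* Both half-steps contract; only one of the two factors is kept. *)
have r2 : sinkhorn_rate * (sinkhorn_rate * s) <= sinkhorn_rate * s.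
  by rewrite ler_wpM2l.
apply: le_trans r2; apply: (soft_min_contract bmeas_swap).
- by move=> z; exact: cK.
- exact: bmeas_soft_min.
- exact: bmeas_soft_min.
- exact: le_trans sK.
- exact: soft_min_contract.
Qed.

(** Used twice: with [g] the first iterate it compares consecutive iterates, and with [g] an exact
    potential, which the step fixes, it gives convergence to the potential. *)
Lemma sinkhorn_iter_osc g : bmeas g ->
  (forall y y', g y - g y' <= K *+ 2) ->
  forall k y y', (iter k sinkhorn_step g y - sinkhorn_iter k y) -
    (iter k sinkhorn_step g y' - sinkhorn_iter k y') <= (K *+ 4) * sinkhorn_rate ^+ k.
Proof.
move=> bg gK; have /andP[r0 /ltW r1] := sinkhorn_rate_itv.
have bi k : bmeas (iter k sinkhorn_step g).
  by elim: k => // k IH; exact: bmeas_sinkhorn_step.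
elim=> [|k IH] y y'.
  by rewrite /= expr0 mulr1 !subr0 (le_trans (gK _ _))//; have := K0; lra.
rewrite exprS mulrCA; apply: sinkhorn_step_contract => //.
- exact: (bi k).
- exact: (bmeas_sinkhorn_iter k).
by rewrite ler_piMr ?mulrn_wge0// exprn_ile1.
Qed.

Lemma sinkhorn_stepD g s y : bmeas g ->
  sinkhorn_step (fun y => g y + s) y = sinkhorn_step g y + s.
Proof.
move=> bg; rewrite /sinkhorn_step.
rewrite (_ : soft_min c Q _ = fun x => soft_min c Q g x - s); last first.
  by apply/funext => x; exact: soft_minD.
by rewrite soft_minD ?opprK//; [exact: bmeas_swap|
  exact: bmeas_soft_min].
Qed.

Lemma sinkhorn_step_lipschitz g g' e y : bmeas g -> bmeas g' ->
  (forall y, `|g y - g' y| <= e) -> `|sinkhorn_step g y - sinkhorn_step g' y| <= e.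
Proof.
move=> bg bg' gg'; apply: soft_min_lipschitz; first exact: bmeas_swap.
- exact: bmeas_soft_min.
- exact: bmeas_soft_min.
- by move=> x; exact: soft_min_lipschitz.
Qed.

(** The contraction sees functions only modulo constants. The iterates are therefore normalised to
    vanish at [point], and the limit is a fixed point up to a shift [s]. *)
Lemma sinkhorn_step_fixpoint : exists2 g, bmeas g &
  exists s, forall y, sinkhorn_step g y = g y + s.
Proof.
have /andP[r0 r1] := sinkhorn_rate_itv.
have [h hE] : exists h : nat -> T2 -> R, forall k,
    h k = fun y => sinkhorn_iter k y - sinkhorn_iter k point by eexists.
have bh k : bmeas (h k).
  rewrite hE; apply: bmeasB; last exact: bmeas_cst.
  exact: bmeas_sinkhorn_iter.
have iterS k : iter k sinkhorn_step (sinkhorn_step (fun=> 0)) = sinkhorn_iter k.+1.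
  by rewrite -iterSr.
have osc k y y' : (sinkhorn_iter k.+1 y - sinkhorn_iter k y) -
    (sinkhorn_iter k.+1 y' - sinkhorn_iter k y') <= (K *+ 4) * sinkhorn_rate ^+ k.
  rewrite -iterS; apply: sinkhorn_iter_osc.
    exact/bmeas_sinkhorn_step/bmeas_cst.
  by move=> z z'; apply: sinkhorn_step_osc; exact: bmeas_cst.
have hS k y : `|h k.+1 y - h k y| <= (K *+ 4) * sinkhorn_rate ^+ k.
  have := osc k y point; have := osc k point y; rewrite ler_norml !hE.
  move: (sinkhorn_iter k.+1 y) (sinkhorn_iter k y) (sinkhorn_iter k.+1 point)
    (sinkhorn_iter k point) (_ * _) => *; lra.
have [g bg gh] := geometric_cauchy_limit (mulrn_wge0 4 K0) sinkhorn_rate_itv bh hS.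
exists g => //; exists (sinkhorn_step g point) => y.
have [e eE] : exists e : nat -> R, e =
    fun k => (K *+ 4) / (1 - sinkhorn_rate) * sinkhorn_rate ^+ k by eexists.
have {}gh k z : `|g z - h k z| <= e k by rewrite eE.
have e0 : (fun k => 4 * e k) @ \oo --> (0 : R).
  rewrite -[X in _ --> X](mulr0 4); apply: cvgM; first exact: cvg_cst.
  by rewrite eE; exact: cvg_geometric0 sinkhorn_rate_itv.
have ek k : e k.+1 <= e k.
  rewrite eE ler_wpM2l//; last by rewrite exprS ler_piMl ?exprn_ge0// ltW.
  by rewrite divr_ge0 ?mulrn_wge0// subr_ge0 ltW.
apply/eqP; rewrite -subr_eq0 -normr_le0.
apply: (cvgr_to_ge e0); near=> k.
have hh z : sinkhorn_step (h k) z = sinkhorn_iter k.+1 z - sinkhorn_iter k point.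
  by rewrite hE sinkhorn_stepD//; exact: bmeas_sinkhorn_iter.
have a1 := sinkhorn_step_lipschitz y bg (bh k) (gh k).
have a2 := sinkhorn_step_lipschitz point bg (bh k) (gh k).
have a3 := gh k.+1 y; have a4 := ek k.
rewrite !hh in a1 a2; rewrite hE in a3; rewrite !ler_norml in a1 a2 a3 *.
move: a1 a2 a3 a4; move: (sinkhorn_iter k.+1 y) (sinkhorn_iter k.+1 point) (sinkhorn_iter k point)
  (e k) (e k.+1) (sinkhorn_step g y) (sinkhorn_step g point) (g y) => *; lra.
Unshelve. all: by end_near.
Qed.

Definition schrodinger_pair (f : T1 -> R) (g : T2 -> R) :=
  [/\ bmeas f, bmeas g,
      f =1 soft_min c Q g & g =1 soft_min swap_cost P f].

Lemma schrodinger_pair_fixpoint f g : schrodinger_pair f g -> sinkhorn_step g = g.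
Proof.
move=> [bf bg fE gE]; apply/funext => y; rewrite gE /sinkhorn_step.
by congr soft_min; apply/funext => x; rewrite fE.
Qed.

Lemma schrodinger_pair_osc f g : schrodinger_pair f g ->
  (forall x x', f x - f x' <= K *+ 2) /\ (forall y y', g y - g y' <= K *+ 2).
Proof.
move=> [bf bg fE gE]; split=> [x x'|y y'].
  by rewrite !fE; exact: soft_min_osc.
rewrite !gE; apply: soft_min_osc => //; first exact: bmeas_swap.
Qed.

(** The iterates approach [g] only up to a constant depending on [k]; this constant enters the soft
    minimum with the opposite sign and cancels in the sum. The lemma serves to make the density at
    sample points measurable in the sample. *)
Lemma sinkhorn_iter_cvg f g : schrodinger_pair f g -> forall x y,
  (fun k => soft_min c Q (sinkhorn_iter k) x + sinkhorn_iter k y) @ \oo --> f x + g y.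
Proof.
move=> fg x y; have [bf bg fE gE] := fg; have [_ gosc] := schrodinger_pair_osc fg.
have osc := sinkhorn_iter_osc bg gosc.
have gfix k : iter k sinkhorn_step g = g.
  by elim: k => // k IH; rewrite iterS IH; exact: schrodinger_pair_fixpoint fg.
set e := fun k => (K *+ 4) * sinkhorn_rate ^+ k.
have e0 : (fun k => 2 * e k) @ \oo --> (0 : R).
  rewrite -[X in _ --> X](mulr0 2); apply: cvgM; first exact: cvg_cst.
  exact: cvg_geometric0 sinkhorn_rate_itv.
apply/cvgrPdist_lt => eps eps0.
near=> k.
have ek : 2 * e k < eps.
  by near: k; apply: (cvgr_lt _ e0).
apply: le_lt_trans ek.
have bi := bmeas_sinkhorn_iter k.
pose s := sinkhorn_iter k point - g point.
have gs z : `|g z + s - sinkhorn_iter k z| <= e k.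
  have := osc k z point; have := osc k point z; rewrite gfix ler_norml -/(e k) /s.
  move: (sinkhorn_iter k z) (sinkhorn_iter k point) (e k) (g z) (g point) => *; lra.
have bgs : bmeas (fun y => g y + s).
  by apply: bmeasD => //; exact: bmeas_cst.
have := soft_min_lipschitz bc Q x bgs bi gs; rewrite soft_minD// -fE.
have := gs y; rewrite !ler_norml.
move: {bgs gs}s => s; move: (sinkhorn_iter k y) (soft_min c Q _ x) (e k) (f x) (g y) => *; lra.
Unshelve. all: by end_near.
Qed.

Lemma schrodinger_pair_exists : exists2 fg, schrodinger_pair fg.1 fg.2 &
  \int[Q]_y fg.2 y = 0.
Proof.
have [g0 bg0 [s g0s]] := sinkhorn_step_fixpoint.
have bf0 := bmeas_soft_min bc Q bg0.
have bC := bmeas_exp_cost bc.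
have bC' := bmeas_exp_cost bmeas_swap.
(* The density [G] built from [g0] has mass 1 when integrated first over [Q], and mass [expR (- s)]
   when integrated first over [P]. Fubini's theorem forces [s = 0]. *)
have s0 : s = 0.
  pose G z := expR (- c z) * expR (soft_min c Q g0 z.1 + g0 z.2).
  have bG : bmeas G.
    apply: bmeasM => //; apply: bmeas_expR.
    by apply: bmeasD; exact: bmeas_comp.
  have i1 : \int[P]_x \int[Q]_y G (x, y) = 1.
    rewrite -[RHS](integral_cst1 P); apply: eq_Rintegral => x _.
    exact: soft_min_density.
  have i2 : \int[Q]_y \int[P]_x G (x, y) = expR (- s).
    rewrite -[RHS](integral_cst1 Q); apply: eq_Rintegral => y _.
    have := soft_min_density bmeas_swap P y bf0.
    rewrite -/(sinkhorn_step g0 y) g0s => h.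
    have -> : expR (- s) = expR (- s) * 1 by rewrite mulr1.
    rewrite -h -integral_boundedZ; last first.
      apply: bmeasM; first exact: (bmeas_snd y bC').
      apply: bmeas_expR; apply: bmeasD => //.
      exact: bmeas_cst.
    apply: eq_Rintegral => x _; rewrite /G /= -!expRD; congr expR.
    by move: (soft_min _ _ _ _) => a; ring.
  have : expR (- s) = expR 0 by rewrite expR0 -i1 -i2 bounded_fubini.
  by move/expR_inj; move/eqP; rewrite oppr_eq0 => /eqP.
pose t := \int[Q]_y g0 y.
exists (fun x => soft_min c Q g0 x + t, fun y => g0 y - t) => /=.
  have bt r := bmeas_cst T1 r; have bt' r := bmeas_cst T2 r.
  split=> [||x|y].
  - exact: bmeasD.
  - exact: bmeasB.
  - by rewrite soft_minD// opprK.
  - rewrite soft_minD//; last exact: bmeas_swap.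
    by rewrite -/(sinkhorn_step g0 y) g0s s0 addr0.
rewrite integral_boundedB//; last exact: bmeas_cst.
by rewrite integral_cst1 subrr.
Qed.

End sinkhorn_iteration.

(** * The entropic plan and its density *)

Section gibbs.
Context d (S : measurableType d) (R : realType).
Implicit Types mu pi : probability S R.
Local Open Scope ereal_scope.

(** Positive and negative parts are compared separately, so no integrability is assumed. This
    matters for the logarithm of an arbitrary density, whose integral may be infinite. *)
Lemma le_integral_measurable mu (f g : S -> \bar R) :
  measurable_fun setT f -> measurable_fun setT g -> (forall x, f x <= g x) ->
  \int[mu]_x f x <= \int[mu]_x g x.
Proof.
move=> mf mg fg; rewrite integralE [leRHS]integralE; apply: leeB.
- apply: ge0_le_integral => //; [exact: measurable_funepos..|].
  by move=> x _; apply: (@funepos_le _ _ setT) => //; rewrite in_setT.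
- apply: ge0_le_integral => //; [exact: measurable_funeneg..|].
  by move=> x _; apply: (@funeneg_le _ _ setT) => //; rewrite in_setT.
Qed.

(* With [p] the density of [pi], integrate [ln zeta + 1 - zeta / p <= ln p]
   against [pi]. *)
Lemma gibbs_inequality mu pi (zeta : S -> R) (r : R) : bmeas zeta ->
  (0 < r)%R -> (forall z, (r <= zeta z)%R) -> (\int[mu]_z zeta z <= 1)%R ->
  (\int[pi]_z ln (zeta z))%:E <= KL pi mu.
Proof.
move=> bz r0 rz z1; rewrite /KL; case: asboolP => [dom|_]; last exact: leey.
pose q := Radon_Nikodym_SigmaFinite.f pi mu.
have q0 z : 0 <= q z by exact: Radon_Nikodym_SigmaFinite.f_ge0.
have qfin z : q z \is a fin_num by exact: Radon_Nikodym_SigmaFinite.f_fin_num.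
have mq : measurable_fun setT q.
  exact: measurable_int (Radon_Nikodym_SigmaFinite.f_integrable dom).
have [p pE] : exists p : S -> R, forall z, (p z)%:E = q z.
  by exists (fine \o q) => z /=; rewrite fineK.
have p0 z : (0 <= p z)%R by rewrite -lee_fin pE.
have mp : measurable_fun setT p.
  apply/measurable_EFinP; rewrite (_ : EFin \o p = q)//.
  by apply/funext => z /=; rewrite pE.
(* The version [q] of the derivative is nonnegative and finite everywhere. The two versions agree
   [mu]-almost everywhere, hence [pi]-almost everywhere by domination. *)
rewrite (_ : \int[pi]_z _ = \int[pi]_z (ln (p z))%:E); last first.
  have mRN : measurable_fun setT
      (Radon_Nikodym (charge_of_finite_measure pi) mu).
    by apply: measurable_int; exact: Radon_Nikodym_integrable.
  apply: ae_eq_integral => //.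
  - apply/measurable_EFinP; apply: measurableT_comp => //.
    exact: (measurableT_comp (fine_measurable measurableT)).
  - by apply/measurable_EFinP; exact: measurableT_comp.
  - apply: (null_dominates_ae_eq measurableT dom).
    have := ae_eq_Radon_Nikodym_SigmaFinite dom measurableT.
    apply: filterS => z /(_ Logic.I) h _; rewrite -h//.
    by rewrite -[Radon_Nikodym_SigmaFinite.f _ _ z]/(q z) -pE.
(* This is [zeta / p] where [p > 0]. Where [p = 0], the default [ln 0 = 0] gives [s = zeta], and the
   factor [p] in the change of variables removes these points. *)
pose s z := (zeta z * expR (- ln (p z)))%R.
have z0 z : (0 < zeta z)%R by exact: lt_le_trans (rz z).
have s0 z : (0 <= s z)%R by rewrite mulr_ge0 ?expR_ge0// ltW.
have ms : measurable_fun setT s.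
  apply: measurable_funM; first exact: bmeas_fun.
  apply: measurableT_comp => //; apply: measurableT_comp => //.
  exact: measurableT_comp.
have s1 : \int[pi]_z (s z)%:E <= 1.
  rewrite -(Radon_Nikodym_SigmaFinite.change_of_variables dom)//; last exact/measurable_EFinP.
  rewrite -/q; under eq_integral do rewrite -pE -EFinM.
  apply: (@le_trans _ _ (\int[mu]_z (zeta z)%:E)); last first.
    by rewrite EFin_integral_bounded// lee_fin.
  apply: ge0_le_integral => //.
  - by move=> z _; rewrite lee_fin mulr_ge0.
  - by apply/measurable_EFinP; exact: measurable_funM.
  - exact/measurable_EFinP/bmeas_fun.
  - move=> z _; rewrite lee_fin; have [->|pz0] := eqVneq (p z) 0%R.
      by rewrite mulr0 ltW.
    have pz : (0 < p z)%R by rewrite lt_neqAle eq_sym pz0 p0.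
    by rewrite /s -mulrA -{2}(lnK pz) -expRD addNr expR0 mulr1.
have si : pi.-integrable setT (EFin \o s).
  apply/integrableP; split; first exact/measurable_EFinP.
  rewrite (le_lt_trans _ (ltry 1%R))// (le_trans _ s1)//.
  by under eq_integral => z _ do rewrite /= ger0_norm//.
have bln := bmeas_ln bz r0 rz.
have bln1 : bmeas (fun z => ln (zeta z) + 1)%R.
  by apply: bmeasD => //; exact: bmeas_cst.
have bi := bmeas_integrable pi bln1.
apply: (@le_trans _ _ (\int[pi]_z ((ln (zeta z) + 1) - s z)%R%:E)).
  rewrite (_ : \int[pi]_z _ = (\int[pi]_z ((ln (zeta z) + 1) - s z))%:E); last first.
    rewrite /Rintegral fineK//; apply: integrable_fin_num => //.
    exact: (integrableB measurableT bi si).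
  rewrite lee_fin RintegralB// integral_boundedD//; last exact: bmeas_cst.
  rewrite integral_cst1 -addrA lerDl subr_ge0 -lee_fin /Rintegral fineK//.
  exact: integrable_fin_num.
apply: le_integral_measurable.
- by apply/measurable_EFinP; apply: measurable_funB => //; exact: bmeas_fun.
- by apply/measurable_EFinP; exact: measurableT_comp.
- move=> z; rewrite lee_fin /s -{2}(lnK (z0 z)) -expRD.
  have := expR_ge1Dx (ln (zeta z) - ln (p z))%R; lra.
Qed.

End gibbs.

Section density_measure.
Context d (S : measurableType d) (R : realType) (mu : probability S R).
Variable zeta : S -> R.
Hypotheses (bz : bmeas zeta) (z0 : forall z, 0 <= zeta z)
  (z1 : \int[mu]_z zeta z = 1).

Let mz : measurable_fun setT (EFin \o zeta).
Proof. exact/measurable_EFinP/bmeas_fun. Qed.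

Definition density_measure (A : set S) : \bar R := (\int[mu]_(z in A) (zeta z)%:E)%E.

Let dm0 : density_measure set0 = 0%E.
Proof. by rewrite /density_measure integral_set0. Qed.

Let dm_ge0 A : (0 <= density_measure A)%E.
Proof. by apply: integral_ge0 => z _; rewrite lee_fin. Qed.

Let dm_sigma_additive : semi_sigma_additive density_measure.
Proof. exact: (semi_sigma_additive_nng_induced mz). Qed.

HB.instance Definition _ := isMeasure.Build _ _ _ density_measure
  dm0 dm_ge0 dm_sigma_additive.

Let dm_setT : density_measure setT = 1%E.
Proof. by rewrite /density_measure EFin_integral_bounded// z1. Qed.

HB.instance Definition _ :=
  @Measure_isProbability.Build _ _ R density_measure dm_setT.

Definition density_prob : probability S R := density_measure.

Lemma density_prob_dominates : density_prob `<< mu.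
Proof.
apply/null_content_dominatesP => A mA A0; apply: null_set_integral => //.
exact: measurable_funTS.
Qed.

Lemma ae_eq_density_prob : ae_eq mu setT
  (Radon_Nikodym (charge_of_finite_measure density_prob) mu) (EFin \o zeta).
Proof.
have dom := density_prob_dominates.
apply: integral_ae_eq => //; first exact: Radon_Nikodym_integrable.
by move=> A _ mA; rewrite -Radon_Nikodym_integral.
Qed.

Lemma KL_density_prob (r : R) : 0 < r -> (forall z, r <= zeta z) ->
  KL density_prob mu = (\int[density_prob]_z ln (zeta z))%:E.
Proof.
move=> r0 rz; have dom := density_prob_dominates.
rewrite /KL asboolT// -EFin_integral_bounded; last exact: (bmeas_ln bz r0 rz).
have mRN : measurable_fun setT
    (Radon_Nikodym (charge_of_finite_measure density_prob) mu).
  by apply: measurable_int; exact: Radon_Nikodym_integrable.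
apply: ae_eq_integral => //.
- apply/measurable_EFinP; apply: measurableT_comp => //.
  exact: (measurableT_comp (fine_measurable measurableT)).
- by apply/measurable_EFinP; apply: measurableT_comp => //; exact: bmeas_fun.
- apply: (null_dominates_ae_eq measurableT dom).
  by apply: filterS ae_eq_density_prob => z /(_ Logic.I) -> _.
Qed.

Lemma integral_density_prob (h : S -> R) : bmeas h ->
  \int[density_prob]_z h z = \int[mu]_z (h z * zeta z).
Proof.
move=> bh; have dom := density_prob_dominates.
have bhz : bmeas (fun z => h z * zeta z) by exact: bmeasM.
apply: EFin_inj; rewrite -!EFin_integral_bounded//.
rewrite -(Radon_Nikodym_change_of_variables dom measurableT); last first.
  exact: bmeas_integrable.
have mh : measurable_fun setT (EFin \o h) by exact/measurable_EFinP/bmeas_fun.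
apply: ae_eq_integral => //.
- by apply: emeasurable_funM => //; apply: measurable_int; exact: Radon_Nikodym_integrable.
- exact/measurable_EFinP/bmeas_fun.
exact: (ae_eqe_mul2l (EFin \o h) ae_eq_density_prob).
Qed.

End density_measure.

Section eot_plan.
Context d (T : measurableType d) (R : realType).
Variables (c : T * T -> R) (K : R).
Hypotheses (bc : bmeas c) (cK : forall z, `|c z| <= K).
Variables (P Q : probability T R).

Lemma is_eot_potentialsE fg : is_eot_potentials c P Q fg <->
  schrodinger_pair c P Q fg.1 fg.2 /\ \int[Q]_y fg.2 y = 0.
Proof.
rewrite /schrodinger_pair soft_min.unlock /is_eot_potentials /=.
by split=> [[]//|[[]]//].
Qed.

Lemma eot_potentialsP : is_eot_potentials c P Q (eot_potentials c P Q).
Proof.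
have [fg h1 h2] := schrodinger_pair_exists bc cK P Q.
by apply: (@xgetPex _ _ (is_eot_potentials c P Q)); exists fg; exact/is_eot_potentialsE.
Qed.

Lemma eot_potentials_pair :
  schrodinger_pair c P Q (eot_potentials c P Q).1 (eot_potentials c P Q).2.
Proof. by have /is_eot_potentialsE[] := eot_potentialsP. Qed.

Local Notation xi := (eot_density c P Q).

Lemma bmeas_eot_log_density :
  bmeas (fun z => - c z + ((eot_potentials c P Q).1 z.1 +
    (eot_potentials c P Q).2 z.2)).
Proof.
have [bf bg _ _] := eot_potentials_pair.
apply: bmeasD; first exact: bmeasN.
by apply: bmeasD; exact: bmeas_comp.
Qed.

Lemma eot_densityE x y : xi x y =
  expR (- c (x, y) + ((eot_potentials c P Q).1 x + (eot_potentials c P Q).2 y)).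
Proof. by rewrite /eot_density -expRD. Qed.

Lemma bmeas_eot_density : bmeas (fun z => xi z.1 z.2).
Proof.
rewrite (_ : (fun _ => _) = fun z => expR (- c z + ((eot_potentials c P Q).1 z.1 +
    (eot_potentials c P Q).2 z.2))).
  exact/bmeas_expR/bmeas_eot_log_density.
by apply/funext => -[x y]; rewrite eot_densityE.
Qed.

Lemma integral_eot_density_snd x : \int[Q]_y xi x y = 1.
Proof.
have [bf bg fE gE] := eot_potentials_pair.
rewrite -(soft_min_density bc Q x bg); apply: eq_Rintegral => y _.
by rewrite /eot_density fE.
Qed.

Lemma integral_eot_density_fst y : \int[P]_x xi x y = 1.
Proof.
have [bf bg fE gE] := eot_potentials_pair.
rewrite -(soft_min_density (bmeas_swap bc) P y bf).
by apply: eq_Rintegral => x _; rewrite /eot_density gE addrC.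
Qed.

(** Only the sum is controlled, since [f] and [g] may be shifted by opposite constants. The density
    has mass 1 in [y], so its exponent cannot stay on one side of 0, and this exponent differs from
    [f x + g y] by at most [K] for the cost and [2K] for the oscillation of [g]. *)
Lemma schrodinger_pair_sum_le f g : schrodinger_pair c P Q f g ->
  forall x y, `|f x + g y| <= K *+ 3.
Proof.
move=> fg x y; have [bf bg fE gE] := fg.
have [_ gosc] := schrodinger_pair_osc bc cK fg.
have := soft_min_density bc Q x bg; rewrite -fE => i1.
have bh : bmeas (fun y => expR (- c (x, y)) * expR (f x + g y)).
  apply: bmeasM.
    exact: (bmeas_snd x (bmeas_exp_cost bc)).
  apply/bmeas_expR/bmeasD => //.
  exact: bmeas_cst.
have h z : - (K *+ 3) + (f x + g y) <= - c (x, z) + (f x + g z) <= K *+ 3 + (f x + g y).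
  have := cK (x, z); have := gosc y z; have := gosc z y; rewrite ler_norml; lra.
have : 1 <= expR (K *+ 3 + (f x + g y)).
  rewrite -[leLHS]i1; apply: integral_bounded_le => // z.
  by rewrite -expRD ler_expR; case/andP: (h z).
have : expR (- (K *+ 3) + (f x + g y)) <= 1.
  rewrite -[leRHS]i1; apply: integral_bounded_ge => // z.
  by rewrite -expRD ler_expR; case/andP: (h z).
rewrite -[in X in X -> _]expR0 -[in X in _ -> X -> _]expR0 !ler_expR ler_norml; lra.
Qed.

Lemma eot_density_bounds x y : expR (- (K *+ 4)) <= xi x y <= expR (K *+ 4).
Proof.
rewrite eot_densityE !ler_expR.
have := schrodinger_pair_sum_le eot_potentials_pair x y; have := cK (x, y).
rewrite !ler_norml; lra.
Qed.

Lemma integral_coupling pi : coupling P Q pi ->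
  forall f g, bmeas f -> bmeas g ->
  \int[pi]_z (f z.1 + g z.2) = \int[P]_x f x + \int[Q]_y g y.
Proof.
move=> cpl f g bf bg.
rewrite integral_boundedD; [|exact: bmeas_comp..].
have marg (p : T * T -> T) (mu : probability T R) h : measurable_fun setT p ->
    (forall A, measurable A -> pi (p @^-1` A) = mu A) -> bmeas h ->
    \int[pi]_z h (p z) = \int[mu]_x h x.
  move=> mp pmu bh; rewrite /Rintegral; congr fine.
  have mh := bmeas_fun bh.
  rewrite [RHS](eq_measure_integral (pushforward pi p)); last by move=> A mA _ /=; rewrite -pmu.
  rewrite integral_pushforward//; first exact/measurable_EFinP.
  apply: (@bmeas_integrable _ _ _ pi (h \o p)).
  exact: bmeas_comp.
congr (_ + _); apply: marg => //.
- by move=> A mA; have [] := cpl A mA.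
- by move=> A mA; have [] := cpl A mA.
Qed.

End eot_plan.

Lemma expR_le_quadratic (R : realType) (t : R) : t <= 2^-1 ->
  expR t <= 1 + t + 2 * t ^+ 2.
Proof.
move=> t2; have : expR t * (1 - t) <= 1.
  rewrite -[leRHS](expR0) -(subrr t) expRD ler_wpM2l ?expR_ge0//.
  exact: expR_ge1Dx.
have e0 := expR_ge0 t; move: (expR t) e0 => e e0 h.
have : e * (1 - t) <= (1 + t + 2 * t ^+ 2) * (1 - t).
  apply: (le_trans h); rewrite -subr_ge0.
  rewrite (_ : _ - 1 = t ^+ 2 * (1 - 2 * t)); last by ring.
  by rewrite mulr_ge0 ?sqr_ge0//; lra.
by rewrite ler_pM2r//; lra.
Qed.

Section sinkhorn_cost.
Context d (T : measurableType d) (R : realType).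
Variables (c : T * T -> R) (K : R).
Hypotheses (bc : bmeas c) (cK : forall z, `|c z| <= K).
Variables (P Q : probability T R).

Local Notation xi := (eot_density c P Q).
Let mu : probability (T * T)%type R := (P \x Q)%E.
Let f := (eot_potentials c P Q).1.
Let g := (eot_potentials c P Q).2.
Let xz (z : T * T) := xi z.1 z.2.

Let bxi : bmeas xz := bmeas_eot_density bc cK P Q.

Let xi_lb z : expR (- (K *+ 4)) <= xz z.
Proof. by have /andP[] := eot_density_bounds bc cK P Q z.1 z.2. Qed.

Let xi_gt0 z : 0 < xz z.
Proof. by apply: lt_le_trans (xi_lb z); rewrite expR_gt0. Qed.

Let xi_ge0 z : 0 <= xz z := ltW (xi_gt0 z).

Let bf : bmeas f. Proof. by case: (eot_potentials_pair bc cK P Q). Qed.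
Let bg : bmeas g. Proof. by case: (eot_potentials_pair bc cK P Q). Qed.

Lemma Rintegral_prod_bounded (F : T * T -> R) : bmeas F ->
  \int[mu]_z F z = \int[P]_x \int[Q]_y F (x, y).
Proof. by move=> bF; rewrite /Rintegral integral_prod_bounded. Qed.

Let xi1 : \int[mu]_z xz z = 1.
Proof.
rewrite Rintegral_prod_bounded// -[RHS](integral_cst1 P).
by apply: eq_Rintegral => x _; exact: (integral_eot_density_snd bc cK).
Qed.

Let plan := density_prob bxi xi_ge0 xi1.

Let plan_coupling : coupling P Q plan.
Proof.
move=> A mA; pose I (x : T) : R := \1_A x.
have bI : bmeas I.
  apply: (@bmeas_intro _ _ _ _ 1); first exact: measurable_indic.
  by move=> x; rewrite /I indicE; case: (_ \in _); rewrite ?normr1 ?normr0.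
have PI (nu : probability T R) : (\int[nu]_x I x)%:E = nu A.
  by rewrite -EFin_integral_bounded// integral_indic// setIT.
have bI2 (p : T * T -> T) : measurable_fun setT p -> bmeas (fun z => I (p z)).
  exact: bmeas_comp.
have planI (p : T * T -> T) : measurable_fun setT p ->
    plan (p @^-1` A) = (\int[mu]_z (I (p z) * xz z))%:E.
  move=> mp; rewrite -(integral_density_prob bxi xi_ge0 xi1); last exact: bI2.
  rewrite -EFin_integral_bounded; last exact: bI2.
  rewrite (_ : (fun z => _) = fun z => (\1_(p @^-1` A) z)%:E).
    by rewrite integral_indic ?setIT// -[X in measurable X]setTI; exact: mp.
  by apply/funext => z; rewrite /I !indicE.
split.
  rewrite planI; last exact: measurable_fst.
  rewrite Rintegral_prod_bounded; last by apply: bmeasM => //; exact: bI2.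
  rewrite -PI; congr EFin; apply: eq_Rintegral => x _ /=.
  rewrite integral_boundedZ; last exact: (bmeas_snd x bxi).
  by rewrite (integral_eot_density_snd bc cK) mulr1.
rewrite planI; last exact: measurable_snd.
have bIx : bmeas (fun z : T * T => I z.2 * xz z).
  by apply: bmeasM => //; exact: bI2.
rewrite (Rintegral_prod_bounded bIx) (bounded_fubini P Q bIx).
rewrite -PI; congr EFin; apply: eq_Rintegral => y _ /=.
rewrite integral_boundedZ; last exact: (bmeas_fst y bxi).
by rewrite (integral_eot_density_fst bc cK) mulr1.
Qed.

Let ln_xi z : ln (xz z) = - c z + (f z.1 + g z.2).
Proof. by case: z => x y; rewrite /xz eot_densityE expRK. Qed.

Let bln : bmeas (fun z => ln (xz z)).
Proof.
rewrite (_ : (fun _ => _) = fun z => - c z + (f z.1 + g z.2)).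
  exact: (bmeas_eot_log_density bc cK).
by apply/funext => z; rewrite ln_xi.
Qed.

Let D := \int[P]_x f x + \int[Q]_y g y.

Let integral_ln_xi pi : coupling P Q pi ->
  \int[pi]_z ln (xz z) = D - \int[pi]_z c z.
Proof.
move=> cpl; rewrite /D -(integral_coupling cpl bf bg) -integral_boundedB//; last first.
  by apply: bmeasD; exact: bmeas_comp.
by apply: eq_Rintegral => z _; rewrite ln_xi addrC.
Qed.

(** Weak duality: on a coupling the potentials integrate to [D], so Gibbs' inequality against [xi]
    cancels the cost. The plan with density [xi] attains the value [D]. *)
Let objective_ge pi : coupling P Q pi -> (D%:E <= eot_objective c P Q pi)%E.
Proof.
move=> cpl; rewrite /eot_objective EFin_integral_bounded//.
have xi_le1 : \int[mu]_z xz z <= 1 by rewrite xi1.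
have := gibbs_inequality pi bxi (expR_gt0 (- (K *+ 4))) xi_lb xi_le1.
rewrite integral_ln_xi// => KLge.
apply: (le_trans _ (leeD2l _ KLge)).
by rewrite -EFinD addrC subrK.
Qed.

Let objective_plan : eot_objective c P Q plan = D%:E.
Proof.
rewrite /eot_objective EFin_integral_bounded//.
rewrite (KL_density_prob bxi xi_ge0 xi1 (expR_gt0 (- (K *+ 4))) xi_lb).
by rewrite -/plan integral_ln_xi// -EFinD addrC subrK.
Qed.

(* Perturbing the density [xi] to [xi e^(t c) / Z] in Gibbs' inequality pins
   down the cost of any minimizer. *)
Lemma eot_plan_cost pi : is_eot_plan c P Q pi ->
  \int[pi]_z c z = \int[P]_x \int[Q]_y (c (x, y) * xi x y).
Proof.
move=> [cpl /(_ _ plan_coupling)]; rewrite objective_plan => piD.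
have bcx : bmeas (fun z => c z * xz z) by exact: bmeasM.
rewrite -(Rintegral_prod_bounded bcx).
have [a aE] : exists a : R, a = \int[pi]_z c z by eexists.
have [b bE] : exists b : R, b = \int[mu]_z (c z * xz z) by eexists.
have K0 : 0 <= K by rewrite (le_trans _ (cK point)).
have KLle : (KL pi mu <= (\int[pi]_z ln (xz z))%:E)%E.
  rewrite integral_ln_xi// EFinB; move: piD.
  by rewrite /eot_objective EFin_integral_bounded// leeBrDl.
(* The right side is quadratic in [t] and [t] may have either sign, so a small [t] of the sign of
   [a - b] forces [a = b]. The bound itself is [t * a <= ln Z <= Z - 1], with [Z] the mass of the
   tilted density expanded to second order. *)
suff pert (t : R) : `|t| * K <= 2^-1 -> t * (a - b) <= 2 * t ^+ 2 * K ^+ 2.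
  rewrite -aE -bE; apply/eqP; rewrite -subr_eq0; apply: contraT => ab.
  have d0 : 0 < `|a - b| by rewrite normr_gt0.
  (* With [e = |a - b| / N], the last summand of [N] gives [e * K <= 1/2], and the first two give
     [2 * e * K ^+ 2 < |a - b|]. *)
  pose N := 4 * K ^+ 2 + 1 + 2 * K * `|a - b|.
  have N0 : 0 < N by rewrite /N; have := sqr_ge0 K; have := mulr_ge0 K0 (ltW d0); lra.
  pose e := `|a - b| / N; have e0 : 0 < e by rewrite divr_gt0.
  have eN : e * N = `|a - b| by rewrite /e divfK// gt_eqF.
  pose t := Num.sg (a - b) * e.
  have tE : `|t| = e by rewrite /t normrM normr_sg ab mul1r ger0_norm// ltW.
  have tab : t * (a - b) = e * `|a - b|.
    by rewrite /t [in RHS]normrEsg; ring.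
  have t2 : t ^+ 2 = e ^+ 2 by rewrite -[LHS]real_normK ?num_real// tE.
  have eK : `|t| * K <= 2^-1.
    have : e * K * N <= 2^-1 * N by rewrite mulrAC eN /N; have := sqr_ge0 K; lra.
    by rewrite tE ler_pM2r.
  have := pert t eK; rewrite tab t2 => h.
  have : e * `|a - b| <= e * (2 * e * K ^+ 2) by apply: (le_trans h); rewrite le_eqVlt; apply/orP; left; apply/eqP; ring.
  rewrite ler_pM2l// -{1}eN /N => h2.
  have : 0 < e * (2 * K ^+ 2 + 1 + 2 * K * `|a - b|).
    rewrite mulr_gt0//; have := sqr_ge0 K; have := mulr_ge0 K0 (ltW d0); lra.
  lra.
move=> tK.
pose w z := xz z * expR (t * c z).
have btc : bmeas (fun z => t * c z).
  by apply: bmeasM => //; exact: bmeas_cst.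
have bw : bmeas w.
  by apply: bmeasM => //; exact: bmeas_expR.
have tc z : `|t * c z| <= 2^-1.
  by rewrite normrM (le_trans _ tK)// ler_wpM2l.
pose r := expR (- (K *+ 4)) * expR (- 2^-1).
have r0 : 0 < r by rewrite mulr_gt0 ?expR_gt0.
have rw z : r <= w z.
  rewrite ler_pM ?expR_ge0// ler_expR.
  by have := tc z; rewrite ler_norml => /andP[].
have [Z ZE] : exists Z : R, Z = \int[mu]_z w z by eexists.
have Z0 : 0 < Z by rewrite ZE (lt_le_trans r0)//; exact: integral_bounded_ge.
have Z1 : Z <= 1 + t * b + 2 * t ^+ 2 * K ^+ 2.
  have bq : bmeas (fun z => xz z + t * (c z * xz z)).
    by apply: bmeasD => //; apply: bmeasM => //; exact: bmeas_cst.
  have bk : bmeas (fun z => 2 * t ^+ 2 * K ^+ 2 * xz z).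
    by apply: bmeasM => //; exact: bmeas_cst.
  have -> : 1 + t * b + 2 * t ^+ 2 * K ^+ 2 =
      \int[mu]_z (xz z + t * (c z * xz z) + 2 * t ^+ 2 * K ^+ 2 * xz z).
    rewrite integral_boundedD// integral_boundedD//; last first.
      by apply: bmeasM => //; exact: bmeas_cst.
    by rewrite !integral_boundedZ// xi1 -bE mulr1.
  rewrite ZE; apply: le_integral_bounded => //; first exact: bmeasD.
  move=> z; rewrite /w.
  have -> : xz z + t * (c z * xz z) + 2 * t ^+ 2 * K ^+ 2 * xz z =
    xz z * (1 + t * c z + 2 * (t ^+ 2 * K ^+ 2)) by ring.
  apply: ler_wpM2l => //; apply: (le_trans (expR_le_quadratic _)).
    by rewrite (le_trans (ler_norm _)).
  rewrite lerD2l ler_wpM2l// exprMn ler_wpM2l ?sqr_ge0//.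
  by rewrite -[X in X <= _]real_normK ?num_real// ler_sqr ?nnegrE.
have bz : bmeas (fun z => w z * Z^-1).
  by apply: bmeasM => //; exact: bmeas_cst.
have rz z : r / Z <= w z * Z^-1 by rewrite ler_wpM2r// invr_ge0 ltW.
have z1 : \int[mu]_z (w z * Z^-1) <= 1.
  by rewrite integral_boundedZr// -ZE divff// gt_eqF.
have gi := gibbs_inequality pi bz (divr_gt0 r0 Z0) rz z1.
have := le_trans gi KLle; rewrite lee_fin.
have wz z : 0 < w z by exact: lt_le_trans (rw z).
rewrite (@eq_Rintegral _ _ _ _ _ (fun z => (ln (xz z) + t * c z) - ln Z)); last first.
  move=> z _; rewrite lnM ?posrE ?invr_gt0// lnV ?posrE// /w.
  by rewrite lnM ?posrE ?expR_gt0// expRK.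
rewrite integral_boundedB; [|exact: bmeasD|exact: bmeas_cst].
rewrite integral_boundedD// integral_boundedZ// -aE integral_cst1.
have lnZ : ln Z <= Z - 1.
  by rewrite -ler_expR lnK// (le_trans _ (expR_ge1Dx _))// subrKC.
move: Z1 lnZ; move: (ln Z) (\int[pi]_z _) => *; lra.
Qed.

Lemma sinkhorn_costE :
  sinkhorn_cost c P Q = \int[P]_x \int[Q]_y (c (x, y) * xi x y).
Proof.
apply: eot_plan_cost; rewrite /eot_plan.
apply: (@getPex _ (is_eot_plan c P Q)); exists plan; split=> // pi cpl.
by rewrite objective_plan; exact: objective_ge.
Qed.

End sinkhorn_cost.

(** * Stability of the cost in the marginals *)

(** Strong convexity of the exponential on [[-B, B]], in the form of strong monotonicity of its
    derivative. *)
Lemma expR_monotone_gap (R : realType) (B h : R) : `|h| <= B ->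
  expR (- B) * h ^+ 2 <= (expR h - 1) * h.
Proof.
rewrite ler_norml => /andP[hB1 hB2]; have B0 : 0 <= B by lra.
have eB : expR (- B) <= 1 by rewrite -[leRHS]expR0 ler_expR; lra.
have [h0|/ltW h0] := leP 0 h.
  rewrite expr2 mulrA ler_wpM2r//.
  have := expR_ge1Dx h; have := ler_piMl h0 eB; lra.
have e1 : expR h * expR (- h) = 1 by rewrite -expRD subrr expR0.
have e2 := expR_ge1Dx (- h).
have e3 : expR (- B) <= expR h by rewrite ler_expR; lra.
have e4 : expR h * (1 - h) <= 1 by rewrite -[leRHS]e1 ler_wpM2l ?expR_ge0.
rewrite -subr_ge0 (_ : _ - _ = - h * (1 - expR h + expR (- B) * h)); last by ring.
rewrite mulr_ge0//; first by lra.
have : expR h * h <= expR (- B) * h by rewrite ler_wnM2r.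
lra.
Qed.

Lemma expR_taylor1 (R : realType) (B h : R) : `|h| <= B ->
  `|expR h - 1 - h| <= expR B * h ^+ 2.
Proof.
rewrite ler_norml => /andP[hB1 hB2]; have B0 : 0 <= B by lra.
have eB : 1 <= expR B by rewrite -[leLHS]expR0 ler_expR; lra.
have e1 : expR h * expR (- h) = 1 by rewrite -expRD subrr expR0.
have e2 := expR_ge1Dx (- h); have e5 := expR_ge1Dx h.
have e4 : expR h * (1 - h) <= 1 by rewrite -[leRHS]e1 ler_wpM2l ?expR_ge0.
have e3 : expR h <= expR B by rewrite ler_expR.
rewrite ger0_norm; last by lra.
apply: (@le_trans _ _ (h * (expR h - 1))); first by lra.
have [h0|/ltW h0] := leP 0 h.
  have : h * expR h * h <= h * expR B * h by rewrite ler_wpM2r// ler_wpM2l.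
  have : h * (expR h - 1) <= h * (expR h * h) by rewrite ler_wpM2l//; lra.
  lra.
have : h * (expR h - 1) <= h * h by rewrite ler_wnM2l//; lra.
have : h * h * 1 <= h * h * expR B by rewrite ler_wpM2l// -expr2 sqr_ge0.
lra.
Qed.

Section perturbation.
Context d (T : measurableType d) (R : realType).
Variables (c : T * T -> R) (K : R).
Hypotheses (bc : bmeas c) (cK : forall z, `|c z| <= K).
Variables (P Q : probability T R) (u v : T -> R).
Hypotheses (bu : bmeas u) (bv : bmeas v).

Local Notation xi := (eot_density c P Q).

Definition dual_kernel (z : T * T) : R := (c z - u z.1 - v z.2) * xi z.1 z.2.

(** Integrated in one variable against other marginals, this is the amount by which [xi] fails to
    have unit mass there. *)
Definition density_kernel (z : T * T) : R := xi z.1 z.2 - 1.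

Local Notation w := dual_kernel.

Lemma bmeas_dual_kernel : bmeas w.
Proof.
apply: bmeasM; last exact: (bmeas_eot_density bc cK).
by apply: bmeasB; [apply: bmeasB => //|];
  exact: bmeas_comp.
Qed.

Lemma bmeas_density_kernel : bmeas density_kernel.
Proof.
apply: bmeasB; last exact: bmeas_cst.
exact: (bmeas_eot_density bc cK).
Qed.

Section perturbed_marginals.
Variables (P' Q' : probability T R).

Let a0 x := (eot_potentials c P' Q').1 x - (eot_potentials c P Q).1 x.
Let b0 y := (eot_potentials c P' Q').2 y - (eot_potentials c P Q).2 y.
(** Moving the constant [s] from [b0] to [a0] leaves the sum [h] unchanged and centres [b] under
    [Q'], so that the mean square of [h] has no cross term. The bound [B = 6K] for [h] is twice the
    bound [3K] for a sum of potentials. *)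
Let s := \int[Q']_y b0 y.
Let a x := a0 x + s.
Let b y := b0 y - s.
Let h (z : T * T) := a z.1 + b z.2.
Let B := K *+ 6.

Let xiE x y : eot_density c P' Q' x y = xi x y * expR (h (x, y)).
Proof.
rewrite !eot_densityE -expRD /h /a /b /a0 /b0 /=; congr expR.
move: s (eot_potentials c P' Q') (eot_potentials c P Q) => t [f g] [f' g'] /=.
by ring.
Qed.

Let ba : bmeas a.
Proof.
apply: bmeasD; last exact: bmeas_cst.
by apply: bmeasB; [case: (eot_potentials_pair bc cK P' Q')|
  case: (eot_potentials_pair bc cK P Q)].
Qed.

Let bb0 : bmeas b0.
Proof.
by apply: bmeasB; [case: (eot_potentials_pair bc cK P' Q')|
  case: (eot_potentials_pair bc cK P Q)].
Qed.

Let bb : bmeas b.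
Proof. by apply: bmeasB => //; exact: bmeas_cst. Qed.

Let b_mean0 : \int[Q']_y b y = 0.
Proof.
rewrite integral_boundedB//; last exact: bmeas_cst.
by rewrite integral_cst1 subrr.
Qed.

Let hB z : `|h z| <= B.
Proof.
case: z => x y; rewrite /h /=.
have := schrodinger_pair_sum_le bc cK (eot_potentials_pair bc cK P' Q') x y.
have := schrodinger_pair_sum_le bc cK (eot_potentials_pair bc cK P Q) x y.
rewrite /a /b /a0 /b0 /B !ler_norml.
move: s (eot_potentials c P' Q') (eot_potentials c P Q) => t [f g] [f' g'] /=.
by lra.
Qed.

Let bh : bmeas h.
Proof. by apply: bmeasD; exact: bmeas_comp. Qed.

Local Notation mu := ((P' \x Q')%E : probability (T * T)%type R).

Local Notation E F := (Rintegral mu setT F).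

Let bxi := bmeas_eot_density bc cK P Q.
Let bxi' := bmeas_eot_density bc cK P' Q'.

Let E_fst (F : T * T -> R) (p : T -> R) : bmeas F -> bmeas p ->
  E (fun z => p z.1 * F z) = \int[P']_x (p x * \int[Q']_y F (x, y)).
Proof.
move=> bF bp; rewrite Rintegral_prod_bounded; last first.
  by apply: bmeasM => //; exact: bmeas_comp.
apply: eq_Rintegral => x _ /=; rewrite integral_boundedZ//.
exact: (bmeas_snd x bF).
Qed.

Let E_snd (F : T * T -> R) (p : T -> R) : bmeas F -> bmeas p ->
  E (fun z => p z.2 * F z) = \int[Q']_y (p y * \int[P']_x F (x, y)).
Proof.
move=> bF bp; have bpF : bmeas (fun z : T * T => p z.2 * F z).
  by apply: bmeasM => //; exact: bmeas_comp.
rewrite (Rintegral_prod_bounded _ _ bpF) (bounded_fubini P' Q' bpF).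
apply: eq_Rintegral => x _ /=; rewrite integral_boundedZ//.
exact: (bmeas_fst x bF).
Qed.

Local Notation row F := (\int[P']_x (\int[Q']_y F (x, y)) ^+ 2).
Local Notation col F := (\int[Q']_y (\int[P']_x F (x, y)) ^+ 2).
Local Notation sq := (\int[P']_x (a x ^+ 2) + \int[Q']_y (b y ^+ 2)).

Let E_sq : E (fun z => h z ^+ 2) = sq.
Proof.
have ba1 : bmeas (fun z : T * T => a z.1) by exact: bmeas_comp.
have bb2 : bmeas (fun z : T * T => b z.2) by exact: bmeas_comp.
have ba2 := bmeas_sqr ba1; have bbb2 := bmeas_sqr bb2.
have one : bmeas (fun z : T * T => 1 : R) by exact: bmeas_cst.
rewrite (@eq_Rintegral _ _ _ _ _ (fun z => (a z.1 ^+ 2 * 1 + b z.2 ^+ 2 * 1) +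
  2 * (a z.1 * b z.2))); last by move=> z _; rewrite /h; ring.
rewrite integral_boundedD; last first.
  - by apply: bmeasM; [exact: bmeas_cst|exact: bmeasM].
  - by apply: bmeasD; exact: bmeasM.
rewrite integral_boundedD; [|exact: bmeasM..].
rewrite integral_boundedZ; last exact: bmeasM.
rewrite (E_fst one (bmeas_sqr ba)) (E_snd one (bmeas_sqr bb)) (E_fst bb2 ba) /= b_mean0.
rewrite -[RHS]addr0; congr (_ + _ + _).
- by apply: eq_Rintegral => x _; rewrite integral_cst1 mulr1.
- by apply: eq_Rintegral => x _; rewrite integral_cst1 mulr1.
- rewrite (@eq_Rintegral _ _ _ _ _ (fun=> 0)) ?integral_cst1 ?mulr0//.
  by move=> x _; rewrite mulr0.
Qed.

(** As [h] is a sum of functions of one variable, only the one-variable integrals of [F] enter, and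
    these are small for centred kernels and empirical measures. The weight [eta] is [kappa] in the
    stability bound, where [sq] has to be absorbed, and 1 in the expansion of the cost. *)
Let cross (F : T * T -> R) (eta : R) : bmeas F -> 0 < eta ->
  2 * `|E (fun z => h z * F z)| <= eta * sq + eta^-1 * (row F + col F).
Proof.
move=> bF eta0.
have amgm (x y : R) : 2 * `|x * y| <= eta * x ^+ 2 + eta^-1 * y ^+ 2.
  rewrite -subr_ge0 normrM -(real_normK (num_real x)) -(real_normK (num_real y)).
  have -> : eta * `|x| ^+ 2 + eta^-1 * `|y| ^+ 2 - 2 * (`|x| * `|y|) =
      eta * (`|x| - eta^-1 * `|y|) ^+ 2 by field; rewrite gt_eqF.
  by rewrite mulr_ge0 ?sqr_ge0// ltW.
have bZ d' (S : measurableType d') (r : R) (p : S -> R) : bmeas p ->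
    bmeas (fun x => r * p x).
  by move=> bp; apply: bmeasM => //; exact: bmeas_cst.
have half (mu' : probability T R) (p q : T -> R) : bmeas p -> bmeas q ->
    2 * `|\int[mu']_x (p x * q x)| <=
    eta * \int[mu']_x (p x ^+ 2) + eta^-1 * \int[mu']_x (q x ^+ 2).
  move=> bp bq; have bpq : bmeas (fun x => p x * q x) by exact: bmeasM.
  rewrite -!integral_boundedZ; [|exact: bmeas_sqr..].
  rewrite -integral_boundedD; [|exact/bZ/bmeas_sqr..].
  apply: (@le_trans _ _ (2 * \int[mu']_x `|p x * q x|)).
    by rewrite ler_wpM2l// le_norm_integral_bounded.
  have bnpq := bmeas_norm bpq.
  rewrite -integral_boundedZ//; apply: le_integral_bounded.
  - exact: bZ.
  - by apply: bmeasD; exact/bZ/bmeas_sqr.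
  - by move=> x; exact: amgm.
have brow : bmeas (fun x => \int[Q']_y F (x, y)).
  exact: bmeas_integral_snd.
have bcol : bmeas (fun y => \int[P']_x F (x, y)).
  exact: bmeas_integral_fst.
rewrite (@eq_Rintegral _ _ _ _ _ (fun z => a z.1 * F z + b z.2 * F z)); last first.
  by move=> z _; rewrite /h mulrDl.
rewrite integral_boundedD; last first.
- by apply: bmeasM => //; exact: bmeas_comp.
- by apply: bmeasM => //; exact: bmeas_comp.
rewrite (E_fst bF ba) (E_snd bF bb).
have := half P' a _ ba brow; have := half Q' b _ bb bcol.
have := ler_normD (\int[P']_x (a x * \int[Q']_y F (x, y)))
  (\int[Q']_y (b y * \int[P']_x F (x, y))).
move: (\int[P']_x (a x ^+ 2)) (\int[Q']_y (b y ^+ 2)) (row F) (col F)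
  (\int[P']_x (a x * \int[Q']_y F (x, y))) (\int[Q']_y (b y * \int[P']_x F (x, y))) => *.
lra.
Qed.

(** Modulus of strong convexity of the dual problem: lower bound of [xi] times that of the
    exponential on [[-B, B]]. *)
Let kappa := expR (- (K *+ 4)) * expR (- B).

Let kappa0 : 0 < kappa. Proof. by rewrite mulr_gt0 ?expR_gt0. Qed.

(* Strong convexity of the dual objective: its gradient vanishes at the
   perturbed potentials and is [density_kernel] integrated at the original ones. *)
Let sq_le : kappa ^+ 2 * sq <= row density_kernel + col density_kernel.
Proof.
have bk := bmeas_density_kernel.
have bxih : bmeas (fun z => xi z.1 z.2 * expR (h z)).
  by apply: bmeasM => //; exact: bmeas_expR.
have bk' : bmeas (fun z => xi z.1 z.2 * expR (h z) - 1).
  by apply: bmeasB => //; exact: bmeas_cst.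
have zero : E (fun z => h z * (xi z.1 z.2 * expR (h z) - 1)) = 0.
  rewrite (@eq_Rintegral _ _ _ _ _ (fun z =>
    a z.1 * (xi z.1 z.2 * expR (h z) - 1) + b z.2 * (xi z.1 z.2 * expR (h z) - 1))); last first.
    by move=> z _; rewrite /h mulrDl.
  rewrite integral_boundedD; last first.
  - by apply: bmeasM => //; exact: bmeas_comp.
  - by apply: bmeasM => //; exact: bmeas_comp.
  rewrite (E_fst bk' ba) (E_snd bk' bb) -[RHS]addr0; congr (_ + _).
    rewrite -[RHS](integral_cst1 P'); apply: eq_Rintegral => x _ /=.
    rewrite integral_boundedB; last first.
    - exact: bmeas_cst.
    - exact: (bmeas_snd x bxih).
    rewrite integral_cst1 (@eq_Rintegral _ _ _ _ _ (eot_density c P' Q' x)); last first.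
      by move=> y _; rewrite xiE.
    by rewrite (integral_eot_density_snd bc cK) subrr mulr0.
  rewrite -[RHS](integral_cst1 Q'); apply: eq_Rintegral => y _ /=.
  rewrite integral_boundedB; last first.
  - exact: bmeas_cst.
  - exact: (bmeas_fst y bxih).
  rewrite integral_cst1 (@eq_Rintegral _ _ _ _ _ (eot_density c P' Q' ^~ y)); last first.
    by move=> x _; rewrite xiE.
  by rewrite (integral_eot_density_fst bc cK) subrr mulr0.
have := cross bk kappa0.
have bhk : bmeas (fun z => h z * density_kernel z) by exact: bmeasM.
have bhk' : bmeas (fun z => h z * (xi z.1 z.2 * expR (h z) - 1)).
  exact: bmeasM.
have low : kappa * sq <= - E (fun z => h z * density_kernel z).
  rewrite -[leRHS]add0r -[X in _ <= X - _]zero -integral_boundedB// -E_sq.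
  rewrite -integral_boundedZ; last exact: bmeas_sqr.
  apply: le_integral_bounded.
  - by apply: bmeasM; [exact: bmeas_cst|exact: bmeas_sqr].
  - exact: bmeasB.
  move=> z; rewrite /density_kernel.
  rewrite (_ : _ - _ = xi z.1 z.2 * ((expR (h z) - 1) * h z)); last by ring.
  rewrite /kappa -mulrA; apply: ler_pM; first exact: expR_ge0.
  - exact: mulr_ge0 (expR_ge0 _) (sqr_ge0 _).
  - by have /andP[] := eot_density_bounds bc cK P Q z.1 z.2.
  - exact: expR_monotone_gap.
have := ler_norm (- E (fun z => h z * density_kernel z)); rewrite normrN.
move: low; move: (E _) (row _) (col _) sq => e r1 r2 q low le1 le2.
have le3 : kappa * q <= kappa^-1 * (r1 + r2) by lra.
have := ler_wpM2l (ltW kappa0) le3.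
by rewrite mulrA -expr2 mulrA divff ?mul1r// gt_eqF.
Qed.

(** The new plan has marginals [P'] and [Q'], so [u] and [v] can be integrated against its density,
    which leaves [\int w expR h]. In the expansion of [expR h], [cross] handles the linear term and
    [sq_le] the quadratic remainder. The bound holds for any bounded [u], [v]; the linear system is
    what makes its right side small. *)
Lemma sinkhorn_cost_perturbation (L : R) :
  (forall z, `|w z| <= L) ->
  `|sinkhorn_cost c P' Q' - (\int[P']_x u x + \int[Q']_y v y)| <=
  `|\int[P']_x \int[Q']_y w (x, y)| +
  (1 + L * expR (K *+ 6)) * (1 + (expR (- (K *+ 4)) * expR (- (K *+ 6))) ^- 2) *
  (row density_kernel + col density_kernel + (row w + col w)).
Proof.
move=> wL; have bw := bmeas_dual_kernel.
have L0 : 0 <= L by rewrite (le_trans _ (wL point)).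
have beh := bmeas_expR bh.
have bweh : bmeas (fun z => w z * expR (h z)) by exact: bmeasM.
have costE : sinkhorn_cost c P' Q' - (\int[P']_x u x + \int[Q']_y v y) =
    E (fun z => w z * expR (h z)).
  rewrite (sinkhorn_costE bc cK).
  have bcx : bmeas (fun z => c z * eot_density c P' Q' z.1 z.2).
    exact: bmeasM.
  have bux : bmeas (fun z => u z.1 * eot_density c P' Q' z.1 z.2).
    by apply: bmeasM => //; exact: bmeas_comp.
  have bvx : bmeas (fun z => v z.2 * eot_density c P' Q' z.1 z.2).
    by apply: bmeasM => //; exact: bmeas_comp.
  rewrite -(Rintegral_prod_bounded P' Q' bcx).
  have -> : \int[P']_x u x = E (fun z => u z.1 * eot_density c P' Q' z.1 z.2).
    rewrite (E_fst bxi' bu); apply: eq_Rintegral => x _ /=.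
    by rewrite (integral_eot_density_snd bc cK) mulr1.
  have -> : \int[Q']_y v y = E (fun z => v z.2 * eot_density c P' Q' z.1 z.2).
    rewrite (E_snd bxi' bv); apply: eq_Rintegral => y _ /=.
    by rewrite (integral_eot_density_fst bc cK) mulr1.
  rewrite -integral_boundedD// -integral_boundedB//; last exact: bmeasD.
  apply: eq_Rintegral => -[x y] _; rewrite xiE /w /=; ring.
have bwh : bmeas (fun z => h z * w z) by exact: bmeasM.
have br : bmeas (fun z => w z * (expR (h z) - 1 - h z)).
  apply: bmeasM => //; apply: bmeasB => //.
  by apply: bmeasB => //; exact: bmeas_cst.
have split3 : E (fun z => w z * expR (h z)) =
    E w + (E (fun z => h z * w z) + E (fun z => w z * (expR (h z) - 1 - h z))).
  rewrite -!integral_boundedD//; last exact: bmeasD.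
  apply: eq_Rintegral => z _; rewrite -/(dual_kernel z).
  by move: (dual_kernel z) (h z) => t r; ring.
have rem : `|E (fun z => w z * (expR (h z) - 1 - h z))| <= L * expR (K *+ 6) * sq.
  rewrite (le_trans (le_norm_integral_bounded _ br))// -E_sq -integral_boundedZ; last exact: bmeas_sqr.
  apply: le_integral_bounded.
  - exact: bmeas_norm.
  - by apply: bmeasM; [exact: bmeas_cst|exact: bmeas_sqr].
  move=> z; rewrite normrM -mulrA ler_pM//; exact: expR_taylor1.
have sq_le' : sq <= kappa ^- 2 * (row density_kernel + col density_kernel).
  by rewrite ler_pdivlMl ?exprn_gt0//; exact: sq_le.
have crs := cross bw ltr01.
rewrite costE split3 -(Rintegral_prod_bounded P' Q' bw).
have tri := ler_normD (E w) (E (fun z => h z * w z) + E (fun z => w z * (expR (h z) - 1 - h z))).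
have tri2 := ler_normD (E (fun z => h z * w z)) (E (fun z => w z * (expR (h z) - 1 - h z))).
apply: (le_trans tri); rewrite lerD2l; apply: (le_trans tri2).
have rk : 0 <= row density_kernel + col density_kernel.
  by rewrite addr_ge0//; apply: Rintegral_ge0 => x _; exact: sqr_ge0.
have rw : 0 <= row w + col w.
  by rewrite addr_ge0//; apply: Rintegral_ge0 => x _; exact: sqr_ge0.
rewrite -/B -/kappa.
have k0 : 0 <= kappa ^- 2 by rewrite invr_ge0 exprn_ge0// ltW.
have Le0 : 0 <= L * expR (K *+ 6) by rewrite mulr_ge0 ?expR_ge0.
move: rem sq_le' crs rk rw k0 Le0; rewrite -/B invr1 !mul1r.
move: (row density_kernel + _) (row w + _) (kappa ^- 2) (L * _) sq => r1 r2 k l q.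
move: (`|_|) (`|_|) => e1 e2 h1 h2 h3 h4 h5 h6 h7.
have q1 : l * q <= l * (k * r1) by rewrite ler_wpM2l.
have p1 : 0 <= k * r1 by rewrite mulr_ge0.
have p2 : 0 <= l * r1 by rewrite mulr_ge0.
have p3 : 0 <= (1 + l) * (1 + k) * r2 - r2.
  rewrite (_ : _ - _ = (k + l + l * k) * r2); last by ring.
  by rewrite mulr_ge0// !addr_ge0// mulr_ge0.
have -> : (1 + l) * (1 + k) * (r1 + r2) = r1 + l * r1 + k * r1 + l * (k * r1) + (1 + l) * (1 + k) * r2 by ring.
lra.
Qed.

End perturbed_marginals.
End perturbation.

(** * The linear system behind the variance *)

Lemma bmeas_Lfun2 d (T : measurableType d) (R : realType)
    (mu : probability T R) (f : T -> R) :
  bmeas f -> f \in Lfun mu 2%:E.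
Proof.
move=> bf; have mf := bmeas_fun bf.
rewrite inE; apply/andP; split; first by rewrite inE.
rewrite inE /finite_norm unlock /Lnorm /=.
rewrite poweR_lty//.
have bf2 : bmeas (fun x => `|f x| `^ 2).
  rewrite (_ : (fun _ => _) = fun x => `|f x| ^+ 2).
    exact/bmeas_sqr/bmeas_norm.
  by apply/funext => x; rewrite powR_mulrn.
by rewrite EFin_integral_bounded// ltry.
Qed.

(** * Markov kernels bounded below *)

Section markov_operator.
Context d1 d2 (T1 : measurableType d1) (T2 : measurableType d2) (R : realType).
Variables (k : T1 * T2 -> R) (P : probability T1 R) (Q : probability T2 R) (r : R).
Hypotheses (bk : bmeas k) (r0 : 0 < r) (kr : forall z, r <= k z)
  (kP : forall y, \int[P]_x k (x, y) = 1) (kQ : forall x, \int[Q]_y k (x, y) = 1).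

Local Notation A := (fun (f : T1 -> R) y => \int[P]_x (k (x, y) * f x)).
Local Notation B := (fun (g : T2 -> R) x => \int[Q]_y (k (x, y) * g y)).

Let k0 z : 0 <= k z. Proof. by rewrite (le_trans _ (kr z))// ltW. Qed.

Lemma markov_gap_itv : 0 <= 1 - r < 1.
Proof.
rewrite subr_ge0 ltrBlDr ltrDl r0 andbT -(kP point).
by apply: integral_bounded_ge => //; exact: (bmeas_fst _ bk).
Qed.

Let bkf f : bmeas f -> bmeas (fun z => k z * f z.1).
Proof. by move=> bf; apply: bmeasM => //; exact: bmeas_comp. Qed.

Let bkg g : bmeas g -> bmeas (fun z => k z * g z.2).
Proof. by move=> bg; apply: bmeasM => //; exact: bmeas_comp. Qed.

Lemma bmeas_markov_fst f : bmeas f -> bmeas (A f).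
Proof. by move=> bf; exact: (bmeas_integral_fst P (bkf bf)). Qed.

Lemma bmeas_markov_snd g : bmeas g -> bmeas (B g).
Proof. by move=> bg; exact: (bmeas_integral_snd Q (bkg bg)). Qed.

Lemma integral_markov_fst f : bmeas f ->
  \int[Q]_y A f y = \int[P]_x f x.
Proof.
move=> bf; rewrite -(bounded_fubini P Q (bkf bf)); apply: eq_Rintegral => x _ /=.
by rewrite integral_boundedZr ?kQ ?mul1r//; exact: (bmeas_snd _ bk).
Qed.

Lemma integral_markov_snd g : bmeas g ->
  \int[P]_x B g x = \int[Q]_y g y.
Proof.
move=> bg; rewrite (bounded_fubini P Q (bkg bg)); apply: eq_Rintegral => x _ /=.
by rewrite integral_boundedZr ?kP ?mul1r//; exact: (bmeas_fst _ bk).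
Qed.

Lemma markov_fstB f f' y : bmeas f -> bmeas f' ->
  A (fun x => f x - f' x) y = A f y - A f' y.
Proof.
move=> bf bf'; rewrite -integral_boundedB; [|exact: (bmeas_fst y (bkf bf))|
  exact: (bmeas_fst y (bkf bf'))].
by apply: eq_Rintegral => x _; rewrite mulrBr.
Qed.

Lemma markov_sndB g g' x : bmeas g -> bmeas g' ->
  B (fun y => g y - g' y) x = B g x - B g' x.
Proof.
move=> bg bg'; rewrite -integral_boundedB; [|exact: (bmeas_snd x (bkg bg))|
  exact: (bmeas_snd x (bkg bg'))].
by apply: eq_Rintegral => y _; rewrite mulrBr.
Qed.

Lemma markov_fst_le f M y : bmeas f -> (forall x, `|f x| <= M) -> `|A f y| <= M.
Proof.
move=> bf fM.
have bkM : bmeas (fun x => k (x, y) * M).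
  by apply: bmeasM; [exact: (bmeas_fst y bk)|
    exact: bmeas_cst].
have -> : M = \int[P]_x (k (x, y) * M).
  by rewrite integral_boundedZr ?kP ?mul1r//; exact: (bmeas_fst _ bk).
have bkf' := bmeas_fst y (bkf bf).
rewrite (le_trans (le_norm_integral_bounded _ bkf'))//.
apply: le_integral_bounded => //; first exact: bmeas_norm.
by move=> x /=; rewrite normrM ger0_norm// ler_wpM2l.
Qed.

Lemma markov_snd_le g M x : bmeas g -> (forall y, `|g y| <= M) -> `|B g x| <= M.
Proof.
move=> bg gM.
have bkM : bmeas (fun y => k (x, y) * M).
  by apply: bmeasM; [exact: (bmeas_snd x bk)|
    exact: bmeas_cst].
have -> : M = \int[Q]_y (k (x, y) * M).
  by rewrite integral_boundedZr ?kQ ?mul1r//; exact: (bmeas_snd _ bk).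
have bkg' := bmeas_snd x (bkg bg).
rewrite (le_trans (le_norm_integral_bounded _ bkg'))//.
apply: le_integral_bounded => //; first exact: bmeas_norm.
by move=> y /=; rewrite normrM ger0_norm// ler_wpM2l.
Qed.

(** Doeblin's argument: the constant part [r] of the kernel does not see a mean-zero function, and
    the remaining kernel [k - r] has mass [1 - r]. *)
Lemma markov_fst_contract f M y : bmeas f -> \int[P]_x f x = 0 ->
  (forall x, `|f x| <= M) -> `|A f y| <= (1 - r) * M.
Proof.
move=> bf f0 fM.
have b1 := bmeas_cst T1 (1 : R).
have upper h : bmeas h -> \int[P]_x h x = 0 ->
    (forall x, h x <= M) -> A h y <= (1 - r) * M.
  move=> bh h0 hM.
  have r1 x : r * 1 <= k (x, y) by rewrite mulr1.
  have := integral_minorized b1 (bmeas_fst y bk) bh (integral_cst1 P 1) (kP y)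
    r1 hM.
  rewrite (@eq_Rintegral _ _ _ _ _ h (fun x => h x * 1)); last by move=> x _; rewrite mulr1.
  rewrite h0 mulr0 add0r (@eq_Rintegral _ _ _ _ _ (fun x => k (x, y) * h x))//.
  by move=> x _; rewrite mulrC.
have bNf := bmeasN bf.
rewrite ler_norml upper//; last by move=> x; rewrite (le_trans (ler_norm _)).
rewrite andbT -lerN2 opprK; have := upper (fun x => - f x) bNf.
rewrite (@eq_Rintegral _ _ _ _ _ (fun x => -1 * f x)); last by move=> x _; rewrite mulN1r.
rewrite integral_boundedZ// f0 mulr0 => /(_ erefl).
rewrite (@eq_Rintegral _ _ _ _ _ (fun x => -1 * (k (x, y) * f x))); last first.
  by move=> x _; ring.
rewrite integral_boundedZ ?mulN1r; last exact: (bmeas_fst y (bkf bf)).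
by apply=> x; rewrite (le_trans (ler_norm _))// normrN.
Qed.

(** The Neumann series: its partial sums [U n] keep mean zero because both operators preserve means,
    so each increment shrinks by [1 - r] in supremum norm. *)
Lemma markov_resolvent h : bmeas h -> \int[P]_x h x = 0 ->
  exists2 u, bmeas u & \int[P]_x u x = 0 /\ forall x, u x = h x + B (A u) x.
Proof.
move=> bh h0; have /andP[q0 q1] := markov_gap_itv.
have [H H0 hH] := bmeas_bound bh.
pose F u x := h x + B (A u) x.
pose U n := iter n F (fun=> 0).
have bF u : bmeas u -> bmeas (F u).
  move=> bu; apply: bmeasD => //.
  exact/bmeas_markov_snd/bmeas_markov_fst.
have F_mean u : bmeas u -> \int[P]_x u x = 0 -> \int[P]_x F u x = 0.
  move=> bu u0; have bAu := bmeas_markov_fst bu.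
  rewrite integral_boundedD//; last exact: bmeas_markov_snd.
  by rewrite integral_markov_snd// integral_markov_fst// h0 u0 addr0.
have bU n : bmeas (U n).
  by elim: n => [|n IH]; [exact: bmeas_cst|exact: bF].
have U0 n : \int[P]_x U n x = 0.
  by elim: n => [|n IH]; [exact: integral_cst1|exact: F_mean].
have FB u u' x : bmeas u -> bmeas u' ->
    F u x - F u' x = B (A (fun x => u x - u' x)) x.
  move=> bu bu'; have bAu := bmeas_markov_fst bu.
  have bAu' := bmeas_markov_fst bu'.
  rewrite /F opprD addrACA subrr add0r -markov_sndB//.
  by congr Rintegral; apply/funext => y; rewrite markov_fstB.
have US n x : `|U n.+1 x - U n x| <= H * (1 - r) ^+ n.
  elim: n x => [|n IH] x.
    rewrite expr0 mulr1 subr0 /= /F.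
    rewrite [X in h x + X](_ : _ = 0) ?addr0//.
    rewrite -[RHS](integral_cst1 Q); apply: eq_Rintegral => y _.
    rewrite [X in _ * X](_ : _ = 0) ?mulr0// -[RHS](integral_cst1 P).
    by apply: eq_Rintegral => x' _; rewrite mulr0.
  rewrite -[U n.+2]/(F (U n.+1)) -[U n.+1 in X in _ - X]/(F (U n)) FB//.
  have bUU : bmeas (fun x => U n.+1 x - U n x) by exact: bmeasB.
  apply: markov_snd_le; first exact: bmeas_markov_fst.
  move=> y; rewrite exprS mulrCA; apply: markov_fst_contract => //.
  by rewrite integral_boundedB// !U0 subrr.
have [u bu uU] := geometric_cauchy_limit H0 markov_gap_itv bU US.
have [e eE] : exists e : nat -> R, e = fun n => H / (1 - (1 - r)) * (1 - r) ^+ n by eexists.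
have {}uU n x : `|u x - U n x| <= e n by rewrite eE.
have e0 : e @ \oo --> (0 : R) by rewrite eE; exact: cvg_geometric0 markov_gap_itv.
exists u => //; split.
  apply/eqP; rewrite -normr_le0; apply: (cvgr_to_ge e0); near=> n.
  rewrite -[X in `|X|]subr0 -[X in _ - X](U0 n) -integral_boundedB//.
  by apply: integral_bounded_norm => //; exact: bmeasB.
move=> x; apply/eqP; rewrite -subr_eq0 -normr_le0 -/(F u x).
have e02 : (fun n => e n.+1 + e n) @ \oo --> (0 : R).
  rewrite -[X in _ --> X]addr0; apply: cvgD => //.
  by rewrite (cvg_shiftS e).
apply: (cvgr_to_ge e02); near=> n.
have -> : u x - F u x = (u x - U n.+1 x) - (F u x - F (U n) x).
  by rewrite -[U n.+1]/(F (U n)); ring.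
rewrite (le_trans (ler_normB _ _))// lerD// FB//.
have buU : bmeas (fun x => u x - U n x) by exact: bmeasB.
apply: markov_snd_le; first exact: bmeas_markov_fst.
by move=> y; exact: markov_fst_le.
Unshelve. all: by end_near.
Qed.

Lemma markov_integrable_fst w y : P.-integrable setT (EFin \o w) ->
  P.-integrable setT (EFin \o (fun x => k (x, y) * w x)).
Proof.
move=> iw; have [L L0 kL] := bmeas_bound bk.
have mw : measurable_fun setT w by apply/measurable_EFinP; exact: measurable_int iw.
have inorm : P.-integrable setT (EFin \o (fun x => `|w x|)) := integrable_norm iw.
apply: (@le_integrable _ _ _ _ _ _ _ (EFin \o (fun x => L * `|w x|))) => //.
- apply/measurable_EFinP; apply: measurable_funM => //.
  by apply: bmeas_fun; exact: (bmeas_fst y bk).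
- move=> x _ /=; rewrite lee_fin normrM [leRHS]ger0_norm ?mulr_ge0//.
  by rewrite ler_wpM2r.
- exact: (integrableZl measurableT L inorm).
Qed.

(** A bounded kernel sends integrable functions to bounded ones. After one application of [A], an
    arbitrary square integrable solution is back among bounded functions. *)
Lemma bmeas_markov_integrable w : P.-integrable setT (EFin \o w) ->
  bmeas (A w).
Proof.
move=> iw; have [L L0 kL] := bmeas_bound bk.
have mw : measurable_fun setT w by apply/measurable_EFinP; exact: measurable_int iw.
have mw1 : measurable_fun setT (fun z : T1 * T2 => w z.1) by exact: measurableT_comp.
have mk : measurable_fun setT k by exact: bmeas_fun.
have inorm : P.-integrable setT (EFin \o (fun x => `|w x|)) := integrable_norm iw.
have iF : (P \x Q)%E.-integrable setT (EFin \o (fun z => k z * w z.1)).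
  apply/integrable12ltyP; first by apply/measurable_EFinP; exact: measurable_funM.
  move/integrableP : (iw) => [_]; apply: le_lt_trans.
  apply: ge0_le_integral => //.
  - by move=> x _; apply: integral_ge0.
  - apply: (measurable_fun_fubini_tonelli_F (fun z => `|(k z * w z.1)%:E|%E)) => //.
    apply: measurableT_comp => //; apply/measurable_EFinP; exact: measurable_funM.
  - by apply: measurableT_comp => //; exact/measurable_EFinP.
  - move=> x _ /=; rewrite (@eq_integral _ _ _ _ _ (fun y => (k (x, y))%:E * `|w x|%:E)%E); last first.
      by move=> y _; rewrite -EFinM normrM ger0_norm.
    have bkx := bmeas_snd x bk.
    rewrite integralZr//; last exact: (bmeas_integrable Q bkx).
    by rewrite EFin_integral_bounded// kQ mul1e.
apply: (@bmeas_intro _ _ _ _ (L * \int[P]_x `|w x|)).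
  apply/measurable_EFinP.
  apply: eq_measurable_fun (measurable_fubini_G iF) => y _ /=.
  exact: (EFin_Rintegral (markov_integrable_fst y iw)).
move=> y; have ikw := markov_integrable_fst y iw.
rewrite (le_trans (le_normr_Rintegral _ _))// -RintegralZl//.
apply: le_Rintegral => //; first exact: integrable_norm ikw.
  exact: (integrableZl measurableT L inorm).
by move=> x _; rewrite normrM ler_wpM2r.
Qed.

(* [A] contracts the L1 norm of a mean-zero function by [1 - r] and [B] does
   not increase it. *)
Lemma markov_fixpoint_ae0 w : P.-integrable setT (EFin \o w) -> \int[P]_x w x = 0 ->
  ae_eq P setT w (B (A w)) -> ae_eq P setT w (fun=> 0).
Proof.
move=> iw w0 wBA; have /andP[q0 q1] := markov_gap_itv.
have mw : measurable_fun setT w by apply/measurable_EFinP; exact: measurable_int iw.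
have mw1 : measurable_fun setT (fun z : T1 * T2 => w z.1) by exact: measurableT_comp.
have mk : measurable_fun setT k by exact: bmeas_fun.
have [L L0 kL] := bmeas_bound bk.
have inorm : P.-integrable setT (EFin \o (fun x => `|w x|)) := integrable_norm iw.
have ikw y := markov_integrable_fst y iw.
have bAw := bmeas_markov_integrable iw.
have ikrw y : P.-integrable setT (EFin \o (fun x => (k (x, y) - r) * `|w x|)).
  apply: (@le_integrable _ _ _ _ _ _ _ (EFin \o (fun x => L * `|w x|))) => //.
  - apply/measurable_EFinP; apply: measurable_funM => //; last exact: measurableT_comp.
    apply: measurable_funB => //.
    by apply: bmeas_fun; exact: (bmeas_fst y bk).
  - move=> x _ /=; rewrite lee_fin normrM normr_id [leRHS]ger0_norm ?mulr_ge0//.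
    rewrite ler_wpM2r// ger0_norm ?subr_ge0//.
    by rewrite (le_trans _ (kL (x, y)))// (le_trans _ (ler_norm _))// gerBl ltW.
  - exact: (integrableZl measurableT L inorm).
set W := \int[P]_x `|w x|.
have W0 : 0 <= W by apply: Rintegral_ge0.
(* Since [w] has mean zero, [k] may be replaced by the nonnegative kernel [k - r] before absolute
   values are taken. *)
have Awle y : `|A w y| <= \int[P]_x ((k (x, y) - r) * `|w x|).
  have -> : A w y = \int[P]_x ((k (x, y) - r) * w x).
    rewrite (@eq_Rintegral _ _ _ _ _ (fun x => k (x, y) * w x - r * w x) (fun x => (k (x, y) - r) * w x)); last first.
      by move=> x _; rewrite mulrBl.
    rewrite RintegralB//; last exact: (integrableZl measurableT r iw).
    by rewrite RintegralZl// w0 mulr0 subr0.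
  have ikrw' : P.-integrable setT (EFin \o (fun x => (k (x, y) - r) * w x)).
    apply: (@le_integrable _ _ _ _ _ _ _ (EFin \o (fun x => (k (x, y) - r) * `|w x|))) => //.
      apply/measurable_EFinP; apply: measurable_funM => //; apply: measurable_funB => //.
      by apply: bmeas_fun; exact: (bmeas_fst y bk).
    by move=> x _ /=; rewrite lee_fin !normrM normr_id.
  rewrite (le_trans (le_normr_Rintegral _ _))//.
  rewrite (@eq_Rintegral _ _ _ _ _ (fun x => (k (x, y) - r) * `|w x|))//.
  by move=> x _; rewrite normrM ger0_norm// subr_ge0.
have AwL1 : \int[Q]_y `|A w y| <= (1 - r) * W.
  have bnAw := bmeas_norm bAw.
  have mF : measurable_fun setT (fun z : T1 * T2 => ((k z - r) * `|w z.1|)%:E).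
    apply/measurable_EFinP; apply: measurable_funM; last exact: measurableT_comp.
    exact: measurable_funB.
  have F0 z : (0 <= ((k z - r) * `|w z.1|)%:E)%E by rewrite lee_fin mulr_ge0// subr_ge0.
  rewrite -lee_fin -EFin_integral_bounded//.
  apply: (@le_trans _ _ (\int[Q]_y \int[P]_x ((k (x, y) - r) * `|w x|)%:E)%E).
    apply: ge0_le_integral => //.
    - exact/measurable_EFinP/bmeas_fun.
    - exact: (measurable_fun_fubini_tonelli_G _ mF).
    - by move=> y _; rewrite (EFin_Rintegral (ikrw y)) lee_fin.
  rewrite -(@fubini_tonelli _ _ _ _ _ P Q _ mF F0) EFinM /W -(EFin_Rintegral inorm).
  rewrite -integralZl//; apply: ge0_le_integral => //.
  - by move=> x _; apply: integral_ge0.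
  - exact: (measurable_fun_fubini_tonelli_F _ mF).
  - by apply: measurable_funeM; apply/measurable_EFinP; exact: measurableT_comp.
  - move=> x _; rewrite (@eq_integral _ _ _ _ _ (fun y => (k (x, y) - r)%:E * `|w x|%:E)%E)//.
    have bkx := bmeas_snd x bk.
    have bkr : bmeas (fun y => k (x, y) - r).
      by apply: bmeasB => //; exact: bmeas_cst.
    rewrite integralZr//; last exact: (bmeas_integrable Q bkr).
    rewrite EFin_integral_bounded// integral_boundedB//; last exact: bmeas_cst.
    by rewrite kQ integral_cst1.
have BAL1 : \int[P]_x `|B (A w) x| <= \int[Q]_y `|A w y|.
  have bBA := bmeas_markov_snd bAw.
  have bnAw := bmeas_norm bAw.
  rewrite -(integral_markov_snd bnAw).
  apply: le_integral_bounded; first exact: bmeas_norm.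
    exact: bmeas_markov_snd.
  move=> x; have bkAw := bmeas_snd x (bkg bAw).
  rewrite (le_trans (le_norm_integral_bounded _ bkAw))//=.
  rewrite (@eq_Rintegral _ _ _ _ _ (fun y => k (x, y) * `|A w y|))//.
  by move=> y _; rewrite normrM ger0_norm.
have WBA : W = \int[P]_x `|B (A w) x|.
  rewrite /W /Rintegral; congr fine; apply: ae_eq_integral => //.
  - by apply/measurable_EFinP; exact: measurableT_comp.
  - apply/measurable_EFinP; apply: measurableT_comp => //; apply: bmeas_fun.
    exact: bmeas_markov_snd.
  - by move: wBA; apply: filterS => x /(_ Logic.I) -> _.
have W00 : W = 0.
  have : W <= (1 - r) * W by rewrite {1}WBA (le_trans BAL1).
  rewrite mulrBl mul1r => h; apply/eqP; rewrite eq_le W0 andbT.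
  by rewrite -(ler_pM2l r0) mulr0; lra.
have : ae_eq P setT (EFin \o w) (cst 0%E).
  apply/ae_eq_integral_abs => //; first exact/measurable_EFinP.
  rewrite -[RHS]/(0%:E) -W00 /W -(EFin_Rintegral inorm); exact: eq_integral.
by apply: filterS => x /= /(_ Logic.I) [] ->.
Qed.

(** The bounded solution [u] shows that [inv_subI] does not fall back on its default. The selected
    solution differs from [u] by a mean-zero fixed point of [B A], which vanishes almost everywhere,
    and the variance does not see the difference. *)
Lemma variance_inv_subI u h : bmeas u -> \int[P]_x u x = 0 ->
  (forall x, u x - B (A u) x = h x) ->
  fine 'V_P[inv_subI P (fun f => B (A f)) h] = \int[P]_x (u x ^+ 2).
Proof.
move=> bu u0 uh.
have [[U2 U0] UH] : [set u | L2_0 P u /\ {ae P, forall x, u x - B (A u) x = h x}]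
    (inv_subI P (fun f => B (A f)) h).
  apply: (@xgetPex _ _ [set u | L2_0 P u /\ {ae P, forall x, u x - B (A u) x = h x}]).
  exists u; split; first by split=> //; exact: bmeas_Lfun2.
  by apply: aeW => x; exact: uh.
move: (inv_subI P _ h) U2 U0 UH => U U2 U0 UH.
have iU : P.-integrable setT (EFin \o U).
  by apply/Lfun1_integrable; apply: Lfun_subset12 U2; rewrite fin_num_measure.
have iu := bmeas_integrable P bu.
have bAU := bmeas_markov_integrable iU.
have bAu := bmeas_markov_fst bu.
have iw : P.-integrable setT (EFin \o (fun x => U x - u x)).
  exact: (integrableB measurableT iU iu).
have AB y : A (fun x => U x - u x) y = A U y - A u y.
  rewrite -RintegralB//; [|exact: markov_integrable_fst..].
  by apply: eq_Rintegral => x _; rewrite mulrBr.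
have ae0 : ae_eq P setT (fun x => U x - u x) (fun=> 0).
  apply: markov_fixpoint_ae0 => //; first by rewrite RintegralB// U0 u0 subrr.
  move: UH; apply: filterS => x UHx _.
  have -> : B (A (fun x => U x - u x)) x = B (A U) x - B (A u) x.
    rewrite -markov_sndB//; congr Rintegral; apply/funext => y; rewrite AB//.
  have := uh x; rewrite -UHx; move: (B (A U) x) (B (A u) x) => *; lra.
rewrite varianceE// unlock.
have mU : measurable_fun setT U by apply/measurable_EFinP; exact: measurable_int iU.
have mu2 := bmeas_fun (bmeas_sqr bu).
rewrite (_ : \int[P]_w (U w)%:E = 0)%E; last first.
  by rewrite (EFin_Rintegral iU) U0.
rewrite expe2 mule0 sube0 /Rintegral; congr fine.
apply: ae_eq_integral => //.
- apply/measurable_EFinP; rewrite (_ : U ^+ 2 = fun x => U x * U x); last by apply/funext.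
  exact: measurable_funM.
- exact/measurable_EFinP.
- move: ae0; apply: filterS => x /(_ Logic.I)/eqP; rewrite subr_eq0 => /eqP Ux _.
  by rewrite -Ux.
Qed.

End markov_operator.

Section dual_solution.
Context d (T : measurableType d) (R : realType).
Variables (c : T * T -> R) (K : R).
Hypotheses (bc : bmeas c) (cK : forall z, `|c z| <= K).
Variables (P Q : probability T R).

Local Notation xi := (eot_density c P Q).
Local Notation A_P := (opA_P c P Q).
Local Notation A_Q := (opA_Q c P Q).
Local Notation cx := (c_x c P Q).
Local Notation cy := (c_y c P Q).

Let k (z : T * T) := xi z.1 z.2.
Let r := expR (- (K *+ 4)).

Let bk : bmeas k := bmeas_eot_density bc cK P Q.
Let r0 : 0 < r := expR_gt0 _.
Let kr z : r <= k z.
Proof. by have /andP[] := eot_density_bounds bc cK P Q z.1 z.2. Qed.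
Let kP y : \int[P]_x k (x, y) = 1 := integral_eot_density_fst bc cK P Q y.
Let kQ x : \int[Q]_y k (x, y) = 1 := integral_eot_density_snd bc cK P Q x.

Let k' (z : T * T) := xi z.2 z.1.
Let bk' : bmeas k'.
Proof. exact: (bmeas_swap bk). Qed.
Let kr' z : r <= k' z := kr (z.2, z.1).

Let bck : bmeas (fun z => c z * k z).
Proof. exact: bmeasM. Qed.

Let bcx : bmeas cx.
Proof. exact: (bmeas_integral_snd Q bck). Qed.

Let bcy : bmeas cy.
Proof. exact: (bmeas_integral_fst P bck). Qed.

(** Eliminating [v = c_y - A_P u] leaves [(I - A_Q A_P) u = c_x - A_Q c_y], whose right side has
    mean zero because [c_x] and [c_y] have the same mean. The two one-variable integrals of the
    kernel vanish precisely by the two equations of the system. *)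
Lemma dual_solution : exists u v : T -> R,
  [/\ bmeas u, bmeas v,
      forall x, \int[Q]_y dual_kernel c P Q u v (x, y) = 0,
      forall y, \int[P]_x dual_kernel c P Q u v (x, y) = 0 &
      forall lambda, sinkhorn_variance c P Q lambda =
        lambda * (\int[P]_x (u x ^+ 2) - (\int[P]_x u x) ^+ 2) +
        (1 - lambda) * (\int[Q]_y (v y ^+ 2) - (\int[Q]_y v y) ^+ 2)].
Proof.
have bA_P f : bmeas f -> bmeas (A_P f).
  exact: (bmeas_markov_fst P bk).
have bA_Q f : bmeas f -> bmeas (A_Q f).
  exact: (bmeas_markov_snd Q bk).
have mA_P f : bmeas f -> \int[Q]_y A_P f y = \int[P]_x f x.
  exact: (integral_markov_fst P bk kQ).
have mA_Q f : bmeas f -> \int[P]_x A_Q f x = \int[Q]_y f y.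
  exact: (integral_markov_snd Q bk kP).
have bh : bmeas (fun x => cx x - A_Q cy x).
  by apply: bmeasB => //; exact: bA_Q.
have cxy : \int[P]_x cx x = \int[Q]_y cy y by exact: (bounded_fubini P Q bck).
have h0 : \int[P]_x (cx x - A_Q cy x) = 0.
  by rewrite integral_boundedB ?mA_Q ?cxy ?subrr//; exact: bA_Q.
have [u bu [u0 uE]] := markov_resolvent bk r0 kr kP kQ bh h0.
have [v vE] : exists v : T -> R, v = fun y => cy y - A_P u y by eexists.
have bv : bmeas v by rewrite vE; apply: bmeasB => //; exact: bA_P.
have {}uE x : u x = cx x - A_Q cy x + A_Q (A_P u) x by exact: uE.
have A_Qv x : A_Q v x = A_Q cy x - A_Q (A_P u) x.
  by rewrite vE; exact: (markov_sndB Q bk x bcy (bA_P _ bu)).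
have bcz := bmeas_eot_density bc cK P Q.
exists u, v; split=> // [x|y|lambda].
- rewrite (@eq_Rintegral _ _ _ _ _ (fun y => (c (x, y) * xi x y - u x * xi x y) - xi x y * v y)); last first.
    by move=> y _; rewrite /dual_kernel /=; ring.
  have b1 := bmeas_snd x bck; have b2 := bmeas_snd x bk.
  have b3 : bmeas (fun y => u x * xi x y).
    exact: (bmeasM (bmeas_cst _ (u x)) b2).
  have b4 : bmeas (fun y => xi x y * v y) := bmeasM b2 bv.
  rewrite (integral_boundedB Q (bmeasB b1 b3) b4) (integral_boundedB Q b1 b3).
  rewrite (integral_boundedZ Q _ b2).
  rewrite -/(cx x) (kQ x : \int[Q]_y xi x y = 1) mulr1 -/(A_Q v x) A_Qv {1}uE; ring.
- rewrite (@eq_Rintegral _ _ _ _ _ (fun x => (c (x, y) * xi x y - xi x y * u x) - v y * xi x y)); last first.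
    by move=> x _; rewrite /dual_kernel /=; ring.
  have b1 := bmeas_fst y bck; have b2 := bmeas_fst y bk.
  have b3 : bmeas (fun x => v y * xi x y).
    exact: (bmeasM (bmeas_cst _ (v y)) b2).
  have b4 : bmeas (fun x => xi x y * u x) := bmeasM b2 bu.
  rewrite (integral_boundedB P (bmeasB b1 b4) b3) (integral_boundedB P b1 b4).
  rewrite (integral_boundedZ P _ b2).
  rewrite -/(cy y) (kP y : \int[P]_x xi x y = 1) mulr1 -/(A_P u y) vE; ring.
rewrite /sinkhorn_variance; congr (_ * _ + _ * _).
  rewrite (variance_inv_subI bk r0 kr kP kQ bu u0); first by rewrite u0 expr0n subr0.
  move=> x; have : u x - A_Q (A_P u) x = cx x - A_Q cy x; last by [].
  by have := uE x; move: (u x) (A_Q (A_P u) x) => a b ->; ring.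
(* [u] has mean zero by construction, whereas [v] carries the mean of the cost. As [A_P] and [A_Q]
   fix constants, the centred [v'] solves the transposed equation, and the same result applies to
   the transposed kernel. *)
pose s := \int[Q]_y v y; pose v' y := 1 * (v y - s).
have bv' : bmeas v' := bmeas_center Q bv 1.
have v'0 : \int[Q]_y v' y = 0 := integral_center Q bv 1.
have bs : bmeas (fun _ : T => s) by exact: bmeas_cst.
have A_Qs x : A_Q (fun=> s) x = s.
  by rewrite /opA_Q integral_boundedZr ?(kQ x : \int[Q]_y xi x y = 1) ?mul1r//; exact: (bmeas_snd x bk).
have A_Ps y : A_P (fun=> s) y = s.
  by rewrite /opA_P integral_boundedZr ?(kP y : \int[P]_x xi x y = 1) ?mul1r//; exact: (bmeas_fst y bk).
have A_Qv' x : A_Q v' x = (cx x - u x) - s.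
  have -> : v' = fun y => v y - s by apply/funext => y; rewrite /v' mul1r.
  have -> : A_Q (fun y => v y - s) x = A_Q v x - A_Q (fun=> s) x by exact: (markov_sndB Q bk x bv bs).
  by rewrite A_Qv A_Qs; congr (_ - _); rewrite {1}uE; ring.
have A_PA_Qv' y : A_P (A_Q v') y = A_P cx y - A_P u y - s.
  have -> : A_Q v' = fun x => (cx x - u x) - s by apply/funext => x; rewrite A_Qv'.
  have -> : A_P (fun x => (cx x - u x) - s) y = A_P (fun x => cx x - u x) y - A_P (fun=> s) y.
    by apply: (markov_fstB P bk y _ bs); exact: bmeasB.
  by rewrite A_Ps; congr (_ - _); exact: (markov_fstB P bk y bcx bu).
have v'E y : v' y - A_P (A_Q v') y = cy y - A_P cx y by rewrite A_PA_Qv' /v' vE; ring.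
rewrite (variance_inv_subI bk' r0 kr' kQ kP bv' v'0 v'E).
by rewrite (integral_center_sqr Q bv 1) expr1n mul1r.
Qed.

End dual_solution.

(** * Independence and empirical measures *)

Section independence.
Context d (W : measurableType d) (R : realType) (Pr : probability W R).
Context d' (T : measurableType d') (I : choiceType) (Z : I -> W -> T).
Hypothesis mZ : forall i, measurable_fun setT (Z i).
Hypothesis indep : mutually_independent Pr Z.

(** The variables indexed by [J] are represented by the coarser sigma-algebra they generate on [W]
    itself. A function of these variables is then a function of [w], without passing through tuples
    of values. *)
Definition joint_cylinders (J : {fset I}) : set (set W) :=
  [set A | exists2 B : I -> set T, forall i, measurable (B i) &
    A = \bigcap_(i in [set` J]) Z i @^-1` B i].

Notation past J := (g_sigma_algebraType (joint_cylinders J)).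

Lemma joint_cylinders_measurable J : joint_cylinders J `<=` measurable.
Proof.
move=> _ [B mB ->]; apply: fin_bigcap_measurable => [|i _].
  exact: finite_fset.
by rewrite -[X in measurable X]setTI; exact: mZ.
Qed.

Lemma measurable_past_id J : measurable_fun setT (id : W -> past J).
Proof.
move=> _ A sA; rewrite setTI /=; move: A sA; apply: smallest_sub.
  exact: sigma_algebra_measurable.
exact: joint_cylinders_measurable.
Qed.

Lemma measurable_past (J : {fset I}) i : i \in J ->
  measurable_fun [set: past J] (Z i : past J -> T).
Proof.
move=> iJ _ B mB; rewrite setTI; apply: sub_gen_smallest.
exists (fun j => if j == i then B else setT) => [j|]; first by case: ifP.
apply/seteqP; split=> [w Bw j jJ /=|w /(_ i iJ)]; last by rewrite eqxx.
by case: eqP => // ->.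
Qed.

Lemma measurable_past_fst (J : {fset I}) i : i \in J ->
  measurable_fun setT (fun z : past J * T => Z i z.1).
Proof. by move=> iJ; apply: (measurableT_comp (measurable_past iJ)); exact: measurable_fst. Qed.

Lemma setI_closed_joint_cylinders J : setI_closed (joint_cylinders J).
Proof.
move=> _ _ [B mB ->] [C mC ->]; exists (fun i => B i `&` C i).
  by move=> i; exact: measurableI.
by rewrite -bigcapI.
Qed.

(** As functions of [A], both sides are finite measures: the restriction of [Pr] to the event that
    [Z k] lies in [B], and a multiple of [Pr]. They agree on the cylinders, which are closed under
    intersection. *)
Lemma indep_past (J : {fset I}) k (A : set W) (B : set T) : k \notin J ->
  <<s joint_cylinders J >> A -> measurable B ->
  Pr (A `&` Z k @^-1` B) = (Pr A * Pr (Z k @^-1` B))%E.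
Proof.
move=> kJ sA mB.
have mkB : measurable (Z k @^-1` B) by rewrite -[X in measurable X]setTI; exact: mZ.
have c0 : 0 <= fine (Pr (Z k @^-1` B)) by rewrite fine_ge0.
have cE X : mscale (NngNum c0) Pr X = (Pr (Z k @^-1` B) * Pr X)%E.
  by rewrite /mscale /= fineK// fin_num_measure.
rewrite muleC -cE -[LHS]/(mrestr Pr mkB A).
apply: (@g_sigma_algebra_measure_unique _ _ _ (joint_cylinders J)
  (@joint_cylinders_measurable J) (fun=> setT)) => //.
- move=> _; exists (fun=> setT) => //.
  by rewrite [RHS](_ : _ = setT)//; apply/seteqP; split.
- by rewrite bigcup_const//; exists 0%N.
- exact: setI_closed_joint_cylinders.
- move=> _ [C mC ->]; set E := \bigcap_(i in _) _.
  rewrite -[LHS]/(Pr (E `&` Z k @^-1` B)) -[RHS]/(mscale (NngNum c0) Pr E) cE /E.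
  pose D i := if i == k then B else C i.
  have mD i : measurable (D i) by rewrite /D; case: ifP.
  have DC i : i \in J -> D i = C i.
    by move=> iJ; rewrite /D; case: eqP => // ik; rewrite -ik iJ in kJ.
  have -> : \bigcap_(i in [set` J]) Z i @^-1` C i `&` Z k @^-1` B =
      \bigcap_(i in [set` (k |` J)%fset]) Z i @^-1` D i.
    apply/seteqP; split=> [w [Cw Bw] i /= |w Dw].
      rewrite !inE => /predU1P[->|iJ]; first by rewrite /D eqxx.
      by rewrite DC//; exact: Cw.
    split; last by have := Dw k; rewrite /D eqxx; apply; rewrite /= !inE eqxx.
    by move=> i iJ /=; rewrite -DC//; apply: Dw; rewrite /= !inE iJ orbT.
  rewrite (indep _ mD) (indep _ mC) big_fsetU1//= {1}/D eqxx; congr (_ * _)%E.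
  by rewrite [LHS]big_seq [RHS]big_seq; apply: eq_bigr => i iJ; rewrite DC.
- move=> _; rewrite -[X in (X < _)%E]/(Pr (setT `&` Z k @^-1` B)) setTI.
  exact: le_lt_trans (probability_le1 Pr mkB) (ltry _).
Qed.

(** The pair of the past and [Z k] has a product law, so [Z k] can be integrated out with the past
    frozen. All later uses of independence go through this form. *)
Lemma indep_fubini (J : {fset I}) k (mu : probability T R) (F : past J * T -> R) :
  k \notin J -> (forall A, measurable A -> Pr (Z k @^-1` A) = mu A) ->
  bmeas F ->
  bmeas (fun w : W => F (w, Z k w)) /\
  \int[Pr]_w F (w, Z k w) = \int[Pr]_w \int[mu]_y F (w, y).
Proof.
move=> kJ kmu bF.
pose V (w : W) : past J * T := (w, Z k w).
have mV : measurable_fun setT V.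
  by apply/measurable_fun_pair; [exact: measurable_past_id|exact: mZ].
have bFV : bmeas (fun w : W => F (w, Z k w)).
  exact: (bmeas_comp bF mV).
split=> //.
pose PJ : probability (past J) R :=
  distribution Pr (mfun_Sub (mem_set (@measurable_past_id J)) : {mfun W >-> past J}).
pose N : probability (past J * T)%type R :=
  distribution Pr (mfun_Sub (mem_set mV) : {mfun W >-> (past J * T)%type}).
have NE A : measurable A -> (PJ \x mu)%E A = N A.
  apply: product_measure_unique => {A} A B mA mB.
  rewrite /N /distribution /pushforward /=.
  by rewrite -kmu// -(indep_past kJ mA mB).
have bFi : bmeas (fun w : past J => \int[mu]_y F (w, y)).
  exact: (bmeas_integral_snd mu bF).
have mF := bmeas_fun bF.
transitivity (\int[N]_z F z).
  rewrite /Rintegral /N integral_distribution//; first exact/measurable_EFinP.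
  exact: (bmeas_integrable Pr bFV).
transitivity (\int[(PJ \x mu)%E : probability _ _]_z F z).
  rewrite /Rintegral; congr fine; apply: eq_measure_integral => A mA _ /=.
  by rewrite -NE.
rewrite /Rintegral integral_prod_bounded//= -/(Rintegral PJ setT _).
have bFiW : bmeas (fun w : W => \int[mu]_y F (w, y)).
  exact: (bmeas_comp bFi (@measurable_past_id J)).
rewrite /PJ {1}/Rintegral integral_distribution//; first exact/measurable_EFinP/bmeas_fun.
exact: (bmeas_integrable Pr bFiW).
Qed.

End independence.

Section empirical_integral.
Context d (T : measurableType d) (R : realType).

Lemma integral_empirical (x : nat -> T) (n : nat) (f : T -> R) : (0 < n)%N ->
  bmeas f ->
  \int[empirical x n]_z f z = n%:R^-1 * \sum_(i < n) f (x i).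
Proof.
move=> n0 bf; have n0' : n%:R != 0 :> R by rewrite pnatr_eq0 -lt0n.
have [M M0 fM] := bmeas_bound bf.
have bM := bmeas_cst T M.
have bg : bmeas (fun z => f z + M) by exact: bmeasD.
have g0 z : 0 <= f z + M by have := fM z; rewrite ler_norml; lra.
have mg : measurable_fun setT (fun z => (f z + M)%:E).
  exact/measurable_EFinP/bmeas_fun.
have nV0 : 0 <= n%:R^-1 :> R by rewrite invr_ge0.
(* The shift by [M] makes the integrand nonnegative, as the rules for sums and multiples of measures
   require. *)
suff H : \int[empirical x n]_z (f z + M) = n%:R^-1 * \sum_(i < n) (f (x i) + M).
  move: H; rewrite integral_boundedD// integral_cst1 big_split/= mulrDr.
  rewrite sumr_const card_ord -[M *+ n]mulr_natr mulrCA mulVf// mulr1.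
  by move/addIr.
rewrite /Rintegral (eq_measure_integral (mscale (NngNum nV0)
  (msum (fun i => @dirac _ T (x i) R) n))); last first.
  by move=> A mA _; exact: (empiricalE x A n0).
rewrite (ge0_integral_mscale _ measurableT (NngNum nV0) mg) => [|z _]; last by rewrite lee_fin.
rewrite (ge0_integral_measure_sum (fun i => @dirac _ T (x i) R) measurableT _ mg) => [|z _]; last first.
  by rewrite lee_fin.
under eq_bigr do rewrite integral_dirac// diracT mul1e.
by rewrite sumEFin.
Qed.

Lemma integral_empirical2 (x y : nat -> T) (n m : nat) (F : T * T -> R) :
  (0 < n)%N -> (0 < m)%N -> bmeas F ->
  \int[empirical x n]_z \int[empirical y m]_z' F (z, z') =
  (n%:R * m%:R)^-1 * \sum_(p : 'I_n * 'I_m) F (x p.1, y p.2).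
Proof.
move=> n0 m0 bF; rewrite integral_empirical//; last first.
  exact: bmeas_integral_snd.
under eq_bigr => i _.
  rewrite integral_empirical//; last exact: (bmeas_snd _ bF).
  over.
rewrite -mulr_sumr mulrA -invfM; congr (_ * _).
by rewrite pair_bigA.
Qed.

End empirical_integral.

Section orthogonal_sums.
Context d (W : measurableType d) (R : realType) (Pr : probability W R).

Lemma integral_sqr_sum_orthogonal (A : finType) (V : A -> W -> R) (H : R) :
  (forall a, bmeas (V a)) -> (forall a w, `|V a w| <= H) ->
  (forall a b, a != b -> \int[Pr]_w (V a w * V b w) = 0) ->
  \int[Pr]_w ((\sum_a V a w) ^+ 2) <= #|A|%:R * H ^+ 2.
Proof.
move=> bV VH V0.
have bVV a b : bmeas (fun w => V a w * V b w) by exact: bmeasM.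
rewrite (@eq_Rintegral _ _ _ _ _ (fun w => \sum_a \sum_b V a w * V b w)); last first.
  by move=> w _; rewrite expr2 big_distrlr.
rewrite integral_bounded_sum; last by move=> a; exact: bmeas_sum.
rewrite -sum1_card natr_sum mulr_suml; apply: ler_sum => a _.
rewrite integral_bounded_sum// (bigD1 a)//= big1 ?addr0 ?mul1r; last first.
  by move=> b ba; rewrite V0// eq_sym.
apply: integral_bounded_le => // w; rewrite -expr2.
rewrite -[V a w ^+ 2]real_normK ?num_real// ler_sqr ?nnegrE//.
exact: le_trans (VH a w).
Qed.

Lemma mean_sqr_sum_orthogonal (n m : nat) (V : nat -> nat -> W -> R) (H : R) :
  (0 < n)%N -> (0 < m)%N ->
  (forall i j, bmeas (V i j)) -> (forall i j w, `|V i j w| <= H) ->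
  (forall i j l, j != l -> \int[Pr]_w (V i j w * V i l w) = 0) ->
  let S w := n%:R^-1 * \sum_(i < n) (m%:R^-1 * \sum_(j < m) V i j w) ^+ 2 in
  bmeas S /\ \int[Pr]_w S w <= H ^+ 2 / m%:R.
Proof.
move=> n0 m0 bV VH V0 S.
have nR : 0 < n%:R :> R by rewrite ltr0n.
have mR : 0 < m%:R :> R by rewrite ltr0n.
have SE : S = fun w => \sum_(i < n) (n%:R^-1 * m%:R ^- 2) * (\sum_(j < m) V i j w) ^+ 2.
  apply/funext => w; rewrite /S mulr_sumr; apply: eq_bigr => i _.
  by rewrite exprMn exprVn mulrA.
have bS (i : 'I_n) : bmeas (fun w => (\sum_(j < m) V i j w) ^+ 2).
  by apply/bmeas_sqr/bmeas_sum => j; exact: bV.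
have bSi (i : 'I_n) : bmeas
    (fun w => (n%:R^-1 * m%:R ^- 2) * (\sum_(j < m) V i j w) ^+ 2).
  by apply: bmeasM => //; exact: bmeas_cst.
rewrite SE; split; first exact: bmeas_sum.
rewrite integral_bounded_sum//.
rewrite (_ : H ^+ 2 / _ = \sum_(i < n) (n%:R^-1 * m%:R ^- 2) * (m%:R * H ^+ 2)); last first.
  by rewrite sumr_const card_ord -mulr_natr; field; rewrite !gt_eqF.
apply: ler_sum => i _; rewrite integral_boundedZ//.
rewrite ler_wpM2l ?mulr_ge0 ?invr_ge0 ?sqr_ge0//.
have := @integral_sqr_sum_orthogonal 'I_m (fun j => V i j) H.
by rewrite card_ord; apply => // j l jl; exact: V0.
Qed.

End orthogonal_sums.

(** * Degenerate two-sample statistics *)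

Section two_sample.
Context d (W : measurableType d) (R : realType) (Pr : probability W R).
Context d' (T : measurableType d') (X Y : nat -> W -> T) (P Q : probability T R).
Hypotheses (mX : forall i, measurable_fun setT (X i)) (mY : forall j, measurable_fun setT (Y j)).
Hypotheses (XP : forall i A, measurable A -> Pr (X i @^-1` A) = P A)
  (YQ : forall j A, measurable A -> Pr (Y j @^-1` A) = Q A).
Hypothesis indep : mutually_independent Pr
  (fun k : (nat + nat)%type => match k return W -> T with inl i => X i | inr j => Y j end).

Local Notation Z := (fun k : (nat + nat)%type =>
  match k return W -> T with inl i => X i | inr j => Y j end).

Let mZ k : measurable_fun setT (Z k).
Proof. by case: k => i; [exact: mX|exact: mY]. Qed.

Variables (h : T * T -> R) (H : R).
Hypotheses (bh : bmeas h) (hH : forall z, `|h z| <= H).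
Hypotheses (hQ : forall x, \int[Q]_y h (x, y) = 0)
  (hP : forall y, \int[P]_x h (x, y) = 0).

Lemma bmeas_sample i j : bmeas (fun w => h (X i w, Y j w)).
Proof. by apply: (bmeas_comp bh); exact/measurable_fun_pair. Qed.

(** Given [X i], [X i'] and [Y l], the variable [Y j] occurs in the first factor only, where it
    integrates to zero by [hQ]. The case [i = i'] is included; the sums along a row rely on it. *)
Lemma kernel_orthogonal_snd i i' j l : j != l ->
  \int[Pr]_w (h (X i w, Y j w) * h (X i' w, Y l w)) = 0.
Proof.
move=> jl; pose J : {fset (nat + nat)%type} := [fset inl i; inl i'; inr l]%fset.
have jJ : inr j \notin J.
  by apply/negP; rewrite !inE /= => /eqP[jl']; rewrite jl' eqxx in jl.
pose F (z : g_sigma_algebraType (joint_cylinders Z J) * T) :=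
  h (X i z.1, z.2) * h (X i' z.1, Y l z.1).
have mp k : k \in J -> measurable_fun setT (fun z : g_sigma_algebraType (joint_cylinders Z J) * T => Z k z.1).
  exact: (@measurable_past_fst _ _ _ _ _ Z).
have iJ : inl i \in J by rewrite !inE eqxx.
have i'J : inl i' \in J by rewrite !inE eqxx orbT.
have lJ : inr l \in J by rewrite !inE eqxx orbT.
have bF : bmeas F.
  apply: bmeasM; apply: (bmeas_comp bh); apply/measurable_fun_pair.
  - exact: (mp _ iJ).
  - exact: measurable_snd.
  - exact: (mp _ i'J).
  - exact: (mp _ lJ).
have [_ ->] := @indep_fubini _ _ _ _ _ _ _ Z mZ indep J (inr j) Q F jJ (YQ j) bF.
rewrite -[RHS](integral_cst1 Pr); apply: eq_Rintegral => w _.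
rewrite /F /= integral_boundedZr; last exact: (bmeas_snd _ bh).
by rewrite hQ mul0r.
Qed.

Lemma kernel_orthogonal_fst i i' j l : i != i' ->
  \int[Pr]_w (h (X i w, Y j w) * h (X i' w, Y l w)) = 0.
Proof.
move=> ii; pose J : {fset (nat + nat)%type} := [fset inl i'; inr j; inr l]%fset.
have iJ : inl i \notin J.
  by apply/negP; rewrite !inE /= !orbF => /eqP[ii']; rewrite ii' eqxx in ii.
pose F (z : g_sigma_algebraType (joint_cylinders Z J) * T) :=
  h (z.2, Y j z.1) * h (X i' z.1, Y l z.1).
have mp k : k \in J -> measurable_fun setT (fun z : g_sigma_algebraType (joint_cylinders Z J) * T => Z k z.1).
  exact: (@measurable_past_fst _ _ _ _ _ Z).
have jJ : inr j \in J by rewrite !inE eqxx ?orbT.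
have i'J : inl i' \in J by rewrite !inE eqxx.
have lJ : inr l \in J by rewrite !inE eqxx orbT.
have bF : bmeas F.
  apply: bmeasM; apply: (bmeas_comp bh); apply/measurable_fun_pair.
  - exact: measurable_snd.
  - exact: (mp _ jJ).
  - exact: (mp _ i'J).
  - exact: (mp _ lJ).
have [_ ->] := @indep_fubini _ _ _ _ _ _ _ Z mZ indep J (inl i) P F iJ (XP i) bF.
rewrite -[RHS](integral_cst1 Pr); apply: eq_Rintegral => w _.
rewrite /F /= integral_boundedZr; last exact: (bmeas_fst _ bh).
by rewrite hP mul0r.
Qed.

Variables (n m : nat).
Hypotheses (n0 : (0 < n)%N) (m0 : (0 < m)%N).

Local Notation Pn w := (empirical (fun i => X i w) n).
Local Notation Qm w := (empirical (fun j => Y j w) m).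

Let nR : 0 < n%:R :> R. Proof. by rewrite ltr0n. Qed.
Let mR : 0 < m%:R :> R. Proof. by rewrite ltr0n. Qed.

(** Distinct index pairs differ in a coordinate, in which the kernel integrates to zero. All [n m]
    summands are thus orthogonal, and the mean square is of order [1 / (n m)]. *)
Lemma kernel_mean_square :
  bmeas (fun w => \int[Pn w]_x \int[Qm w]_y h (x, y)) /\
  \int[Pr]_w ((\int[Pn w]_x \int[Qm w]_y h (x, y)) ^+ 2) <= H ^+ 2 / (n%:R * m%:R).
Proof.
have E w : \int[Pn w]_x \int[Qm w]_y h (x, y) =
    (n%:R * m%:R)^-1 * \sum_(p : 'I_n * 'I_m) h (X p.1 w, Y p.2 w).
  exact: integral_empirical2.
have bS : bmeas (fun w => \sum_(p : 'I_n * 'I_m) h (X p.1 w, Y p.2 w)).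
  by apply: bmeas_sum => p; exact: bmeas_sample.
split.
  under eq_fun do rewrite E; apply: bmeasM => //.
  exact: bmeas_cst.
rewrite (@eq_Rintegral _ _ _ _ _ (fun w => (n%:R * m%:R) ^- 2 *
  (\sum_(p : 'I_n * 'I_m) h (X p.1 w, Y p.2 w)) ^+ 2)); last first.
  by move=> w _; rewrite E exprMn exprVn.
rewrite integral_boundedZ; last exact: bmeas_sqr.
have := @integral_sqr_sum_orthogonal _ W R Pr ('I_n * 'I_m)%type
  (fun p w => h (X p.1 w, Y p.2 w)) H (fun p => bmeas_sample p.1 p.2)
  (fun p w => hH _).
rewrite card_prod !card_ord natrM => orth.
rewrite (_ : H ^+ 2 / _ = (n%:R * m%:R) ^- 2 * (n%:R * m%:R * H ^+ 2)); last first.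
  by field; rewrite !gt_eqF.
rewrite ler_wpM2l ?invr_ge0 ?sqr_ge0//; apply: orth => -[i j] [i' j'] ij /=.
have [jj'|] := eqVneq j j'; last by move=> jj'; exact: kernel_orthogonal_snd.
apply: kernel_orthogonal_fst; apply: contra ij => /eqP ii'; apply/eqP.
by rewrite jj'; congr pair; exact/val_inj.
Qed.

Lemma kernel_row_mean_square :
  bmeas (fun w => \int[Pn w]_x (\int[Qm w]_y h (x, y)) ^+ 2) /\
  \int[Pr]_w (\int[Pn w]_x (\int[Qm w]_y h (x, y)) ^+ 2) <= H ^+ 2 / m%:R.
Proof.
have E w : \int[Pn w]_x (\int[Qm w]_y h (x, y)) ^+ 2 =
    n%:R^-1 * \sum_(i < n) (m%:R^-1 * \sum_(j < m) h (X i w, Y j w)) ^+ 2.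
  rewrite integral_empirical//; last first.
    exact/bmeas_sqr/bmeas_integral_snd.
  congr (_ * _); apply: eq_bigr => i _; rewrite integral_empirical//.
  exact: (bmeas_snd _ bh).
rewrite (funext E).
apply: (mean_sqr_sum_orthogonal n0 m0 bmeas_sample) => // i j l jl.
exact: kernel_orthogonal_snd.
Qed.

Lemma kernel_col_mean_square :
  bmeas (fun w => \int[Qm w]_y (\int[Pn w]_x h (x, y)) ^+ 2) /\
  \int[Pr]_w (\int[Qm w]_y (\int[Pn w]_x h (x, y)) ^+ 2) <= H ^+ 2 / n%:R.
Proof.
have E w : \int[Qm w]_y (\int[Pn w]_x h (x, y)) ^+ 2 =
    m%:R^-1 * \sum_(j < m) (n%:R^-1 * \sum_(i < n) h (X i w, Y j w)) ^+ 2.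
  rewrite integral_empirical//; last first.
    exact/bmeas_sqr/bmeas_integral_fst.
  congr (_ * _); apply: eq_bigr => j _; rewrite integral_empirical//.
  exact: (bmeas_fst _ bh).
rewrite (funext E).
apply: (mean_sqr_sum_orthogonal m0 n0 (fun j i => bmeas_sample i j)) => // j i l il.
exact: kernel_orthogonal_fst.
Qed.

End two_sample.

(** * Measurability of the empirical cost *)

Section empirical_cost.
Context d (T : measurableType d) (R : realType) d' (W : measurableType d').
Variables (c : T * T -> R) (K : R).
Hypotheses (bc : bmeas c) (cK : forall z, `|c z| <= K).
Variables (X Y : nat -> W -> T) (n m : nat).
Hypotheses (mX : forall i, measurable_fun setT (X i)) (mY : forall j, measurable_fun setT (Y j)).
Hypotheses (n0 : (0 < n)%N) (m0 : (0 < m)%N).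

Local Notation Pn w := (empirical (fun i => X i w) n : probability T R).
Local Notation Qm w := (empirical (fun j => Y j w) m : probability T R).

(** The function [g w] is itself random. The integral is a finite sum over the sample, so
    measurability in [w] is asked only of the values of [g] at the sample points, a hypothesis that
    an induction over iterates can supply. *)
Lemma measurable_soft_min_empirical (c' : T * T -> R) (V : nat -> W -> T) (N : nat)
    (g : W -> T -> R) : (0 < N)%N -> bmeas c' ->
  (forall i, measurable_fun setT (V i)) ->
  (forall w, bmeas (g w)) ->
  (forall i, measurable_fun setT (fun w => g w (V i w))) ->
  forall U : W -> T, measurable_fun setT U ->
  measurable_fun setT (fun w => soft_min c' (empirical (fun i => V i w) N) (g w) (U w)).
Proof.
move=> N0 bc' mV bg mg U mU; rewrite soft_min.unlock.
have -> : (fun w => - ln (\int[empirical (fun i => V i w) N]_y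
    (expR (- c' (U w, y)) * expR (g w y)))) =
    (fun w => - ln (N%:R^-1 * \sum_(i < N) expR (- c' (U w, V i w)) * expR (g w (V i w)))).
  apply/funext => w; rewrite integral_empirical//.
  exact: (bmeas_snd (U w) (bmeas_exp_cost_fun bc' (bg w))).
apply: measurableT_comp => //; apply: measurableT_comp => //.
apply: measurable_funM => //; apply: measurable_sum => i.
apply: measurable_funM; apply: measurableT_comp => //.
apply: measurableT_comp => //.
apply: (measurableT_comp (bmeas_fun bc')).
exact/measurable_fun_pair.
Qed.

Lemma measurable_sinkhorn_iter_empirical k U : measurable_fun setT U ->
  measurable_fun setT (fun w => sinkhorn_iter c (Pn w) (Qm w) k (U w)).
Proof.
elim: k U => [|k IH] U mU; first exact: measurable_cst.
apply: measurable_soft_min_empirical => //.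
- exact: bmeas_swap.
- move=> w; apply: bmeas_soft_min => //.
  exact: bmeas_sinkhorn_iter.
- move=> i; apply: measurable_soft_min_empirical => //.
  + by move=> w; exact: bmeas_sinkhorn_iter.
  + by move=> j; exact: IH.
Qed.

Lemma measurable_sinkhorn_cost_empirical :
  measurable_fun setT (fun w => sinkhorn_cost c (Pn w) (Qm w)).
Proof.
have bce w : bmeas (fun z => c z * eot_density c (Pn w) (Qm w) z.1 z.2).
  by apply: bmeasM => //; exact: (bmeas_eot_density bc cK).
have -> : (fun w => sinkhorn_cost c (Pn w) (Qm w)) = (fun w => (n%:R * m%:R)^-1 *
    \sum_(p : 'I_n * 'I_m) c (X p.1 w, Y p.2 w) *
      eot_density c (Pn w) (Qm w) (X p.1 w) (Y p.2 w)).
  by apply/funext => w; rewrite (sinkhorn_costE bc cK) (integral_empirical2 _ _ _ _ (bce w)).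
apply: measurable_funM => //; apply: measurable_sum => -[i j] /=.
have mXY : measurable_fun setT (fun w => (X i w, Y j w)) by exact/measurable_fun_pair.
have mc : measurable_fun setT (fun w => c (X i w, Y j w)).
  exact: (measurableT_comp (bmeas_fun bc)).
apply: measurable_funM => //.
under eq_fun do rewrite eot_densityE.
apply: measurableT_comp => //; apply: measurable_funD; first exact: measurableT_comp.
(* The potentials are selected separately for each [w], but their sum is a pointwise limit of
   Sinkhorn iterates. *)
apply: (@measurable_fun_cvg _ _ _ _ (fun k w =>
  soft_min c (Qm w) (sinkhorn_iter c (Pn w) (Qm w) k) (X i w) +
  sinkhorn_iter c (Pn w) (Qm w) k (Y j w))) => [k|w _].
  apply: measurable_funD; last exact: measurable_sinkhorn_iter_empirical.
  apply: measurable_soft_min_empirical => //.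
  - by move=> w; exact: bmeas_sinkhorn_iter.
  - by move=> j'; exact: measurable_sinkhorn_iter_empirical.
exact: (sinkhorn_iter_cvg bc cK (eot_potentials_pair bc cK _ _)).
Qed.

End empirical_cost.

(** * Linearization of the empirical cost *)

Section linearization.
Context d (W : measurableType d) (R : realType) (Pr : probability W R).
Context d' (T : measurableType d') (X Y : nat -> W -> T) (P Q : probability T R).
Hypotheses (mX : forall i, measurable_fun setT (X i)) (mY : forall j, measurable_fun setT (Y j)).
Hypotheses (XP : forall i A, measurable A -> Pr (X i @^-1` A) = P A)
  (YQ : forall j A, measurable A -> Pr (Y j @^-1` A) = Q A).
Hypothesis indep : mutually_independent Pr
  (fun k : (nat + nat)%type => match k return W -> T with inl i => X i | inr j => Y j end).
Variables (c : T * T -> R) (K : R).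
Hypotheses (bc : bmeas c) (cK : forall z, `|c z| <= K).
Variables u v : T -> R.
Hypotheses (bu : bmeas u) (bv : bmeas v).

Local Notation w := (dual_kernel c P Q u v).
Local Notation rho := (density_kernel c P Q).

Hypotheses (wQ : forall x, \int[Q]_y w (x, y) = 0) (wP : forall y, \int[P]_x w (x, y) = 0).

Let bw : bmeas w := bmeas_dual_kernel bc cK P Q bu bv.
Let brho : bmeas rho := bmeas_density_kernel bc cK P Q.

Let rhoQ x : \int[Q]_y rho (x, y) = 0.
Proof.
rewrite integral_boundedB; last exact: bmeas_cst.
  by rewrite integral_cst1 (integral_eot_density_snd bc cK) subrr.
exact: (bmeas_snd x (bmeas_eot_density bc cK P Q)).
Qed.

Let rhoP y : \int[P]_x rho (x, y) = 0.
Proof.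
rewrite integral_boundedB; last exact: bmeas_cst.
  by rewrite integral_cst1 (integral_eot_density_fst bc cK) subrr.
exact: (bmeas_fst y (bmeas_eot_density bc cK P Q)).
Qed.

(** This is the perturbation bound with unchanged marginals: both kernels are centred in each
    variable, so all error terms vanish. *)
Lemma sinkhorn_cost_dual : sinkhorn_cost c P Q = \int[P]_x u x + \int[Q]_y v y.
Proof.
have [L L0 wL] := bmeas_bound bw.
have := sinkhorn_cost_perturbation bc cK bu bv P Q wL.
have z (mu : probability T R) (F : T -> R) : (forall x, F x = 0) -> \int[mu]_x F x = 0.
  by move=> F0; rewrite -[RHS](integral_cst1 mu); apply: eq_Rintegral => x _; exact: F0.
rewrite (z P (fun x => \int[Q]_y w (x, y)))// (z P (fun x => (\int[Q]_y rho (x, y)) ^+ 2)); last first.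
  by move=> x; rewrite rhoQ expr0n.
rewrite (z Q (fun y => (\int[P]_x rho (x, y)) ^+ 2)); last by move=> y; rewrite rhoP expr0n.
rewrite (z P (fun x => (\int[Q]_y w (x, y)) ^+ 2)); last by move=> x; rewrite wQ expr0n.
rewrite (z Q (fun y => (\int[P]_x w (x, y)) ^+ 2)); last by move=> y; rewrite wP expr0n.
by rewrite !addr0 mulr0 normr0 addr0 normr_le0 subr_eq0 => /eqP.
Qed.

Lemma sinkhorn_cost_linearization : exists2 C : R, 0 <= C &
  forall n m, (0 < n)%N -> (0 < m)%N -> exists2 Rem : W -> R,
    bmeas Rem /\ \int[Pr]_w Rem w <= C * (n%:R^-1 + m%:R^-1) &
    forall w, `|sinkhorn_cost c (empirical (fun i => X i w) n) (empirical (fun j => Y j w) m)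
       - sinkhorn_cost c P Q
       - ((\int[empirical (fun i => X i w) n]_x u x - \int[P]_x u x) +
          (\int[empirical (fun j => Y j w) m]_y v y - \int[Q]_y v y))| <= Rem w.
Proof.
have [L L0 wL] := bmeas_bound bw.
have [L' L'0 rL] := bmeas_bound brho.
pose C0 := (1 + L * expR (K *+ 6)) * (1 + (expR (- (K *+ 4)) * expR (- (K *+ 6))) ^- 2).
have C00 : 0 <= C0.
  by rewrite /C0 mulr_ge0// addr_ge0// ?mulr_ge0 ?expR_ge0// invr_ge0 sqr_ge0.
exists (L ^+ 2 + 1 + C0 * (L' ^+ 2 + L ^+ 2)).
  by rewrite !addr_ge0 ?sqr_ge0// mulr_ge0// addr_ge0 ?sqr_ge0.
move=> n m n0 m0.
have n0' : 0 < n%:R :> R by rewrite ltr0n.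
have m0' : 0 < m%:R :> R by rewrite ltr0n.
pose Pn s := (empirical (fun i => X i s) n : probability T R).
pose Qm s := (empirical (fun j => Y j s) m : probability T R).
have [bE iE] := kernel_mean_square mX mY XP YQ indep bw wL wQ wP n0 m0.
have [bR1 iR1] := kernel_row_mean_square mX mY YQ indep brho rL rhoQ n0 m0.
have [bR2 iR2] := kernel_row_mean_square mX mY YQ indep bw wL wQ n0 m0.
have [bC1 iC1] := kernel_col_mean_square mX mY XP indep brho rL rhoP n0 m0.
have [bC2 iC2] := kernel_col_mean_square mX mY XP indep bw wL wP n0 m0.
move: bE iE bR1 iR1 bR2 iR2 bC1 iC1 bC2 iC2.
rewrite -[X in bmeas X]/(fun s => \int[Pn s]_x \int[Qm s]_y w (x, y)).
set e := fun s => \int[Pn s]_x \int[Qm s]_y w (x, y).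
set r1 := fun s => \int[Pn s]_x (\int[Qm s]_y rho (x, y)) ^+ 2.
set r2 := fun s => \int[Pn s]_x (\int[Qm s]_y w (x, y)) ^+ 2.
set c1 := fun s => \int[Qm s]_y (\int[Pn s]_x rho (x, y)) ^+ 2.
set c2 := fun s => \int[Qm s]_y (\int[Pn s]_x w (x, y)) ^+ 2.
move=> bE iE bR1 iR1 bR2 iR2 bC1 iC1 bC2 iC2.
have {}iE : \int[Pr]_s e s ^+ 2 <= L ^+ 2 / (n%:R * m%:R) by exact: iE.
have {}iR1 : \int[Pr]_s r1 s <= L' ^+ 2 / m%:R by exact: iR1.
have {}iR2 : \int[Pr]_s r2 s <= L ^+ 2 / m%:R by exact: iR2.
have {}iC1 : \int[Pr]_s c1 s <= L' ^+ 2 / n%:R by exact: iC1.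
have {}iC2 : \int[Pr]_s c2 s <= L ^+ 2 / n%:R by exact: iC2.
have pw s : `|sinkhorn_cost c (Pn s) (Qm s) - (\int[Pn s]_x u x + \int[Qm s]_y v y)| <=
    `|e s| + C0 * (r1 s + c1 s + (r2 s + c2 s)).
  exact: (sinkhorn_cost_perturbation bc cK bu bv (Pn s) (Qm s) wL).
clearbody e r1 r2 c1 c2 C0.
have bE2 := bmeas_sqr bE.
have bR : bmeas (fun s => r1 s + c1 s + (r2 s + c2 s)).
  by apply: bmeasD; exact: bmeasD.
have bEm : bmeas (fun s => m%:R * e s ^+ 2).
  exact: (bmeasM (bmeas_cst _ (m%:R : R)) bE2).
have bRC : bmeas (fun s => C0 * (r1 s + c1 s + (r2 s + c2 s))).
  exact: (bmeasM (bmeas_cst _ C0) bR).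
have bEm1 : bmeas (fun s => m%:R * e s ^+ 2 + m%:R^-1).
  exact: (bmeasD bEm (bmeas_cst _ (m%:R^-1 : R))).
(* Only the second moment of [e] is known, so [|e|] is replaced by [m * e ^+ 2 + 1 / m], whose mean
   is at most [L ^+ 2 / n + 1 / m]. *)
exists (fun s => (m%:R * e s ^+ 2 + m%:R^-1) + C0 * (r1 s + c1 s + (r2 s + c2 s))).
  split; first exact: bmeasD.
  rewrite integral_boundedD// integral_boundedD//; last exact: bmeas_cst.
  rewrite integral_cst1 !integral_boundedZ// !integral_boundedD//; [|exact: bmeasD..].
  have h1 : m%:R * \int[Pr]_s e s ^+ 2 <= L ^+ 2 * n%:R^-1.
    apply: (le_trans (ler_wpM2l (ltW m0') iE)); rewrite le_eqVlt; apply/orP; left.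
    by apply/eqP; field; rewrite !gt_eqF.
  have h2 : C0 * (\int[Pr]_s r1 s + \int[Pr]_s c1 s + (\int[Pr]_s r2 s + \int[Pr]_s c2 s)) <=
      C0 * ((L' ^+ 2 + L ^+ 2) * (n%:R^-1 + m%:R^-1)).
    rewrite ler_wpM2l//; move: iR1 iR2 iC1 iC2.
    move: (\int[Pr]_s r1 s) (\int[Pr]_s r2 s) (\int[Pr]_s c1 s) (\int[Pr]_s c2 s) => *; lra.
  have p1 : 0 <= L ^+ 2 * m%:R^-1 by rewrite mulr_ge0 ?sqr_ge0// invr_ge0 ltW.
  have p2 : 0 <= n%:R^-1 :> R by rewrite invr_ge0 ltW.
  rewrite [leRHS]mulrDl -mulrA.
  move: h1 h2 p1 p2; move: (_ * \int[Pr]_s e s ^+ 2) (C0 * _) (C0 * _) => *; lra.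
move=> s; rewrite sinkhorn_cost_dual.
rewrite (_ : _ - _ - _ = sinkhorn_cost c (Pn s) (Qm s) - (\int[Pn s]_x u x + \int[Qm s]_y v y)); last first.
  by rewrite /Pn /Qm; ring.
rewrite (le_trans (pw s))// lerD2r.
have : 0 <= m%:R * (`|e s| - m%:R^-1) ^+ 2 by rewrite mulr_ge0 ?sqr_ge0// ltW.
rewrite (_ : m%:R * (`|e s| - m%:R^-1) ^+ 2 = m%:R * `|e s| ^+ 2 + m%:R^-1 - 2 * `|e s|); last first.
  by field; rewrite gt_eqF.
rewrite real_normK ?num_real//; have := normr_ge0 (e s); lra.
Qed.

End linearization.

(** * Lindeberg's method and the heat flow *)

Lemma expR_taylor2 (R : realType) (x : R) :
  `|expR x - 1 - x - x ^+ 2 / 2| <= `|x| ^+ 3 * expR `|x|.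
Proof.
pose f (y : R) := expR y - 1 - y - y ^+ 2 / 2.
have df (y : R) : is_derive y 1 f (expR y - 1 - y).
  rewrite /f; apply: is_derive_eq.
  rewrite /GRing.scale /=; by field.
have cf : continuous f.
  by move=> y; apply: differentiable_continuous; apply/derivable1_diffP; case: (df y).
have f0 : f 0 = 0 by rewrite /f expR0; ring.
have bound (c : R) : `|c| <= `|x| -> `|(expR c - 1 - c) * x| <= `|x| ^+ 3 * expR `|x|.
  move=> cx; rewrite normrM (_ : `|x| ^+ 3 * expR `|x| = expR `|x| * `|x| ^+ 2 * `|x|).
    rewrite ler_wpM2r// (le_trans (expR_taylor1 (lexx `|c|)))//.
    rewrite ler_pM ?expR_ge0 ?sqr_ge0// ?ler_expR//.
    by rewrite -[c ^+ 2]real_normK ?num_real// ler_sqr ?nnegrE.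
  by move: (expR _) => e; ring.
rewrite -/(f x); have [x0|x0|->] := ltgtP x 0.
- have [c] := MVT x0 (fun y _ => df y) (continuous_subspaceT cf).
  rewrite in_itv /= => /andP[cl cr]; rewrite f0 sub0r => /eqP; rewrite eqr_oppLR => /eqP ->.
  rewrite normrN sub0r mulrN normrN bound// !ler0_norm ?lerN2 ltW//.
- have [c] := MVT x0 (fun y _ => df y) (continuous_subspaceT cf).
  rewrite in_itv /= => /andP[cl cr]; rewrite f0 !subr0 => ->.
  by rewrite bound// !ger0_norm ltW.
- by rewrite f0 normr0 expr0n mul0r.
Qed.

Lemma cube_le_expR (R : realType) (x : R) : 0 <= x -> x ^+ 3 <= 27 * expR x.
Proof.
move=> x0; have -> : expR x = expR (x / 3) ^+ 3 by rewrite -expRM_natl; congr expR; field.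
have h : x / 3 <= expR (x / 3) by have := expR_ge1Dx (x / 3); lra.
have : (x / 3) ^+ 3 <= expR (x / 3) ^+ 3.
  by rewrite lerXn2r ?nnegrE ?expR_ge0// divr_ge0.
by move: (expR _ ^+ 3) => e; lra.
Qed.

Lemma sqr_le_expR (R : realType) (x : R) : 0 <= x -> x ^+ 2 <= 4 * expR x.
Proof.
move=> x0; have -> : expR x = expR (x / 2) ^+ 2 by rewrite -expRM_natl; congr expR; field.
have h : x / 2 <= expR (x / 2) by have := expR_ge1Dx (x / 2); lra.
have : (x / 2) ^+ 2 <= expR (x / 2) ^+ 2.
  by rewrite lerXn2r ?nnegrE ?expR_ge0// divr_ge0.
by move: (expR _ ^+ 2) => e; lra.
Qed.

(** The exponential is the ratio of two Gaussian densities shifted by [e] standard deviations, and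
    it generates the Hermite polynomials, here [s] and [s ^+ 2 - 1]. The remainder may carry the
    weight [expR (s ^+ 2 / 4)] because [heat_double] absorbs it. *)
Lemma gaussian_shift_bound (R : realType) (s e : R) : `|e| <= 1 ->
  `|expR (s * e - e ^+ 2 / 2) - 1 - s * e - e ^+ 2 * (s ^+ 2 - 1) / 2| <=
  28 * expR 6 * `|e| ^+ 3 * expR (s ^+ 2 / 4).
Proof.
move=> e1; set x := s * e - e ^+ 2 / 2.
have s0 := normr_ge0 s; have e0 := normr_ge0 e.
pose a : R := `|s| + 1; have a0 : 0 <= a by rewrite addr_ge0.
have xa : `|x| <= `|e| * a.
  rewrite /x (le_trans (ler_normB _ _))// normrM.
  rewrite [X in _ + X]ger0_norm ?divr_ge0 ?sqr_ge0//.
  rewrite -[e ^+ 2]real_normK ?num_real// /a.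
  have : `|e| * `|e| <= `|e| * 1 by rewrite ler_wpM2l.
  rewrite expr2; lra.
have xa1 : `|x| <= a by rewrite (le_trans xa)// ler_piMl.
have -> : expR x - 1 - s * e - e ^+ 2 * (s ^+ 2 - 1) / 2 =
  (expR x - 1 - x - x ^+ 2 / 2) + (e ^+ 4 / 8 - e ^+ 3 * s / 2) by rewrite /x; field.
rewrite (le_trans (ler_normD _ _))//.
have h1 : `|expR x - 1 - x - x ^+ 2 / 2| <= `|e| ^+ 3 * (27 * expR (2 * a)).
  rewrite (le_trans (expR_taylor2 x))// (@le_trans _ _ ((`|e| * a) ^+ 3 * expR a))//.
    by rewrite ler_pM ?exprn_ge0 ?expR_ge0// ?ler_expR// lerXn2r ?nnegrE// mulr_ge0.
  rewrite exprMn -mulrA ler_wpM2l ?exprn_ge0//.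
  have -> : 2 * a = a + a by ring.
  by rewrite expRD [leRHS]mulrA ler_wpM2r ?expR_ge0// cube_le_expR.
have h2 : `|e ^+ 4 / 8 - e ^+ 3 * s / 2| <= `|e| ^+ 3 * expR (2 * a).
  rewrite (_ : e ^+ 4 / 8 - e ^+ 3 * s / 2 = e ^+ 3 * (e / 8 - s / 2)); last by field.
  rewrite normrM normrX ler_wpM2l ?exprn_ge0// (@le_trans _ _ a)//.
    move: e1; rewrite !ler_norml /a; have := ler_norm s; have := ler_norm (- s); rewrite normrN; lra.
  by have := expR_ge1Dx (2 * a); lra.
apply: (le_trans (lerD h1 h2)).
have -> : `|e| ^+ 3 * (27 * expR (2 * a)) + `|e| ^+ 3 * expR (2 * a) =
  28 * `|e| ^+ 3 * expR (2 * a) by ring.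
rewrite [leRHS](_ : _ = 28 * `|e| ^+ 3 * (expR 6 * expR (s ^+ 2 / 4))); last by ring.
rewrite ler_wpM2l ?mulr_ge0 ?exprn_ge0// -expRD ler_expR /a.
(* The constant 6 comes from [2 |s| + 2 <= 6 + s ^+ 2 / 4], a form of [(|s| - 4) ^+ 2 >= 0]. *)
rewrite -[s ^+ 2]real_normK ?num_real//; have := sqr_ge0 (`|s| - 4); rewrite sqrrB; lra.
Qed.

(** The ratio of Gaussian densities with variances [t (1 + tau)] and [t]. Its first-order
    coefficient is the same [(s ^+ 2 - 1) / 2] as at second order in [gaussian_shift_bound]. The
    limit [1/16] on [tau] keeps the exponent of the remainder at [3/16 * (1 + s ^+ 2)], below
    [1 + s ^+ 2 / 4]. *)
Lemma gaussian_variance_bound (R : realType) (s tau : R) : 0 <= tau <= 16^-1 ->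
  `|expR (- ln (1 + tau) / 2 + s ^+ 2 / 2 * (tau / (1 + tau))) - 1 -
    tau * (s ^+ 2 - 1) / 2| <= 512 * expR 1 * tau ^+ 2 * expR (s ^+ 2 / 4).
Proof.
move=> /andP[t0 t1]; set x := - ln (1 + tau) / 2 + _.
pose b := 1 + s ^+ 2; have b1 : 1 <= b by rewrite lerDl sqr_ge0.
have t10 : 0 < 1 + tau by lra.
have frac : tau - tau ^+ 2 <= tau / (1 + tau) <= tau.
  rewrite ler_pdivlMr// ler_pdivrMr//; apply/andP; split.
    rewrite -subr_ge0 (_ : _ - _ = tau ^+ 3); last by ring.
    by rewrite exprn_ge0.
  by rewrite mulrDr mulr1 lerDl mulr_ge0.
have lnt : tau - tau ^+ 2 <= ln (1 + tau) <= tau.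
  apply/andP; split.
    have /andP[f1 _] := frac; rewrite (le_trans f1)//.
    have -> : ln (1 + tau) = - ln ((1 + tau)^-1) by rewrite lnV ?opprK ?posrE.
    have h : ln ((1 + tau)^-1) <= (1 + tau)^-1 - 1.
      rewrite -ler_expR lnK ?posrE ?invr_gt0// (le_trans _ (expR_ge1Dx _))//.
      by rewrite subrKC.
    have -> : tau / (1 + tau) = 1 - (1 + tau)^-1 by field; rewrite gt_eqF.
    lra.
  by rewrite -ler_expR lnK ?posrE// expR_ge1Dx.
pose e := x - tau * (s ^+ 2 - 1) / 2.
have s20 := sqr_ge0 s; have t20 := sqr_ge0 tau.
have eb : `|e| <= tau ^+ 2 * b / 2.
  rewrite /e /x /b; move: frac lnt; move: (tau / (1 + tau)) (ln (1 + tau)) => f l.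
  move=> /andP[f1 f2] /andP[l1 l2].
  have g1 : s ^+ 2 * (tau - tau ^+ 2) <= s ^+ 2 * f by rewrite ler_wpM2l.
  have g2 : s ^+ 2 * f <= s ^+ 2 * tau by rewrite ler_wpM2l.
  rewrite ler_norml; lra.
have tb0 : 0 <= tau * b by rewrite mulr_ge0//; lra.
have xb : `|x| <= tau * b.
  have -> : x = tau * (s ^+ 2 - 1) / 2 + e by rewrite /e addrC subrK.
  rewrite (le_trans (ler_normD _ _))//.
  have h1 : `|tau * (s ^+ 2 - 1) / 2| <= tau * b / 2.
    rewrite -mulrA normrM (ger0_norm t0) -mulrA ler_wpM2l// /b ler_norml; lra.
  have h2 : tau ^+ 2 * b <= tau * b by rewrite expr2 -mulrA ler_piMl//; lra.
  lra.
have -> : expR x - 1 - tau * (s ^+ 2 - 1) / 2 = (expR x - 1 - x) + e by rewrite /e; ring.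
rewrite (le_trans (ler_normD _ _))//.
have h1 : `|expR x - 1 - x| <= tau ^+ 2 * (256 * expR (3 / 16 * b)).
  rewrite (le_trans (expR_taylor1 xb))//.
  rewrite (@le_trans _ _ (expR (b / 16) * (tau ^+ 2 * b ^+ 2)))//.
    rewrite ler_pM ?expR_ge0 ?sqr_ge0// ?ler_expR; first by rewrite mulrC ler_wpM2l//; lra.
    by rewrite -exprMn -[x ^+ 2]real_normK ?num_real// ler_sqr ?nnegrE.
  rewrite mulrCA ler_wpM2l//.
  have -> : 3 / 16 * b = b / 16 + b / 8 by field.
  rewrite expRD [leRHS]mulrCA ler_wpM2l ?expR_ge0//.
  have b8 : 0 <= b / 8 by lra.
  have := sqr_le_expR b8; rewrite exprMn exprVn; lra.
have h2 : `|e| <= tau ^+ 2 * (256 * expR (3 / 16 * b)).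
  rewrite (le_trans eb)// -mulrA ler_wpM2l//.
  have := expR_ge1Dx (3 / 16 * b); lra.
apply: (le_trans (lerD h1 h2)).
have -> : tau ^+ 2 * (256 * expR (3 / 16 * b)) + tau ^+ 2 * (256 * expR (3 / 16 * b)) =
   512 * tau ^+ 2 * expR (3 / 16 * b) by ring.
rewrite [leRHS](_ : _ = 512 * tau ^+ 2 * (expR 1 * expR (s ^+ 2 / 4))); last by ring.
apply: ler_wpM2l; first by apply: mulr_ge0; [exact: ler0n|exact: t20].
rewrite -expRD ler_expR /b.
by move: s20; clear => s20; lra.
Qed.

Section heat_kernel.
Context {R : realType}.
Implicit Types t x y v : R.

Local Notation leb := (@lebesgue_measure R).

(** Time is the variance, whereas [normal_pdf] takes the standard deviation. *)
Definition heat t x y : R := normal_pdf x (Num.sqrt t) y.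

Lemma heatE t x y : 0 < t -> heat t x y =
  (Num.sqrt (pi *+ 2))^-1 * expR (- ln t / 2 - (y - x) ^+ 2 / (2 * t)).
Proof.
move=> t0; have st0 : 0 < Num.sqrt t by rewrite sqrtr_gt0.
rewrite /heat normal_pdfE ?gt_eqF//= /normal_peak /normal_fun sqr_sqrtr ?ltW//.
have -> : - ln t / 2 - (y - x) ^+ 2 / (2 * t) = - (ln t / 2) + - (y - x) ^+ 2 / (t *+ 2).
  by rewrite -mulr_natl; field; rewrite gt_eqF.
have stE : Num.sqrt t = expR (ln t / 2).
  rewrite -[X in Num.sqrt X]lnK ?posrE// (_ : ln t = ln t / 2 + ln t / 2); last by field.
  by rewrite expRD -expr2 sqrtr_sqr ger0_norm ?expR_ge0//; congr expR; field.
by rewrite expRD expRN -stE -mulrnAr sqrtrM ?ltW// invfM [X in X * _ = _]mulrC -!mulrA.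
Qed.

Lemma heat_ge0 t x y : 0 <= heat t x y.
Proof. exact: normal_pdf_ge0. Qed.

(** A weight [expR (s ^+ 2 / 4)] in the standardized variable [s] costs only a doubling of the time
    and the factor [expR (ln 2 / 2)], the square root of 2. *)
Lemma heat_double t x y : 0 < t ->
  heat t x y * expR ((y - x) ^+ 2 / (4 * t)) = expR (ln 2 / 2) * heat (2 * t) x y.
Proof.
move=> t0; rewrite !heatE//; last by rewrite mulr_gt0.
rewrite -mulrA -expRD [RHS]mulrCA -expRD; congr (_ * expR _).
rewrite lnM ?posrE//; field; rewrite gt_eqF//.
Qed.

Lemma heat_shift t x e y : 0 < t -> heat t (x + e) y = heat t x y *
  expR ((y - x) / Num.sqrt t * (e / Num.sqrt t) - (e / Num.sqrt t) ^+ 2 / 2).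
Proof.
move=> t0; rewrite !heatE// -[RHS]mulrA -expRD; congr (_ * expR _).
have tE : t = Num.sqrt t ^+ 2 by rewrite sqr_sqrtr// ltW.
have st0 : 0 < Num.sqrt t by rewrite sqrtr_gt0.
rewrite {2 4}tE; move: (Num.sqrt t) (ln t) st0 => r l r0; field; rewrite gt_eqF//.
Qed.

Lemma heat_variance t x v y : 0 < t -> 0 <= v -> heat (t + v) x y = heat t x y *
  expR (- ln (1 + v / t) / 2 +
    ((y - x) / Num.sqrt t) ^+ 2 / 2 * ((v / t) / (1 + v / t))).
Proof.
move=> t0 v0; have tv0 : 0 < t + v by rewrite ltr_pwDl.
rewrite !heatE// -[RHS]mulrA -expRD; congr (_ * expR _).
rewrite expr_div_n sqr_sqrtr ?ltW//.
have -> : t + v = t * (1 + v / t) by field; rewrite gt_eqF.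
have vt0 : 0 < 1 + v / t by rewrite ltr_pwDl// divr_ge0// ltW.
rewrite lnM ?posrE//.
have -> : 1 + v / t = (t + v) / t by field; rewrite gt_eqF.
by move: (ln _) (ln _) => a b; field; rewrite !gt_eqF.
Qed.

Lemma measurable_heat t x : measurable_fun setT (heat t x).
Proof. exact: measurable_normal_pdf. Qed.

Lemma integrable_le_heat t x (g : R -> R) (C : R) : 0 <= C -> measurable_fun setT g ->
  (forall y, `|g y| <= C * heat t x y) ->
  leb.-integrable setT (EFin \o g) /\ `|\int[leb]_y g y| <= C.
Proof.
move=> C0 mg gC.
have ih : leb.-integrable setT (EFin \o heat t x) by exact: integrable_normal_pdf.
have iC : leb.-integrable setT (EFin \o (fun y => C * heat t x y)).
  exact: (integrableZl measurableT C ih).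
have ig : leb.-integrable setT (EFin \o g).
  apply: le_integrable iC => //; first exact/measurable_EFinP.
  by move=> y _ /=; rewrite lee_fin (le_trans (gC y))// ler_norm.
split=> //; rewrite (le_trans (le_normr_Rintegral _ _))//.
have -> : C = \int[leb]_y (C * heat t x y).
  by rewrite RintegralZl// /Rintegral integral_normal_pdf mulr1.
by apply: le_Rintegral => //; exact: integrable_norm ig.
Qed.

End heat_kernel.

HB.lock Definition heat_flow (R : realType) (h : R -> R) (t x : R) : R :=
  \int[lebesgue_measure]_y (h y * heat t x y).

(* Second-order expansions in space and in time with the same coefficient [B]:
   this is the heat equation. *)
Definition heat_expansion (R : realType) (h : R -> R) (t0 C : R) : Prop :=
  forall t x, t0 <= t -> exists A B : R, [/\ `|B| <= C,
    forall e, `|e| <= Num.sqrt t0 ->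
      `|heat_flow h t (x + e) - heat_flow h t x - e * A - e ^+ 2 * B| <= C * `|e| ^+ 3 &
    forall v, 0 <= v <= t0 / 16 ->
      `|heat_flow h (t + v) x - heat_flow h t x - v * B| <= C * v ^+ 2].

Section heat_flow.
Context {R : realType}.
Variables (h : R -> R) (H : R).
Hypotheses (mh : measurable_fun [set: R] h) (hH : forall x, `|h x| <= H).
Implicit Types t x v e y : R.

Local Notation leb := (@lebesgue_measure R).

Local Notation U := (heat_flow h).

Let H0 : 0 <= H. Proof. by rewrite (le_trans _ (hH 0)). Qed.

Let s t x y := (y - x) / Num.sqrt t.

Let measurable_s t x : measurable_fun setT (s t x).
Proof. by apply: measurable_funM => //; exact: measurable_funB. Qed.

Let s2E t x y : 0 < t -> s t x y ^+ 2 / 4 = (y - x) ^+ 2 / (4 * t).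
Proof.
by move=> t0; rewrite /s expr_div_n sqr_sqrtr ?ltW//; field; rewrite gt_eqF.
Qed.

Let K := expR (ln 2 / 2) : R.

Let K0 : 0 <= K. Proof. exact: expR_ge0. Qed.

Let L1 : 0 <= H * (28 * expR 6) * K.
Proof. exact: mulr_ge0 (mulr_ge0 H0 (mulr_ge0 (ler0n _ 28) (expR_ge0 _))) K0. Qed.

Let L2 : 0 <= H * (512 * expR 1) * K.
Proof. exact: mulr_ge0 (mulr_ge0 H0 (mulr_ge0 (ler0n _ 512) (expR_ge0 _))) K0. Qed.

Let L3 : 0 <= H * 2 * K.
Proof. exact: mulr_ge0 (mulr_ge0 H0 (ler0n _ 2)) K0. Qed.

Let integral_bound t x (p : R -> R) (C : R) : 0 < t -> 0 <= C -> measurable_fun setT p ->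
  (forall y, `|p y| <= C * expR (s t x y ^+ 2 / 4)) ->
  leb.-integrable setT (EFin \o (fun y => h y * heat t x y * p y)) /\
  `|\int[leb]_y (h y * heat t x y * p y)| <= H * C * K.
Proof.
move=> t0 C0 mp pC; apply: (@integrable_le_heat _ (2 * t) x).
- by rewrite !mulr_ge0.
- apply: measurable_funM => //; apply: measurable_funM => //; exact: measurable_heat.
move=> y; rewrite !normrM (ger0_norm (heat_ge0 _ _ _)).
rewrite -mulrA [leRHS](_ : _ = H * (heat t x y * (C * expR (s t x y ^+ 2 / 4)))).
  by rewrite ler_pM// ?mulr_ge0 ?heat_ge0// ler_wpM2l ?heat_ge0.
transitivity (H * C * (K * heat (2 * t) x y)); first by rewrite mulrA.
by rewrite -heat_double// -s2E//; move: (heat t x y) (expR _) => a b; ring.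
Qed.

Let integrable_flow t x : 0 < t ->
  leb.-integrable setT (EFin \o (fun y => h y * heat t x y)).
Proof.
move=> t0; have m1 : measurable_fun setT (fun _ : R => 1 : R) by exact: measurable_cst.
have b1 y : `|1 : R| <= 1 * expR (s t x y ^+ 2 / 4).
  by rewrite normr1 mul1r -[leLHS]expR0 ler_expR divr_ge0// sqr_ge0.
have [+ _] := integral_bound t0 ler01 m1 b1.
by rewrite (_ : (fun y => _ * 1) = fun y => h y * heat t x y)//; apply/funext => y; rewrite mulr1.
Qed.

Lemma heat_flow_bound t x : 0 < t -> `|U t x| <= H.
Proof.
move=> t0; rewrite heat_flow.unlock.
have mU : measurable_fun setT (fun y => h y * heat t x y).
  by apply: measurable_funM => //; exact: measurable_heat.
have bU y : `|h y * heat t x y| <= H * heat t x y.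
  by rewrite normrM (ger0_norm (heat_ge0 _ _ _)) ler_wpM2r// heat_ge0.
by have [] := integrable_le_heat H0 mU bU.
Qed.

Let c1 y : `|y| <= 1 * expR (y ^+ 2 / 4).
Proof.
rewrite mul1r (le_trans _ (expR_ge1Dx _))// -[y ^+ 2]real_normK ?num_real//.
have := sqr_ge0 (`|y| - 2); rewrite sqrrB; lra.
Qed.

Let c2 y : `|(y ^+ 2 - 1) / 2| <= 2 * expR (y ^+ 2 / 4).
Proof. have := expR_ge1Dx (y ^+ 2 / 4); have := sqr_ge0 y; rewrite ler_norml; lra. Qed.

Lemma heat_flow_expansion (t0 : R) : 0 < t0 ->
  exists2 C : R, 0 <= C & heat_expansion h t0 C.
Proof.
move=> t00; have st00 : 0 < Num.sqrt t0 by rewrite sqrtr_gt0.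
(* [C1], [C2] and [C3] bound the space remainder, the time remainder and the coefficient [B].
   Increments are measured in units of [Num.sqrt t] or [t], and [t0] is the worst case. *)
pose C1 := H * (28 * expR 6) * K / Num.sqrt t0 ^+ 3.
pose C2 := H * (512 * expR 1) * K / t0 ^+ 2.
pose C3 := H * 2 * K / t0.
have C10 : 0 <= C1 by rewrite /C1 divr_ge0// exprn_ge0// ltW.
have C20 : 0 <= C2 by rewrite /C2 divr_ge0// exprn_ge0// ltW.
have C30 : 0 <= C3 by rewrite /C3 divr_ge0// ltW.
exists (C1 + C2 + C3); first by rewrite !addr_ge0.
move=> t x tt0; have tp : 0 < t by exact: lt_le_trans tt0.
have stp : 0 < Num.sqrt t by rewrite sqrtr_gt0.
have stt : Num.sqrt t0 <= Num.sqrt t by rewrite ler_sqrt// ltW.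
have sqE : Num.sqrt t ^+ 2 = t by rewrite sqr_sqrtr// ltW.
have ms := measurable_s t x.
have [i1 _] := integral_bound tp ler01 ms (fun y => c1 (s t x y)).
have ms2 : measurable_fun setT (fun y => (s t x y ^+ 2 - 1) / 2).
  by apply: measurable_funM => //; apply: measurable_funB => //; exact: measurable_funX.
have [i2 b2] := integral_bound tp (ler0n _ 2) ms2 (fun y => c2 (s t x y)).
have iU := integrable_flow x tp.
set A1 := \int[leb]_y (h y * heat t x y * s t x y) in i1.
set B1 := \int[leb]_y (h y * heat t x y * ((s t x y ^+ 2 - 1) / 2)) in b2.
exists (A1 / Num.sqrt t), (B1 / t).
(* Common to both expansions: [p] is the ratio of the new kernel to the old one. It is used with
   coefficients [a], [a ^+ 2] for a shift by [a] standard deviations, and [0], [a] for a relative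
   increase [a] of the variance. *)
have part (D : R) (p : R -> R) (V a b : R) : 0 <= D -> measurable_fun setT p ->
    (forall y, `|p y - 1 - a * s t x y - b * ((s t x y ^+ 2 - 1) / 2)| <=
      D * expR (s t x y ^+ 2 / 4)) ->
    leb.-integrable setT (EFin \o (fun y => h y * heat t x y * p y)) ->
    V = \int[leb]_y (h y * heat t x y * p y) ->
    `|V - U t x - a * A1 - b * B1| <= H * D * K.
  move=> D0 mp pD ip ->.
  pose q y := p y - 1 - a * s t x y - b * ((s t x y ^+ 2 - 1) / 2).
  have mq : measurable_fun setT q.
    apply: measurable_funB; last exact: measurable_funM.
    apply: measurable_funB; last exact: measurable_funM.
    exact: measurable_funB.
  have [_] := integral_bound tp D0 mq pD; congr (`|_| <= _).
  rewrite heat_flow.unlock.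
  transitivity (\int[leb]_y ((h y * heat t x y * p y - h y * heat t x y
    - a * (h y * heat t x y * s t x y)) - b * (h y * heat t x y * ((s t x y ^+ 2 - 1) / 2)))).
    apply: eq_Rintegral => y _; rewrite /q.
    by move: (heat t x y) (s t x y) (h y) (p y) => *; field.
  have ia := integrableZl measurableT a i1; have ib := integrableZl measurableT b i2.
  have ipu := integrableB measurableT ip iU.
  have ipua := integrableB measurableT ipu ia.
  rewrite (RintegralB measurableT ipua ib) (RintegralB measurableT ipu ia).
  rewrite (RintegralB measurableT ip iU).
  by rewrite (RintegralZl a measurableT i1) (RintegralZl b measurableT i2).
split=> [|e et|v /andP[v0 vt]].
- rewrite normrM normfV (ger0_norm (ltW tp)) (@le_trans _ _ C3)//; last by rewrite lerDr addr_ge0.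
  by rewrite /C3 ler_pM ?invr_ge0// ?(ltW tp)// lef_pV2 ?posrE.
- pose a := e / Num.sqrt t.
  have a1 : `|a| <= 1.
    rewrite normrM normfV (ger0_norm (ltW stp)) ler_pdivrMr// mul1r.
    exact: le_trans stt.
  have aE : `|a| ^+ 3 <= `|e| ^+ 3 / Num.sqrt t0 ^+ 3.
    rewrite normrM normfV (ger0_norm (ltW stp)) exprMn ler_wpM2l ?exprn_ge0// exprVn.
    by rewrite lef_pV2 ?posrE ?exprn_gt0// lerXn2r// nnegrE ltW.
  pose p y := expR (s t x y * a - a ^+ 2 / 2).
  have mp : measurable_fun setT p.
    apply: measurableT_comp => //; apply: measurable_funB => //; exact: measurable_funM.
  have D0 : 0 <= 28 * expR 6 * `|a| ^+ 3.
    exact: mulr_ge0 (mulr_ge0 (ler0n _ 28) (expR_ge0 _)) (exprn_ge0 _ (normr_ge0 _)).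
  have VE : U t (x + e) = \int[leb]_y (h y * heat t x y * p y).
    rewrite heat_flow.unlock; apply: eq_Rintegral => y _.
    by rewrite heat_shift// mulrA.
  have ip : leb.-integrable setT (EFin \o (fun y => h y * heat t x y * p y)).
    rewrite (_ : (fun y => _) = fun y => h y * heat t (x + e) y); first exact: integrable_flow.
    by apply/funext => y; rewrite heat_shift// mulrA.
  have := part _ p (U t (x + e)) a (a ^+ 2) D0 mp _ ip VE.
  rewrite (_ : a * A1 = e * (A1 / Num.sqrt t)); last by rewrite /a mulrAC mulrA.
  rewrite (_ : a ^+ 2 * B1 = e ^+ 2 * (B1 / t)); last first.
    by rewrite /a expr_div_n sqE mulrAC mulrA.
  have pb y : `|p y - 1 - a * s t x y - a ^+ 2 * ((s t x y ^+ 2 - 1) / 2)| <=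
      28 * expR 6 * `|a| ^+ 3 * expR (s t x y ^+ 2 / 4).
    by have := gaussian_shift_bound (s t x y) a1; rewrite -/(p y) [a * _]mulrC -[a ^+ 2 * _ / 2]mulrA.
  move=> /(_ pb) /le_trans; apply.
  apply: (@le_trans _ _ (C1 * `|e| ^+ 3)); last first.
    by rewrite ler_wpM2r ?exprn_ge0// -addrA lerDl addr_ge0.
  rewrite /C1 (_ : H * (28 * expR 6 * `|a| ^+ 3) * K = H * (28 * expR 6) * K * `|a| ^+ 3); last by ring.
  by rewrite -[leRHS]mulrA; apply: ler_wpM2l => //; rewrite [leRHS]mulrC.
- pose a := v / t.
  have a0 : 0 <= a by rewrite divr_ge0// ltW.
  have a1 : 0 <= a <= 16^-1.
    rewrite a0 /= /a ler_pdivrMr// (le_trans vt)// mulrC ler_wpM2l// invr_ge0 ler0n//.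
  have aE : a ^+ 2 <= v ^+ 2 / t0 ^+ 2.
    rewrite /a exprMn ler_wpM2l ?exprn_ge0// exprVn.
    by rewrite lef_pV2 ?posrE ?exprn_gt0// lerXn2r// nnegrE ltW.
  pose p y := expR (- ln (1 + a) / 2 + s t x y ^+ 2 / 2 * (a / (1 + a))).
  have mp : measurable_fun setT p.
    apply: measurableT_comp => //; apply: measurable_funD => //.
    apply: measurable_funM => //; apply: measurable_funM => //; exact: measurable_funX.
  have D0 : 0 <= 512 * expR 1 * a ^+ 2.
    exact: mulr_ge0 (mulr_ge0 (ler0n _ 512) (expR_ge0 _)) (sqr_ge0 _).
  have VE : U (t + v) x = \int[leb]_y (h y * heat t x y * p y).
    rewrite heat_flow.unlock; apply: eq_Rintegral => y _.
    by rewrite heat_variance// mulrA.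
  have ip : leb.-integrable setT (EFin \o (fun y => h y * heat t x y * p y)).
    rewrite (_ : (fun y => _) = fun y => h y * heat (t + v) x y).
      by apply: integrable_flow; rewrite ltr_pwDl.
    by apply/funext => y; rewrite heat_variance// mulrA.
  have := part _ p (U (t + v) x) 0 a D0 mp _ ip VE.
  rewrite mul0r subr0 (_ : a * B1 = v * (B1 / t)); last by rewrite /a mulrAC mulrA.
  have pb y : `|p y - 1 - 0 * s t x y - a * ((s t x y ^+ 2 - 1) / 2)| <=
      512 * expR 1 * a ^+ 2 * expR (s t x y ^+ 2 / 4).
    by have := gaussian_variance_bound (s t x y) a1; rewrite -/(p y) mul0r subr0 -[a * _ / 2]mulrA.
  move=> /(_ pb) /le_trans; apply.
  apply: (@le_trans _ _ (C2 * v ^+ 2)); last first.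
    by rewrite ler_wpM2r ?exprn_ge0// addrAC lerDr addr_ge0.
  rewrite /C2 (_ : H * (512 * expR 1 * a ^+ 2) * K = H * (512 * expR 1) * K * a ^+ 2); last by ring.
  by rewrite -[leRHS]mulrA; apply: ler_wpM2l => //; rewrite [leRHS]mulrC.
Qed.

End heat_flow.

Section gaussian_integral.
Context {R : realType}.
Implicit Types (h : R -> R) (t v x : R).

Local Notation leb := (@lebesgue_measure R).

Lemma integral_normal_prob h (m s : R) : bmeasR h ->
  \int[normal_prob m s]_x h x = \int[leb]_x (h x * normal_pdf m s x).
Proof.
move=> bh; have dom := @normal_prob_dominates R m s.
have mpdf : measurable_fun setT (EFin \o normal_pdf m s).
  by apply/measurable_EFinP; exact: measurable_normal_pdf.
have ipdf := @integrable_normal_pdf R m s.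
have iRN : leb.-integrable setT
    (Radon_Nikodym (charge_of_finite_measure (normal_prob m s)) leb).
  exact: Radon_Nikodym_integrable.
have mh : measurable_fun [set: measurableTypeR R] (EFin \o h).
  exact/measurable_EFinP/bmeas_fun.
rewrite /Rintegral; congr fine.
rewrite -(Radon_Nikodym_change_of_variables dom measurableT); last first.
  exact: bmeas_integrable.
apply: ae_eq_integral => //.
- by apply: emeasurable_funM => //; exact: measurable_int iRN.
- apply/measurable_EFinP; apply: measurable_funM; last exact: measurable_normal_pdf.
  exact: bmeas_fun bh.
have RNpdf : ae_eq leb setT (Radon_Nikodym (charge_of_finite_measure (normal_prob m s)) leb)
    (EFin \o normal_pdf m s).
  apply: integral_ae_eq => // A _ mA.
  by rewrite -Radon_Nikodym_integral.
by apply: filterS RNpdf => x /(_ Logic.I) /= -> _; rewrite EFinM.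
Qed.

Lemma integral_gaussian h v : bmeasR h -> 0 <= v ->
  \int[gaussian v]_x h x = if v == 0 then h 0 else heat_flow h v 0.
Proof.
move=> bh v0; rewrite /gaussian; case: eqP => [_|/eqP vn0].
  have mh : measurable_fun [set: measurableTypeR R] (EFin \o h).
    exact/measurable_EFinP/bmeas_fun.
  have := @integral_dirac _ (measurableTypeR R) 0 R setT measurableT (EFin \o h) mh.
  by rewrite diracT mul1e /Rintegral /= => ->.
by rewrite heat_flow.unlock integral_normal_prob.
Qed.

End gaussian_integral.

Section heat_flow_regularity.
Context {R : realType}.
Variables (h : R -> R) (H : R).
Hypotheses (mh : measurable_fun [set: R] h) (hH : forall x, `|h x| <= H).
Implicit Types t x v e : R.

Local Notation leb := (@lebesgue_measure R).
Local Notation U := (heat_flow h).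

(** Measurability follows from continuity in space, which the second-order expansion provides. *)
Lemma bmeas_heat_flow t : 0 < t ->
  bmeasR (U t).
Proof.
move=> t0; apply: (@bmeas_intro _ _ _ _ H) => [|x]; last exact: heat_flow_bound.
apply: continuous_measurable_fun => x; apply/cvgrPdist_le => /= e e0.
have [C C0 /(_ t x (lexx _))[A [B [BC Usp _]]]] := heat_flow_expansion mh hH t0.
have D0 : 0 < `|A| + C + C + 1 by rewrite ltr_wpDl// !addr_ge0.
have st0 : 0 < Num.sqrt t by rewrite sqrtr_gt0.
have r0 : 0 < Num.min (Num.min (Num.sqrt t) 1) (e / (`|A| + C + C + 1)).
  by rewrite !lt_min st0 ltr01 divr_gt0.
near=> y.
have : `|x - y| < Num.min (Num.min (Num.sqrt t) 1) (e / (`|A| + C + C + 1)).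
  by near: y; exact: cvgr_dist_lt.
rewrite distrC !lt_min ltr_pdivlMr// => /andP[/andP[y1 y2] y3].
have := Usp (y - x) (ltW y1); rewrite (addrC x) subrK distrC => Uy.
move: (y - x) (U t y) (U t x) y1 y2 y3 Uy => a u u' _ a1 ae ua.
have aA : `|a * A| <= `|a| * `|A| by rewrite normrM.
have aB : `|a ^+ 2 * B| <= `|a| * C.
  rewrite normrM ler_pM// normrX expr2 -[leRHS]mulr1.
  by apply: ler_pM => //; exact: ltW.
have a3 : C * `|a| ^+ 3 <= `|a| * C.
  rewrite [leRHS]mulrC ler_wpM2l// exprS -[leRHS]mulr1 ler_wpM2l// exprn_ile1//.
  exact: ltW.
have a0 := normr_ge0 a.
move: ae; rewrite !mulrDr mulr1; move: ua aA aB a3 a0.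
move: (`|a| * `|A|) (`|a| * C) (a * A) (_ * B) (C * _) => p q r s t'.
rewrite !ler_norml => /andP[? ?] /andP[? ?] /andP[? ?] *.
by apply/andP; split; lra.
Unshelve. all: by end_near.
Qed.

Lemma heat_flow_lipschitz (L t x : R) : 0 <= L -> 0 < t ->
  (forall x y, `|h x - h y| <= L * `|x - y|) ->
  `|U t x - h x| <= L * Num.sqrt t * expR (ln 2 / 2).
Proof.
move=> L0 t0 hL; have st0 : 0 < Num.sqrt t by rewrite sqrtr_gt0.
have ih : leb.-integrable setT (EFin \o (fun y => h y * heat t x y)).
  have H0 : 0 <= H by rewrite (le_trans _ (hH 0)).
  apply: proj1; apply: (integrable_le_heat (t := t) (x := x) H0).
    by apply: measurable_funM => //; exact: measurable_heat.
  by move=> y; rewrite normrM (ger0_norm (heat_ge0 _ _ _)) ler_wpM2r// heat_ge0.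
have i1 : leb.-integrable setT (EFin \o heat t x) by exact: integrable_normal_pdf.
have ihx : leb.-integrable setT (EFin \o (fun y => h x * heat t x y)).
  exact: (integrableZl measurableT _ i1).
have -> : U t x - h x = \int[leb]_y ((h y - h x) * heat t x y).
  transitivity (\int[leb]_y (h y * heat t x y - h x * heat t x y)); last first.
    by apply: eq_Rintegral => y _; rewrite mulrBl.
  rewrite RintegralB// heat_flow.unlock RintegralZl//; congr (_ - _).
  by rewrite /Rintegral integral_normal_pdf mulr1.
have [] // := @integrable_le_heat R (2 * t) x (fun y => (h y - h x) * heat t x y)
  (L * Num.sqrt t * expR (ln 2 / 2)).
- exact: mulr_ge0 (mulr_ge0 L0 (sqrtr_ge0 _)) (expR_ge0 _).
- by apply: measurable_funM; [exact: measurable_funB|exact: measurable_heat].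
move=> y; rewrite -mulrA -heat_double// normrM (ger0_norm (heat_ge0 _ _ _)).
rewrite (mulrC (heat t x y)) mulrA ler_wpM2r ?heat_ge0// (le_trans (hL y x))//.
rewrite -mulrA ler_wpM2l//.
have -> : (y - x) ^+ 2 / (4 * t) = (`|y - x| / Num.sqrt t) ^+ 2 / 4.
  by rewrite expr_div_n sqr_sqrtr ?ltW// real_normK ?num_real//; field; rewrite gt_eqF.
have {1}-> : `|y - x| = Num.sqrt t * (`|y - x| / Num.sqrt t).
  by rewrite mulrCA divff ?mulr1// gt_eqF.
(* From [z <= 1 + z ^+ 2 / 4 <= expR (z ^+ 2 / 4)]: the distance is traded for the weight that
   [heat_double] absorbs. *)
move: (`|y - x| / _) => z; rewrite ler_wpM2l ?sqrtr_ge0// (le_trans _ (expR_ge1Dx _))//.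
by have := sqr_ge0 (z - 2); rewrite sqrrB; lra.
Qed.

End heat_flow_regularity.

(** * Lindeberg replacement *)

Section lindeberg.
Context {R : realType}.
Variables (h : R -> R) (H L : R).
Hypotheses (mh : measurable_fun [set: R] h) (hH : forall x, `|h x| <= H).
Hypotheses (L0 : 0 <= L) (hL : forall x y, `|h x - h y| <= L * `|x - y|).
Implicit Types t v s : R.

Local Notation U := (heat_flow h).

Let bh : bmeasR h.
Proof. exact: bmeas_intro hH. Qed.

(** For [v = 0] the Gaussian law is the Dirac mass and the Lipschitz bound on [h] applies. For
    [v > 0] the time expansion is used from [v / 2] on, where steps up to [(v / 2) / 16 = v / 32]
    are allowed; it only runs forward, so it starts at the smaller of [t] and [v]. *)
Lemma gaussian_continuity v (eta : R) : 0 <= v -> 0 < eta -> exists2 rho, 0 < rho &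
  forall t, 0 < t -> `|t - v| <= rho -> `|U t 0 - \int[gaussian v]_x h x| <= eta.
Proof.
move=> v0 eta0; rewrite integral_gaussian//; case: eqP => [v_eq0|/eqP vn0].
  pose D := L * expR (ln 2 / 2) + 1.
  have D0 : 0 < D by rewrite ltr_wpDl// mulr_ge0// expR_ge0.
  exists ((eta / D) ^+ 2) => [|t t0]; first by rewrite exprn_gt0// divr_gt0.
  rewrite v_eq0 subr0 (ger0_norm (ltW t0)) => tD.
  apply: (le_trans (heat_flow_lipschitz mh hH 0 L0 t0 hL)).
  have sD : Num.sqrt t <= eta / D.
    rewrite -[leRHS]ger0_norm; last by rewrite divr_ge0// ltW.
    by rewrite -sqrtr_sqr ler_sqrt// exprn_ge0// divr_ge0// ltW.
  rewrite mulrAC; apply: (@le_trans _ _ (D * (eta / D))); last first.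
    by rewrite mulrCA divff ?mulr1// gt_eqF.
  by apply: ler_pM => //; rewrite ?mulr_ge0 ?expR_ge0 ?sqrtr_ge0// lerDl.
have vp : 0 < v by rewrite lt_def vn0.
have v20 : 0 < v / 2 by rewrite divr_gt0.
have [C C0 UC] := heat_flow_expansion mh hH v20.
have D0 : 0 < 2 * C + 1 by rewrite ltr_wpDl// mulr_ge0.
exists (Num.min (Num.min (v / 32) 1) (eta / (2 * C + 1))) => [|t t0].
  by rewrite !lt_min divr_gt0// ltr01 divr_gt0.
rewrite !le_min => /andP[/andP[tv t1]]; rewrite ler_pdivlMr// => te.
have step w : v / 2 <= w -> forall a, 0 <= a -> a <= v / 32 -> a <= 1 ->
    a * (2 * C + 1) <= eta -> `|U (w + a) 0 - U w 0| <= eta.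
  move=> vw a a0 av a1 ae; have [A [B [BC _ Utm]]] := UC w 0 vw.
  have av16 : 0 <= a <= v / 2 / 16.
    by rewrite a0/= (le_trans av)//; move: (v) => z; rewrite le_eqVlt; apply/orP; left; apply/eqP; field.
  move: (Utm a av16).
  have aB : `|a * B| <= a * C by rewrite normrM (ger0_norm a0) ler_wpM2l.
  have aC : C * a ^+ 2 <= a * C.
    by rewrite [leRHS]mulrC ler_wpM2l// expr2 -[leRHS]mulr1 ler_wpM2l.
  move: ae aB aC; rewrite mulrDr mulr1 mulrCA; move: (U _ _) (U _ _) (a * C) (a * B) (C * _) => u u' p q r.
  by rewrite !ler_norml => ae /andP[? ?] ? /andP[? ?]; apply/andP; split; lra.
case: (leP v t) => vt.
  have : t = v + `|t - v| by rewrite ger0_norm ?subr_ge0// addrC subrK.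
  by move=> ->; apply: step => //; lra.
rewrite distrC; have {1}-> : v = t + `|t - v| by rewrite ler0_norm ?subr_le0 ?(ltW vt)// opprB addrC subrK.
apply: step => //.
by move: tv; rewrite ltr0_norm ?subr_lt0//; lra.
Qed.

Section step.
Context d (T : measurableType d) (mu : probability T R) (phi : T -> R).
Variables (t0 C delta : R).
Hypotheses (t00 : 0 < t0 <= 1) (C0 : 0 <= C).
Hypothesis UC : heat_expansion h t0 C.
Hypotheses (bphi : bmeas phi) (phi0 : \int[mu]_x phi x = 0).
Hypotheses (d0 : 0 <= delta) (phid : forall x, `|phi x| <= delta).
Hypothesis dt : 16 * delta ^+ 2 <= t0.

(** Up to [C * delta ^+ 3], both quantities equal [U t s + v * B], with [v] the variance of [phi]:
    the mean-zero [phi] kills the linear term, and the space and time expansions share [B]. The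
    hypothesis [dt] admits [phi] as a shift and [v] as a time step. *)
Lemma heat_flow_swap t s : t0 <= t ->
  `|\int[mu]_x U t (s + phi x) - U (t + \int[mu]_x (phi x ^+ 2)) s| <= 2 * C * delta ^+ 3.
Proof.
move: t00 => /andP[t0p t01] tt0; have tp : 0 < t by exact: lt_le_trans tt0.
have bU := bmeas_heat_flow mh hH tp.
have [A [B [BC Usp Utm]]] := UC s tt0.
have d1 : delta <= 1.
  rewrite leNgt; apply/negP => d1.
  have : 1 < delta ^+ 2 by rewrite expr_gt1.
  move: dt t01; move: (_ ^+ 2) => z; lra.
have bphi2 : bmeas (fun x => phi x ^+ 2) by exact: bmeas_sqr.
set v := \int[mu]_x (phi x ^+ 2).
have v0 : 0 <= v by apply: Rintegral_ge0 => x _; exact: sqr_ge0.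
have vd : v <= delta ^+ 2.
  apply: integral_bounded_le => // x.
  by rewrite -[phi x ^+ 2]real_normK ?num_real// lerXn2r// nnegrE.
have vt : 0 <= v <= t0 / 16.
  by rewrite v0 /= (le_trans vd)// ler_pdivlMr// mulrC.
have UV := Utm v vt.
have v2 : C * v ^+ 2 <= C * delta ^+ 3.
  rewrite ler_wpM2l//; apply: (@le_trans _ _ ((delta ^+ 2) ^+ 2)).
    by rewrite lerXn2r// nnegrE ?exprn_ge0.
  rewrite -exprM [leRHS](_ : _ = 1 * delta ^+ 3); last by rewrite mul1r.
  by rewrite (exprS _ 3) ler_wpM2r ?exprn_ge0.
have bUs : bmeas (fun x => U t (s + phi x)).
  apply: (bmeas_comp bU).
  by apply: measurable_funD => //; exact: bmeas_fun bphi.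
pose g x := U t (s + phi x) - U t s - A * phi x - B * phi x ^+ 2.
have b1 : bmeas (fun _ : T => U t s) by exact: bmeas_cst.
have b2 : bmeas (fun x => A * phi x).
  by apply: bmeasM => //; exact: bmeas_cst.
have b3 : bmeas (fun x => B * phi x ^+ 2).
  by apply: bmeasM => //; exact: bmeas_cst.
have b4 := bmeasB bUs b1.
have b5 := bmeasB b4 b2.
have bg : bmeas g := bmeasB b5 b3.
have gE : \int[mu]_x g x = \int[mu]_x U t (s + phi x) - U t s - v * B.
  rewrite /g (integral_boundedB _ b5 b3) (integral_boundedB _ b4 b2).
  rewrite (integral_boundedB _ bUs b1) !integral_boundedZ// phi0 mulr0 subr0 integral_cst1.
  by rewrite -/v mulrC.
have : `|\int[mu]_x g x| <= C * delta ^+ 3.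
  apply: integral_bounded_norm => // x; rewrite /g.
  have pt : `|phi x| <= Num.sqrt t0.
    apply: (le_trans (phid x)); rewrite -[leLHS]ger0_norm// -sqrtr_sqr ler_sqrt//; last exact: ltW.
    by move: dt (sqr_ge0 delta); move: (_ ^+ 2) => z; lra.
  have := Usp _ pt; rewrite [_ * A]mulrC [_ * B]mulrC => /le_trans; apply.
  by rewrite ler_wpM2l// lerXn2r// nnegrE.
rewrite gE; move: UV v2; rewrite -mulrA; move: (\int[mu]_x _) (U _ _) (U _ _) (v * B) => a b c' e.
move: (C * _) (C * _) => p q; rewrite !ler_norml => /andP[? ?] ? /andP[? ?].
by apply/andP; split; lra.
Qed.

End step.

End lindeberg.

Section lindeberg_sums.
Context {R : realType}.
Variables (h : R -> R) (H L : R).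
Hypotheses (mh : measurable_fun [set: R] h) (hH : forall x, `|h x| <= H).
Hypotheses (L0 : 0 <= L) (hL : forall x y, `|h x - h y| <= L * `|x - y|).
Context d (W : measurableType d) (Pr : probability W R).
Context d' (T : measurableType d') (I : choiceType) (Z : I -> W -> T).
Variable mu : I -> probability T R.
Hypothesis mZ : forall i, measurable_fun setT (Z i).
Hypothesis indep : mutually_independent Pr Z.
Hypothesis Zmu : forall i A, measurable A -> Pr (Z i @^-1` A) = mu i A.

Local Notation U := (heat_flow h).

Let bh : bmeasR h.
Proof. exact: bmeas_intro hH. Qed.

Lemma measurable_sum_comp (phi : I -> T -> R) (js : seq I) :
  (forall i, bmeas (phi i)) ->
  measurable_fun setT (fun w => \sum_(j <- js) phi j (Z j w)).
Proof.
move=> bphi; apply: bmeas_fun; apply: bmeas_sum => i.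
exact: bmeas_comp.
Qed.

(* One summand at a time is traded for an increase of the time by its variance. *)
Lemma heat_flow_telescope (t0 C : R) (phi : I -> T -> R) (delta : I -> R) :
  0 < t0 <= 1 -> 0 <= C ->
  heat_expansion h t0 C ->
  (forall i, bmeas (phi i)) -> (forall i, \int[mu i]_x phi i x = 0) ->
  (forall i, 0 <= delta i) -> (forall i x, `|phi i x| <= delta i) ->
  (forall i, 16 * delta i ^+ 2 <= t0) ->
  forall (js : seq I), uniq js -> forall t, t0 <= t ->
  `|\int[Pr]_w U t (\sum_(j <- js) phi j (Z j w)) -
    U (t + \sum_(j <- js) \int[mu j]_x (phi j x ^+ 2)) 0| <=
  \sum_(j <- js) (2 * C * delta j ^+ 3).
Proof.
move=> t001 C0 UC bphi phi0 d0 phid dt; elim=> [_ t tt0|k js IH /= /andP[kjs ujs] t tt0].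
  under eq_Rintegral do rewrite big_nil.
  by rewrite !big_nil addr0 integral_cst1 subrr normr0.
have tp : 0 < t by move: t001 tt0 => /andP[? _]; exact: lt_le_trans.
set v := \int[mu k]_x (phi k x ^+ 2).
have v0 : 0 <= v by apply: Rintegral_ge0 => x _; exact: sqr_ge0.
have tvp : 0 < t + v by rewrite ltr_pwDl.
pose J : {fset I} := [fset j in js]%fset.
have kJ : k \notin J by rewrite inE.
pose S w := \sum_(j <- js) phi j (Z j w).
pose F (z : g_sigma_algebraType (joint_cylinders Z J) * T) := U t (S z.1 + phi k z.2).
have bF : bmeas F.
  apply: (bmeas_comp (bmeas_heat_flow mh hH tp)).
  apply: measurable_funD; last first.
    apply: measurableT_comp; first exact: bmeas_fun.
    exact: measurable_snd.
  (* The guard makes the summand of every index measurable for the past, including indices outside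
     [js]. *)
  rewrite (_ : (fun z => _) = fun z : g_sigma_algebraType (joint_cylinders Z J) * T =>
    \sum_(j <- js) (if j \in js then phi j (Z j z.1) else 0)); last first.
    by apply/funext => z; rewrite /S big_seq [RHS]big_seq; apply: eq_bigr => j ->.
  apply: bmeas_fun; apply: bmeas_sum => i.
  case ijs : (i \in js); last exact: bmeas_cst.
  apply: (bmeas_comp (bphi i)); apply: measurable_past_fst.
  by rewrite inE.
have [_ FE] := indep_fubini mZ indep kJ (Zmu k) bF.
have -> : \int[Pr]_w U t (\sum_(j <- k :: js) phi j (Z j w)) =
    \int[Pr]_w \int[mu k]_y U t (S w + phi k y).
  by rewrite -FE; apply: eq_Rintegral => w _; rewrite /F /S/= big_cons addrC.
have bI : bmeas (fun w : W => \int[mu k]_y U t (S w + phi k y)).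
  have bFi := bmeas_integral_snd (mu k) bF.
  apply: (bmeas_comp (T := g_sigma_algebraType (joint_cylinders Z J)) bFi).
  exact: measurable_past_id.
have bV : bmeas (fun w : W => U (t + v) (S w)).
  apply: (bmeas_comp (bmeas_heat_flow mh hH tvp)).
  exact: measurable_sum_comp.
have : `|\int[Pr]_w (\int[mu k]_y U t (S w + phi k y) - U (t + v) (S w))| <=
    2 * C * delta k ^+ 3.
  apply: integral_bounded_norm => [|w]; first exact: bmeasB.
  exact: (heat_flow_swap mh hH t001 C0 UC (bphi k) (phi0 k) (d0 k) (phid k) (dt k)).
rewrite integral_boundedB//.
have ttv : t0 <= t + v by rewrite (le_trans tt0)// lerDl.
have := IH ujs (t + v) ttv; rewrite !big_cons addrA -/v.
move=> b a; apply: le_trans (lerD a b); apply: le_trans (ler_normD _ _).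
by rewrite addrA subrK.
Qed.

(** Three errors of size [eta / 3]: smoothing [h] by the flow at time [t0], exchanging the summands,
    and comparing the final time with [v]. The tolerance [rho] is uniform in the index list and the
    summands, so triangular arrays are covered. *)
Lemma lindeberg_clt (v eta : R) : 0 <= v -> 0 < eta -> exists2 rho : R, 0 < rho &
  forall (js : seq I) (phi : I -> T -> R) (delta : I -> R), uniq js ->
  (forall i, bmeas (phi i)) -> (forall i, \int[mu i]_x phi i x = 0) ->
  (forall i, 0 <= delta i) -> (forall i x, `|phi i x| <= delta i) ->
  (forall i, delta i ^+ 2 <= rho) ->
  \sum_(j <- js) delta j ^+ 3 <= rho ->
  `|\sum_(j <- js) \int[mu j]_x (phi j x ^+ 2) - v| <= rho ->
  `|\int[Pr]_w h (\sum_(j <- js) phi j (Z j w)) - \int[gaussian v]_x h x| <= eta.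
Proof.
move=> v0 eta0; have eta30 : 0 < eta / 3 by rewrite divr_gt0.
have [rho1 rho10 Ugauss] := gaussian_continuity mh hH L0 hL v0 eta30.
pose D := L * expR (ln 2 / 2) + 1.
have D0 : 0 < D by rewrite ltr_wpDl// mulr_ge0// expR_ge0.
(* [t0] is fixed before [rho], since the expansion constant [C] depends on it. Half of [rho1] is
   reserved for [t0], the other half for the error in the total variance. *)
pose t0 := Num.min (Num.min 1 (rho1 / 2)) ((eta / 3 / D) ^+ 2).
have t00 : 0 < t0 by rewrite !lt_min ltr01 divr_gt0//= exprn_gt0// divr_gt0.
have : t0 <= t0 by [].
rewrite {2}/t0 !le_min => /andP[/andP[t01 t0rho] t0D].
have [C C0 UC] := heat_flow_expansion mh hH t00.
have C10 : 0 < 2 * C + 1 by rewrite ltr_wpDl// mulr_ge0.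
exists (Num.min (Num.min (t0 / 16) (rho1 / 2)) (eta / 3 / (2 * C + 1))).
  by rewrite !lt_min !divr_gt0.
clearbody t0.
move=> js phi delta ujs bphi phi0 d0 phid drho.
rewrite !le_min => /andP[/andP[_ _] sumd] /andP[/andP[_ sumv] _].
have dt i : 16 * delta i ^+ 2 <= t0.
  by have := drho i; rewrite !le_min => /andP[/andP[]]; rewrite ler_pdivlMr// mulrC.
have t001 : 0 < t0 <= 1 by rewrite t00.
have := heat_flow_telescope t001 C0 UC bphi phi0 d0 phid dt ujs (lexx t0).
set V := \sum_(j <- js) \int[_]_x _ in sumv *.
have V0 : 0 <= V by apply: sumr_ge0 => j _; apply: Rintegral_ge0 => x _; exact: sqr_ge0.
have tV0 : 0 < t0 + V by rewrite ltr_pwDl.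
have tVv : `|t0 + V - v| <= rho1.
  by move: sumv; rewrite !ler_norml => /andP[? ?]; apply/andP; split; lra.
have := Ugauss _ tV0 tVv.
have mS := measurable_sum_comp js bphi.
set S := fun w => _ in mS.
have bhS : bmeas (fun w => h (S w)) := bmeas_comp bh mS.
have bUS : bmeas (fun w => U t0 (S w)).
  exact: (bmeas_comp (bmeas_heat_flow mh hH t00) mS).
have : `|\int[Pr]_w (U t0 (S w) - h (S w))| <= eta / 3.
  apply: integral_bounded_norm => [|w]; first exact: bmeasB.
  apply: (le_trans (heat_flow_lipschitz mh hH (S w) L0 t00 hL)).
  have sD : Num.sqrt t0 <= eta / 3 / D.
    rewrite -[leRHS]ger0_norm; last by rewrite divr_ge0// ltW.
    by rewrite -sqrtr_sqr ler_sqrt// exprn_ge0// divr_ge0// ltW.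
  rewrite mulrAC; apply: (@le_trans _ _ (D * (eta / 3 / D))); last first.
    by rewrite mulrCA divff ?mulr1// gt_eqF.
  by apply: ler_pM => //; rewrite ?mulr_ge0 ?expR_ge0 ?sqrtr_ge0// lerDl.
rewrite (integral_boundedB _ bUS bhS) -mulr_sumr.
move: sumd; rewrite ler_pdivlMr//.
have : 0 <= \sum_(j <- js) delta j ^+ 3 by apply: sumr_ge0 => j _; rewrite exprn_ge0.
move: (\sum_(j <- js) delta j ^+ 3) => sd sd0.
rewrite /S; move: (\int[Pr]_w U t0 _) (\int[Pr]_w h _) (U _ _) (\int[gaussian v]_x h x) => a b c' e.
rewrite mulrDr mulr1 mulrCA mulrA.
by rewrite !ler_norml => ? /andP[? ?] /andP[? ?] /andP[? ?]; apply/andP; split; lra.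
Qed.

End lindeberg_sums.

(** * Central limit theorems for the linear part and the cost *)

Section two_sample_clt.
Context d (W : measurableType d) (R : realType) (Pr : probability W R).
Context d' (T : measurableType d') (X Y : nat -> W -> T) (P Q : probability T R).
Hypotheses (mX : forall i, measurable_fun setT (X i)) (mY : forall j, measurable_fun setT (Y j)).
Hypotheses (XP : forall i A, measurable A -> Pr (X i @^-1` A) = P A)
  (YQ : forall j A, measurable A -> Pr (Y j @^-1` A) = Q A).
Hypothesis indep : mutually_independent Pr
  (fun k : (nat + nat)%type => match k return W -> T with inl i => X i | inr j => Y j end).
Variables u v : T -> R.
Hypotheses (bu : bmeas u) (bv : bmeas v).
Variables (h : R -> R) (H L : R).
Hypotheses (mh : measurable_fun [set: R] h) (hH : forall x, `|h x| <= H).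
Hypotheses (L0 : 0 <= L) (hL : forall x y, `|h x - h y| <= L * `|x - y|).

Let Pu := \int[P]_x u x.
Let Qv := \int[Q]_y v y.
Let varu := \int[P]_x (u x ^+ 2) - Pu ^+ 2.
Let varv := \int[Q]_y (v y ^+ 2) - Qv ^+ 2.

Let varu0 : 0 <= varu. Proof. exact: variance_integral_ge0. Qed.
Let varv0 : 0 <= varv. Proof. exact: variance_integral_ge0. Qed.

Lemma two_sample_clt (lambda eta : R) : 0 < lambda < 1 -> 0 < eta ->
  exists2 rho : R, 0 < rho & forall n m : nat, (0 < n)%N -> (0 < m)%N ->
  n%:R^-1 <= rho -> m%:R^-1 <= rho -> `|m%:R / (n + m)%:R - lambda| <= rho ->
  `|\int[Pr]_w h (Num.sqrt ((n * m)%:R / (n + m)%:R) *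
      ((\int[empirical (fun i => X i w) n]_x u x - \int[P]_x u x) +
       (\int[empirical (fun j => Y j w) m]_y v y - \int[Q]_y v y))) -
    \int[gaussian (lambda * (\int[P]_x (u x ^+ 2) - (\int[P]_x u x) ^+ 2) +
      (1 - lambda) * (\int[Q]_y (v y ^+ 2) - (\int[Q]_y v y) ^+ 2))]_x h x| <= eta.
Proof.
move=> /andP[lambda0 lambda1] eta0; rewrite -/Pu -/Qv -/varu -/varv.
pose Z (k : (nat + nat)%type) := match k return W -> T with inl i => X i | inr j => Y j end.
pose mu (k : (nat + nat)%type) := match k with inl i => P | inr j => Q end.
have mZ k : measurable_fun setT (Z k) by case: k.
have Zmu k A : measurable A -> Pr (Z k @^-1` A) = mu k A by case: k => i mA; [exact: XP|exact: YQ].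
have [M M1 [uM vM]] : exists2 M : R, 1 <= M &
    (forall x, `|u x - Pu| <= M) /\ (forall y, `|v y - Qv| <= M).
  have [M1 M10 uM1] := bmeas_bound (bmeasB bu (bmeas_cst T Pu)).
  have [M2 M20 vM2] := bmeas_bound (bmeasB bv (bmeas_cst T Qv)).
  exists (1 + M1 + M2); first by rewrite -addrA lerDl addr_ge0.
  split=> [x|y]; first by rewrite (le_trans (uM1 x))// addrAC lerDr addr_ge0.
  by rewrite (le_trans (vM2 y))// lerDr addr_ge0.
have M0 : 0 <= M by exact: le_trans M1.
have s20 : 0 <= lambda * varu + (1 - lambda) * varv.
  by rewrite addr_ge0// mulr_ge0// ?subr_ge0 ltW.
have [rho0 rho00 clt] := lindeberg_clt mh hH L0 hL mZ indep Zmu s20 eta0.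
(* [tau] will bound the weights [alpha] and [beta]. Each sample contributes at most [tau * M ^+ 3]
   to the sum of cubes, hence the factor 2; with [tau <= 1 <= M] the same quantity dominates every
   [delta k ^+ 2]. *)
pose tau := Num.min 1 (rho0 / (2 * M ^+ 3)).
have M3 : 1 <= M ^+ 3 by rewrite exprn_ege1.
have M30 : 0 < 2 * M ^+ 3 by rewrite mulr_gt0// (lt_le_trans _ M3).
have tau0 : 0 < tau by rewrite lt_min ltr01 divr_gt0.
have : tau <= tau by [].
rewrite {2}/tau le_min ler_pdivlMr// => /andP[tau1 tauM].
have vv0 : 0 < varu + varv + 1 by rewrite ltr_wpDl// addr_ge0.
exists (Num.min (tau ^+ 2) (rho0 / (varu + varv + 1))).
  by rewrite lt_min exprn_gt0// divr_gt0.
move=> n m n0 m0; rewrite !le_min => /andP[ntau _] /andP[mtau _] /andP[_].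
clearbody tau; rewrite ler_pdivlMr// => mlambda.
have nR : 0 < n%:R :> R by rewrite ltr0n.
have mR : 0 < m%:R :> R by rewrite ltr0n.
have nmE : (n + m)%:R = n%:R + m%:R :> R by rewrite natrD.
have nmR : 0 < (n + m)%:R :> R by rewrite ltr0n addn_gt0 n0.
set a := Num.sqrt _.
have a2 : a ^+ 2 = n%:R * m%:R / (n + m)%:R.
  by rewrite sqr_sqrtr ?natrM// divr_ge0 ?mulr_ge0 // ltW.
have a0 : 0 <= a by exact: sqrtr_ge0.
clearbody a.
(* The weights of one observation of each sample. The total squared weights are [m / (n + m)] and
   [n / (n + m)], which tend to [lambda] and [1 - lambda]. *)
pose alpha := a / n%:R; pose beta := a / m%:R.
have alpha0 : 0 <= alpha by rewrite divr_ge0// ltW.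
have beta0 : 0 <= beta by rewrite divr_ge0// ltW.
have alpha2 : n%:R * alpha ^+ 2 = m%:R / (n + m)%:R.
  by rewrite /alpha expr_div_n a2 nmE; field; rewrite -nmE !gt_eqF.
have beta2 : m%:R * beta ^+ 2 = 1 - m%:R / (n + m)%:R.
  by rewrite /beta expr_div_n a2 nmE; field; rewrite -nmE !gt_eqF.
have small k g : (0 < k)%N -> 0 <= g -> k%:R * g ^+ 2 <= 1 -> k%:R^-1 <= tau ^+ 2 -> g <= tau.
  move=> k0 g0 kg kt; rewrite -(@ler_pXn2r _ 2)// ?nnegrE ?(ltW tau0)//.
  by apply: le_trans kt; rewrite -[leRHS]mul1r ler_pdivlMr ?ltr0n// mulrC.
have mnm1 : 0 <= (m%:R / (n + m)%:R : R) <= 1.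
  by rewrite divr_ge0 ?(ltW mR) ?(ltW nmR)//= ler_pdivrMr// mul1r ler_nat leq_addl.
have alphat : alpha <= tau.
  by apply: (small n) => //; rewrite alpha2; case/andP: mnm1.
have betat : beta <= tau.
  by apply: (small m) => //; rewrite beta2; lra.
pose phi (k : (nat + nat)%type) := match k return T -> R with
  | inl _ => fun x => alpha * (u x - Pu) | inr _ => fun y => beta * (v y - Qv) end.
pose delta (k : (nat + nat)%type) := match k with inl _ => alpha * M | inr _ => beta * M end.
pose js := [seq inl i | i <- index_iota 0 n] ++ [seq inr j | j <- index_iota 0 m] : seq (nat + nat).
have sumE (F : (nat + nat)%type -> R) :
    \sum_(k <- js) F k = \sum_(i < n) F (inl (i : nat)) + \sum_(j < m) F (inr (j : nat)).
  by rewrite big_cat !big_map !big_mkord.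
have ujs : uniq js.
  rewrite cat_uniq !map_inj_uniq ?iota_uniq ?andbT => [|? ? []//|? ? []//].
  by apply/hasPn => _ /mapP[j _ ->]; apply/negP => /mapP[].
have bphi k : bmeas (phi k) by case: k => i; exact: bmeas_center.
have phi0 k : \int[mu k]_x phi k x = 0 by case: k => i; exact: integral_center.
have delta0 k : 0 <= delta k by case: k => i; exact: mulr_ge0.
have phid k x : `|phi k x| <= delta k.
  by case: k => i; rewrite /= normrM ger0_norm// ler_wpM2l.
have tau2M : tau * M ^+ 3 <= rho0 by move: tauM; rewrite mulrCA; lra.
have deltat k : delta k <= tau * M by case: k => i; rewrite ler_wpM2r.
have drho k : delta k ^+ 2 <= rho0.
  apply: le_trans tau2M; apply: (@le_trans _ _ ((tau * M) ^+ 2)).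
    by apply: lerXn2r => //; rewrite nnegrE// mulr_ge0// ltW.
  rewrite exprMn; apply: ler_pM; rewrite ?exprn_ge0// ?(ltW tau0)//.
    by rewrite expr2 -[leRHS]mulr1 ler_wpM2l// ltW.
  by rewrite (exprS _ 2) -[leLHS]mul1r ler_wpM2r ?exprn_ge0.
have sumd : \sum_(k <- js) delta k ^+ 3 <= rho0.
  rewrite sumE /= !sumr_const !card_ord -[_ *+ n]mulr_natl -[_ *+ m]mulr_natl.
  have cube k g : 0 <= g -> k%:R * g ^+ 2 <= 1 -> g <= tau -> k%:R * (g * M) ^+ 3 <= tau * M ^+ 3.
    move=> g0 kg gt; rewrite exprMn mulrA ler_wpM2r ?exprn_ge0//.
    rewrite (exprS _ 2) mulrCA -[leRHS]mulr1; apply: ler_pM => //.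
    by rewrite mulr_ge0// exprn_ge0.
  apply: le_trans tauM; rewrite mulrDl mul1r mulrDr.
  apply: lerD; apply: cube => //; first by rewrite alpha2; case/andP: mnm1.
  by rewrite beta2; lra.
have varE : \sum_(k <- js) \int[mu k]_x (phi k x ^+ 2) =
    m%:R / (n + m)%:R * varu + (1 - m%:R / (n + m)%:R) * varv.
  rewrite sumE /= !sumr_const !card_ord -[_ *+ n]mulr_natl -[_ *+ m]mulr_natl.
  by rewrite (integral_center_sqr _ bu) (integral_center_sqr _ bv) (mulrA n%:R) (mulrA m%:R) alpha2 beta2.
have sumv : `|\sum_(k <- js) \int[mu k]_x (phi k x ^+ 2) -
    (lambda * varu + (1 - lambda) * varv)| <= rho0.
  rewrite varE; move: mlambda (varu0) (varv0); move: (m%:R / _) (varu) (varv) => t p q.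
  have -> : t * p + (1 - t) * q - (lambda * p + (1 - lambda) * q) = (t - lambda) * (p - q) by ring.
  move=> tp p0 q0; rewrite normrM; apply: le_trans tp; apply: ler_wpM2l => //.
  by rewrite ler_norml; lra.
have := clt js phi delta ujs bphi phi0 delta0 phid drho sumd sumv.
congr (`|_ - _| <= _); apply: eq_Rintegral => w _; congr h.
rewrite sumE /= !integral_empirical// -!mulr_sumr !sumrB !sumr_const !card_ord -[_ *+ n]mulr_natl -[_ *+ m]mulr_natl.
rewrite /alpha /beta -/Pu -/Qv; move: (\sum_(i < n) _) (\sum_(i < m) _) => s s'.
by move: (Pu) (Qv) => p q; field; rewrite !gt_eqF.
Qed.

End two_sample_clt.

Section sinkhorn_clt.
Context d (W : measurableType d) (R : realType) (Pr : probability W R).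
Context d' (T : measurableType d') (X Y : nat -> W -> T) (P Q : probability T R).
Hypotheses (mX : forall i, measurable_fun setT (X i)) (mY : forall j, measurable_fun setT (Y j)).
Hypotheses (XP : forall i A, measurable A -> Pr (X i @^-1` A) = P A)
  (YQ : forall j A, measurable A -> Pr (Y j @^-1` A) = Q A).
Hypothesis indep : mutually_independent Pr
  (fun k : (nat + nat)%type => match k return W -> T with inl i => X i | inr j => Y j end).
Variables (c : T * T -> R) (K : R).
Hypotheses (bc : bmeas c) (cK : forall z, `|c z| <= K).

Local Notation statistic n m := (fun w => Num.sqrt ((n * m)%:R / (n + m)%:R) *
  (sinkhorn_cost c (empirical (fun i => X i w) n) (empirical (fun j => Y j w) m) -
   sinkhorn_cost c P Q)).

Lemma measurable_statistic n m : measurable_fun setT (statistic n m).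
Proof.
(* Measurability is required along the whole sequence, including empty samples; there the scaling
   factor is zero. *)
case: n => [|n].
  by rewrite (_ : statistic _ _ = cst 0)//; apply/funext => w; rewrite mul0n mul0r sqrtr0 mul0r.
case: m => [|m].
  by rewrite (_ : statistic _ _ = cst 0)//; apply/funext => w; rewrite muln0 mul0r sqrtr0 mul0r.
apply: measurable_funM => //; apply: measurable_funB => //.
exact: (measurable_sinkhorn_cost_empirical bc cK).
Qed.

Lemma sinkhorn_clt (h : R -> R) (H L lambda eta : R) :
  measurable_fun [set: R] h -> (forall x, `|h x| <= H) ->
  0 <= L -> (forall x y, `|h x - h y| <= L * `|x - y|) ->
  0 < lambda < 1 -> 0 < eta ->
  exists2 rho : R, 0 < rho & forall n m : nat, (0 < n)%N -> (0 < m)%N ->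
  n%:R^-1 <= rho -> m%:R^-1 <= rho -> `|m%:R / (n + m)%:R - lambda| <= rho ->
  `|\int[Pr]_w h (statistic n m w) -
    \int[gaussian (sinkhorn_variance c P Q lambda)]_x h x| <= eta.
Proof.
move=> mh hH L0 hL lambda01 eta0.
have [u [v [bu bv wQ wP varE]]] := dual_solution bc cK P Q.
have eta20 : 0 < eta / 2 by rewrite divr_gt0.
have [rho0 rho00 clt] := two_sample_clt mX mY XP YQ indep bu bv mh hH L0 hL lambda01 eta20.
have [C C0 lin] := sinkhorn_cost_linearization mX mY XP YQ indep bc cK bu bv wQ wP.
(* Chosen so that a remainder of mean [2 * C * tau] moves the [L]-Lipschitz [h] by at most [eta / 2]
   in mean. *)
pose tau := eta / 2 / (2 * L * C + 1).
have LC0 : 0 < 2 * L * C + 1 by rewrite ltr_wpDl// !mulr_ge0.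
have tau0 : 0 < tau by rewrite divr_gt0.
have tauE : L * (C * (2 * tau)) <= eta / 2.
  have : tau * (2 * L * C + 1) = eta / 2 by rewrite divfK// gt_eqF.
  by have := ltW tau0; rewrite mulrDr mulr1; move: (tau) => t; nra.
exists (Num.min rho0 (tau ^+ 2)); first by rewrite lt_min rho00 exprn_gt0.
clearbody tau.
move=> n m n0 m0; rewrite !le_min => /andP[nrho ntau] /andP[mrho mtau] /andP[lrho _].
have := clt n m n0 m0 nrho mrho lrho; rewrite -varE.
have [Rem [bRem RemC] linRem] := lin n m n0 m0.
have nR : 0 < n%:R :> R by rewrite ltr0n.
have mR : 0 < m%:R :> R by rewrite ltr0n.
have nmR : 0 < n%:R + m%:R :> R by rewrite addr_gt0.
have mst := measurable_statistic n m.
set a := Num.sqrt _ in mst *.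
have a0 : 0 <= a by exact: sqrtr_ge0.
have a2 : a ^+ 2 = n%:R * m%:R / (n%:R + m%:R).
  by rewrite sqr_sqrtr natrM natrD// divr_ge0 ?mulr_ge0 // ltW.
clearbody a.
(* [a ^+ 2] is the reciprocal of [1/n + 1/m], so the left side is the square root of that sum, at
   most [2 * tau] when both terms are at most [tau ^+ 2]. *)
have arate : a * (n%:R^-1 + m%:R^-1) <= 2 * tau.
  rewrite -(@ler_pXn2r _ 2)// ?nnegrE ?mulr_ge0 ?addr_ge0 ?invr_ge0 ?(ltW nR) ?(ltW mR) ?(ltW tau0)//.
  have -> : (a * (n%:R^-1 + m%:R^-1)) ^+ 2 = n%:R^-1 + m%:R^-1.
    by rewrite exprMn a2; field; rewrite !gt_eqF.
  rewrite exprMn; move: ntau mtau (sqr_ge0 tau); move: (_ ^-1) (_ ^-1) (tau ^+ 2) => *; lra.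
set Pu := \int[P]_x u x; set Qv := \int[Q]_y v y.
pose lin_ w := a * ((\int[empirical (fun i => X i w) n]_x u x - Pu) +
  (\int[empirical (fun j => Y j w) m]_y v y - Qv)).
have mlin : measurable_fun setT lin_.
  have mE (V : nat -> W -> T) k f : (0 < k)%N -> bmeas f ->
      (forall i, measurable_fun setT (V i)) ->
      measurable_fun setT (fun w => \int[empirical (fun i => V i w) k]_x f x).
    move=> k0 bf mV; under eq_fun do rewrite integral_empirical//.
    apply: measurable_funM => //; apply: measurable_sum => i.
    exact: (measurableT_comp (bmeas_fun bf) (mV i)).
  apply: measurable_funM => //; apply: measurable_funD; apply: measurable_funB => //; exact: mE.
have bh : bmeasR h := bmeas_intro mh hH.
have bhl : bmeas (fun w => h (lin_ w)) := bmeas_comp bh mlin.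
have bhs := bmeas_comp bh mst.
rewrite -[X in `|X - _| <= eta / 2]/(\int[Pr]_w h (lin_ w)).
have : `|\int[Pr]_w (h (a * (sinkhorn_cost c (empirical (fun i => X i w) n)
    (empirical (fun j => Y j w) m) - sinkhorn_cost c P Q)) - h (lin_ w))| <= eta / 2.
  apply: le_trans tauE; apply: le_trans (le_norm_integral_bounded _ (bmeasB bhs bhl)) _.
  have bR : bmeas (fun w => (L * a) * Rem w).
    by apply: bmeasM => //; exact: bmeas_cst.
  apply: (@le_trans _ _ (\int[Pr]_w ((L * a) * Rem w))).
    apply: le_integral_bounded => // [|w].
      exact/bmeas_norm/bmeasB.
    apply: (le_trans (hL _ _)); rewrite -mulrA ler_wpM2l// /lin_ -mulrBr normrM (ger0_norm a0).
    by rewrite ler_wpM2l.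
  rewrite integral_boundedZ// -mulrA ler_wpM2l//.
  apply: (@le_trans _ _ (a * (C * (n%:R^-1 + m%:R^-1)))); first by rewrite ler_wpM2l.
  by rewrite mulrCA ler_wpM2l.
rewrite (integral_boundedB _ bhs bhl).
move: (\int[Pr]_w h _) (\int[Pr]_w h _) (\int[gaussian _]_x h x) => x y z.
by rewrite !ler_norml => /andP[? ?] /andP[? ?]; apply/andP; split; lra.
Qed.

End sinkhorn_clt.

(** * Convergence in distribution *)

Section portmanteau.
Context {R : realType}.
Implicit Types (h : R -> R) (mu : probability (measurableTypeR R) R).

Lemma lipschitz_continuous (g : R -> R) (L : R) : 0 <= L ->
  (forall x y, `|g x - g y| <= L * `|x - y|) -> continuous g.
Proof.
move=> L0 gL x; apply/cvgrPdist_le => e e0.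
have L10 : 0 < L + 1 by rewrite ltr_wpDl.
near=> y; apply: (le_trans (gL x y)).
have : `|x - y| <= e / (L + 1).
  by near: y; apply: cvgr_dist_le => //; rewrite divr_gt0.
rewrite ler_pdivlMr// mulrDr mulr1 mulrC => xy.
by rewrite (le_trans _ xy)// lerDl.
Unshelve. all: by end_near.
Qed.

(* The infimal convolutions of h with N |.| are N-Lipschitz and increase to h. *)
Lemma lipschitz_minorant h (H : R) mu (eta : R) :
  continuous h -> (forall x, `|h x| <= H) -> 0 < eta ->
  exists g L, [/\ 0 <= L, forall x y, `|g x - g y| <= L * `|x - y|,
    forall x, `|g x| <= H, forall x, g x <= h x &
    \int[mu]_x h x - eta <= \int[mu]_x g x].
Proof.
move=> ch hH eta0.
pose A N x := range (fun y => h y + N%:R * `|x - y|).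
pose g N x := inf (A N x).
have hl y : - H <= h y by have := hH y; rewrite ler_norml => /andP[].
have hu y : h y <= H by have := hH y; rewrite ler_norml => /andP[].
have A0 N x : A N x !=set0 by exists (h x + N%:R * `|x - x|), x.
have Ab N x : lbound (A N x) (- H).
  by move=> _ [y _ <-]; rewrite (le_trans (hl y))// lerDl mulr_ge0.
have gle N x y : g N x <= h y + N%:R * `|x - y|.
  by apply: ge_inf; [exists (- H); exact: Ab|exists y].
have leg N x r : (forall y, r <= h y + N%:R * `|x - y|) -> r <= g N x.
  by move=> rh; apply: lb_le_inf => // _ [y _ <-]; exact: rh.
have gh N x : g N x <= h x by have := gle N x x; rewrite subrr normr0 mulr0 addr0.
have gH N x : `|g N x| <= H.
  by rewrite ler_norml (le_trans (gh N x) (hu x)) andbT; apply: lb_le_inf => //; exact: Ab.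
have gL N x y : `|g N x - g N y| <= N%:R * `|x - y|.
  have gL1 x' y' : g N x' - N%:R * `|x' - y'| <= g N y'.
    apply: leg => z; rewrite lerBlDr (le_trans (gle N x' z))// -addrA lerD2l -mulrDr ler_wpM2l//.
    by rewrite [leRHS]addrC ler_distD.
  have := gL1 x y; have := gL1 y x; rewrite (distrC y x) ler_norml.
  by move: (N%:R * _) => r *; apply/andP; split; lra.
have gcvg x : g ^~ x @ \oo --> h x.
  apply/cvgrPdist_le => e e0.
  have [r /= r0 hr] : \forall y \near x, `|h x - h y| <= e by exact: cvgr_dist_le (ch x) _ e0.
  near=> N; rewrite ger0_norm ?subr_ge0// lerBlDr -lerBlDl; apply: leg => y.
  (* Beyond distance [r] the penalty then exceeds the whole range [2 * H] of [h], so only points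
     near [x] compete in the infimum. *)
  have Nr : 2 * H / r <= N%:R by near: N; exact: nbhs_infty_ger.
  have [xy|xy] := ltP `|x - y| r.
    have := hr y xy; rewrite ler_norml => /andP[_ hxy].
    have : 0 <= N%:R * `|x - y| by rewrite mulr_ge0.
    by move: (_ * _) => z z0; lra.
  have : 2 * H <= N%:R * `|x - y|.
    by move: Nr; rewrite ler_pdivrMr// => /le_trans; apply; rewrite ler_wpM2l.
  by have := hl y; have := hu x; move: (_ * `|_|) => z; lra.
have mg N : measurable_fun [set: measurableTypeR R] (g N).
  by apply: continuous_measurable_fun; apply: lipschitz_continuous (gL N).
have bh : bmeasR h.
  by apply: bmeas_intro hH; exact: continuous_measurable_fun.
have bg N : bmeasR (g N) := bmeas_intro (mg N) (gH N).
have icvg : (\int[mu]_x (g N x)%:E)%E @[N --> \oo] --> (\int[mu]_x (h x)%:E)%E.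
  have [] // := @dominated_convergence _ (measurableTypeR R) R mu setT measurableT
    (fun N x => (g N x)%:E) (EFin \o h) (EFin \o cst H).
  - by move=> N; apply/measurable_EFinP.
  - by apply/measurable_EFinP; exact: bmeas_fun bh.
  - by apply: aeW => x _; apply/cvg_EFin; [exact: nearW|exact: gcvg].
  - exact: (bmeas_integrable mu (bmeas_cst _ H)).
  - by apply: aeW => x N _; rewrite lee_fin.
have icvgR : \int[mu]_x g N x @[N --> \oo] --> \int[mu]_x h x.
  move: icvg; rewrite EFin_integral_bounded//.
  under eq_cvg do rewrite EFin_integral_bounded//.
  by move=> /fine_cvg.
have /cvgrPdist_le /(_ _ eta0) [N _ /(_ N (leqnn N)) /= gN] := icvgR.
exists (g N), N%:R; split=> //.
by move: gN; rewrite ler_norml; lra.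
Unshelve. all: by end_near.
Qed.

(** A Lipschitz minorant yields an asymptotic lower bound for the expectation of a continuous
    function; the upper bound is the lower bound for [- h]. *)
Lemma portmanteau d (W : measurableType d) (Pr : probability W R) (Z : nat -> W -> R) mu :
  (forall k, measurable_fun [set: W] (Z k)) ->
  (forall (g : R -> R) (H L : R), measurable_fun [set: R] g -> (forall x, `|g x| <= H) -> 0 <= L ->
    (forall x y, `|g x - g y| <= L * `|x - y|) ->
    forall eta : R, 0 < eta -> \forall k \near \oo,
      `|\int[Pr]_w g (Z k w) - \int[mu]_x g x| <= eta) ->
  cvg_in_distribution Pr Z mu.
Proof.
move=> mZ lip; split=> // h ch [H0 [_ /(_ (H0 + 1))]].
rewrite ltrDl ltr01 => /(_ isT) hH.
have {}hH x : `|h x| <= H0 + 1 by exact: hH.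
move: (H0 + 1) hH => H hH {H0}.
have bh : bmeasR h.
  by apply: bmeas_intro hH; exact: continuous_measurable_fun.
have bhZ k : bmeas (fun w => h (Z k w)) := bmeas_comp bh (mZ k).
rewrite EFin_integral_bounded//.
under eq_cvg do rewrite unlock /= EFin_integral_bounded//.
apply: cvg_EFin; first by apply: nearW.
apply/cvgrPdist_le => eta eta0; have eta20 : 0 < eta / 2 by rewrite divr_gt0.
have lower (f : R -> R) : continuous f -> (forall x, `|f x| <= H) ->
    \forall k \near \oo, \int[mu]_x f x - eta <= \int[Pr]_w f (Z k w).
  move=> cf fH; have [g [L [L0 gL gH gf fg]]] := lipschitz_minorant mu cf fH eta20.
  have mg : measurable_fun [set: R] g.
    by apply: continuous_measurable_fun; apply: lipschitz_continuous gL.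
  have bg : bmeasR g := bmeas_intro mg gH.
  have bf : bmeasR f.
    by apply: bmeas_intro fH; exact: continuous_measurable_fun.
  have := lip g H L mg gH L0 gL _ eta20; apply: filterS => k.
  have : \int[Pr]_w g (Z k w) <= \int[Pr]_w f (Z k w).
    apply: le_integral_bounded => [||w]; last exact: gf.
      exact: (bmeas_comp bg (mZ k)).
    exact: (bmeas_comp bf (mZ k)).
  move: fg; move: (\int[Pr]_w g _) (\int[Pr]_w f _) (\int[mu]_x g x) (\int[mu]_x f x) => p q r s.
  by rewrite ler_norml => ? ? /andP[? ?]; lra.
have cNh : continuous (fun x => - h x) by move=> x; apply: continuousN; exact: ch.
have NhH x : `|- h x| <= H by rewrite normrN.
near=> k.
have l1 : \int[mu]_x h x - eta <= \int[Pr]_w h (Z k w) by near: k; exact: lower.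
have l2 : \int[mu]_x (- h x) - eta <= \int[Pr]_w (- h (Z k w)) by near: k; exact: (lower (fun x => - h x)).
have NE d' (S : measurableType d') (nu : probability S R) (f : S -> R) : bmeas f ->
    \int[nu]_x (- f x) = - \int[nu]_x f x.
  move=> bf; rewrite -mulN1r -integral_boundedZ//.
  by apply: eq_Rintegral => x _; rewrite mulN1r.
move: l2; rewrite !NE// => l2.
move: l1 l2; rewrite /=; move: (\int[mu]_x h x) (\int[Pr]_w h _) => p q *.
by rewrite ler_norml; apply/andP; split; lra.
Unshelve. all: by end_near.
Qed.

End portmanteau.

Lemma countable_bigcup_measurable d (T : sigmaRingType d) (I : pointedType) (S : set I)
    (F : I -> set T) : countable S -> (forall i, S i -> measurable (F i)) ->
  measurable (\bigcup_(i in S) F i).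
Proof.
move=> /countable_injP[f injf] mF.
rewrite -(injpinv_image (fun=> point) injf) bigcup_image.
by apply: bigcup_measurable => n [i Si <-]; rewrite /= pinvKV ?inE//; exact: mF.
Qed.

(** * Borel sets of a product of Polish spaces *)

Section borel_product.
Context {R : realType} {T : ptopologicalType}.

(** The base consists of the preimages of balls of radius [1 / (n + 1)] around the points of the
    dense set. Interiors are taken because balls of a pseudometric structure need not be open. *)
Lemma polish_second_countable : polish_space R T -> @second_countable T.
Proof.
move=> [[M [f [g [_ fK gK cf cg]]]] [D cD dD]].
pose r n : R := n.+1%:R^-1.
pose B (z : T * nat) : set T := f @^-1` (ball (f z.1) (r z.2))°.
exists (B @` (D `*` setT)).
  by apply: sub_countable (card_image_le _ _) _; exact: countableX.
split=> [_ [z _ <-]|x V nV].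
  by apply: open_comp; [move=> y _; exact: cf|exact: open_interior].
have /nbhs_ballP[e /= e0 eV] : nbhs (f x) (g @^-1` V).
  by apply: cg; rewrite fK.
have [n ne] : exists n, r n < e / 2.
  have [//|N] := @ltr_add_invr R 0%R (e / 2) _; first by rewrite divr_gt0.
  by rewrite add0r; exists N.
have rn0 : 0 < r n by rewrite invr_gt0.
have rn20 : 0 < r n / 2 by rewrite divr_gt0.
have [d [xd Dd]] : (f @^-1` (ball (f x) (r n / 2))°) `&` D !=set0.
  apply: dD; last by apply: open_comp; [move=> y _; exact: cf|exact: open_interior].
  by exists x; exact: nbhsx_ballx.
have {}xd : ball (f x) (r n / 2) (f d) by exact: interior_subset.
exists (B (d, n)); first split.
- by exists (d, n).
- have : nbhs (f x) (ball (f d) (r n)); last by [].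
  apply: filterS (nbhsx_ballx (f x) _ rn20) => y xy.
  by rewrite [r n]splitr; apply: ball_triangle xy; exact: ball_sym.
move=> y /interior_subset /= dy; rewrite -[y]fK; apply: eV.
rewrite /= [e]splitr; apply: ball_triangle; last first.
  by apply: le_ball dy; exact: ltW.
by apply: le_ball xd; rewrite (le_trans _ (ltW ne))// ler_pdivrMr// ler_peMr ?ler1n// ltW.
Qed.

(** An open set of the product is a union of rectangles of basic open sets, and there are countably
    many of these. Measurability for the Borel sets of the product thus becomes measurability for
    the product sigma-algebra, where couplings live. *)
Lemma measurable_open_prod (A : set (T * T)) : @second_countable T -> open A ->
  measurable (A : set (borel T * borel T)).
Proof.
move=> [B cB [oB bB]] oA.
pose S := [set z : set T * set T | [/\ B z.1, B z.2 & z.1 `*` z.2 `<=` A]].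
have -> : A = \bigcup_(z in S) (z.1 `*` z.2).
  apply/seteqP; split=> [[x y] Axy|xy [z [_ _ zA] zxy]]; last exact: zA.
  have [[U V] /= [nU nV] UVA] : nbhs (x, y) A by exact: open_nbhs_nbhs.
  have [U' [BU' U'x] UU'] := bB _ _ nU; have [V' [BV' V'y] VV'] := bB _ _ nV.
  exists (U', V') => //; split=> // -[a b] /= [aU bV].
  by apply: UVA; split; [exact: UU'|exact: VV'].
have cS : countable S.
  apply: (@sub_countable _ _ _ (B `*` B)); last exact: countableX.
  by apply: subset_card_le => -[U V] [].
have mB U : B U -> measurable (U : set (borel T)).
  by move=> BU; apply: sub_sigma_algebra; exact: oB.
rewrite -[measurable _]/(measurable (\bigcup_(z in S)
  ((z.1 : set (borel T)) `*` (z.2 : set (borel T))))).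
by apply: countable_bigcup_measurable => // z [Bz1 Bz2 _]; apply: measurableX; exact: mB.
Qed.

Lemma bmeas_borel_prod (c : T * T -> R) : @second_countable T ->
  @bounded_measurable _ (borel (T * T)%type) R c ->
  @bounded_measurable _ (borel T * borel T)%type R c.
Proof.
move=> scT [mc bc]; split=> // _ B mB; rewrite setTI.
have := mc measurableT B mB; rewrite setTI; apply: smallest_sub.
  exact: sigma_algebra_measurable.
by move=> A oA; exact: measurable_open_prod.
Qed.

End borel_product.

Theorem corollary4p1 (R : realType) (Omega : ptopologicalType)
    (hOmega : polish_space R Omega)
    (c : borel Omega * borel Omega -> R)
    (hc : @bounded_measurable _ (borel (Omega * Omega)%type) R c)
    (P Q : probability (borel Omega) R)
    (d : measure_display) (W : measurableType d) (Pr : probability W R)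
    (X Y : nat -> {RV Pr >-> borel Omega})
    (hX : forall i, has_law (X i) P)
    (hY : forall j, has_law (Y j) Q)
    (hXY : mutually_independent Pr
             (fun k : (nat + nat)%type =>
                match k return W -> borel Omega with
                | inl i => X i
                | inr j => Y j
                end))
    (lambda : R) (hlambda : 0 < lambda < 1)
    (n m : nat -> nat)
    (hn : n k @[k --> \oo] --> \oo)
    (hm : m k @[k --> \oo] --> \oo)
    (hnm : (m k)%:R / (n k + m k)%:R @[k --> \oo] --> lambda) :
  cvg_in_distribution Pr
    (fun k w =>
       Num.sqrt ((n k * m k)%:R / (n k + m k)%:R) *
       (sinkhorn_cost c (empirical (fun i => X i w) (n k))
                        (empirical (fun j => Y j w) (m k))
        - sinkhorn_cost c P Q))
    (gaussian (sinkhorn_variance c P Q lambda)).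
Proof.
have bc := bmeas_borel_prod (polish_second_countable hOmega) hc.
have [K K0 cK] := bmeas_bound bc.
have mX i : measurable_fun setT (X i) by exact: measurable_funPT.
have mY j : measurable_fun setT (Y j) by exact: measurable_funPT.
apply: portmanteau => [k|h H L mh hH L0 hL eta eta0].
  exact: (measurable_statistic P Q mX mY bc cK).
have [rho rho0 clt] := sinkhorn_clt mX mY hX hY hXY bc cK mh hH L0 hL hlambda eta0.
have large (s : nat -> nat) : s k @[k --> \oo] --> \oo ->
    \forall k \near \oo, (0 < s k)%N /\ (s k)%:R^-1 <= rho.
  move=> sinf; near=> k.
  have s0 : (0 < s k)%N by near: k; exact: (sinf _ (nbhs_infty_gt 0)).
  split=> //; rewrite invf_ple ?posrE ?ltr0n//.
  by near: k; exact: (sinf _ (nbhs_infty_ger _)).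
near=> k.
have [n0 nrho] : (0 < n k)%N /\ (n k)%:R^-1 <= rho by near: k; exact: large.
have [m0 mrho] : (0 < m k)%N /\ (m k)%:R^-1 <= rho by near: k; exact: large.
apply: clt => //; rewrite distrC; near: k.
by move/cvgrPdist_le : hnm; apply.
Unshelve. all: by end_near.
Qed.
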